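(* Let $k$ be a commutative ring, $G$ a finite group, and $V$ a $kG$-module that is free of finite rank as a $k$-module. Let $\mathbf{C}$ be any one of the categories $\mathbf{Cpx}(kG)$, $\mathbf{cpx}(kG)$, $\mathbf{Cpx}^*(kG)$ or $\mathbf{cpx}^*(kG)$ for $*=+,-$ or $b$. Let $\mathscr{E}$ be the collection of $V$-term split sequences in $\mathbf{C}$. Then the exact category $(\mathbf{C},\mathscr{E})$, whose associated quotient category is $\mathcal{K}_{V\text{-ts}}(\mathbf{C})=\mathbf{C}/\mathscr{E}\text{-}\mathbf{Proj}$, is a Frobenius category. The $\mathscr{E}$-projective objects are precisely the split and contractible complexes of $V$-projective modules; that is, $\mathscr{E}\text{-}\mathbf{Proj}$ contains all complexes of the form $\cdots\to0\to W\to W\to0\to\cdots$ where $W$ is $V$-projective, the nonzero terms occur in consecutive degrees and the boundary map is the identity, and it consists of all direct sums of such complexes when such a direct sum is in $\mathbf{C}$. If $k$ is a field, then the category $\mathcal{K}_{V\text{-ts}}(\mathbf{cpx}^b(kG))$ is a Krull-Schmidt category.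
   Context: $\mathbf{Cpx}(kG)$ is the category of cochain complexes of $kG$-modules and chain maps, $\mathbf{cpx}(kG)$ the full subcategory of complexes of finitely generated $kG$-modules; superscripts $+,-,b$ denote the full subcategories of complexes bounded above, bounded below, and both. $\otimes=\otimes_k$ with diagonal $G$-action. A $kG$-module is $V$-projective if it is a direct summand of $V\otimes X$ for some $kG$-module $X$. An exact sequence $E$ of complexes is $V$-term split if in each degree $V\otimes E$ is a split sequence of $kG$-modules. An object $P$ is $\mathscr{E}$-projective if $\mathrm{Hom}(P,-)$ sends each sequence in $\mathscr{E}$ to an exact sequence; $\mathscr{E}$-injective is dual. An exact category $(\mathbf{C},\mathscr{E})$ is Frobenius if it has enough $\mathscr{E}$-projectives and enough $\mathscr{E}$-injectives and these two classes of objects coincide. $\mathbf{C}/\mathscr{E}\text{-}\mathbf{Proj}$ has the objects of $\mathbf{C}$ and the morphisms of $\mathbf{C}$ modulo those factoring through an $\mathscr{E}$-projective object. An additive category is Krull-Schmidt if every object is a finite direct sum of indecomposable objects, uniquely up to order and isomorphism of the summands.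
   Formalization: V is assumed free of positive finite rank: for V = 0 and k nonzero every exact sequence is V-term split, so the complex kG→kG (identity) is a nonzero E-projective although 0 is the only V-projective module, and the description of E-Proj fails. *)

(* Defs.v *)
From HB Require Import structures.
From mathcomp Require Import fingroup all_boot all_order all_algebra.
From mathcomp Require Import boolp.

Set Implicit Arguments.
Unset Strict Implicit.
Unset Printing Implicit Defensive.

Import Order.TTheory GRing.Theory Num.Theory.
Local Open Scope ring_scope.
Local Open Scope quotient_scope.

Record preaddcat := PreAddCat {
  obj :> Type;
  hom : obj -> obj -> zmodType;
  idm : forall X, hom X X;
  comp : forall X Y Z, hom Y Z -> hom X Y -> hom X Z;
  comp_assoc : forall X Y Z T (h : hom Z T) (g : hom Y Z) (f : hom X Y),
    comp h (comp g f) = comp (comp h g) f;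
  comp_idl : forall X Y (f : hom X Y), comp (idm Y) f = f;
  comp_idr : forall X Y (f : hom X Y), comp f (idm X) = f;
  comp_addl : forall X Y Z (g g' : hom Y Z) (f : hom X Y),
    comp (g + g') f = comp g f + comp g' f;
  comp_addr : forall X Y Z (g : hom Y Z) (f f' : hom X Y),
    comp g (f + f') = comp g f + comp g f' }.

Arguments hom {p} X Y : rename.
Arguments idm {p} X : rename.
Arguments comp {p X Y Z} g f : rename.

Notation "g \oc f" := (comp g f) (at level 40, left associativity).

Section Preadditive.
Variable C : preaddcat.
Implicit Types X Y Z S : C.

Lemma comp0l X Y Z (f : hom X Y) : (0 : hom Y Z) \oc f = 0.
Proof. by apply: (addrI (0 \oc f)); rewrite -comp_addl !addr0. Qed.

Lemma comp0r X Y Z (g : hom Y Z) : g \oc (0 : hom X Y) = 0.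
Proof. by apply: (addrI (g \oc 0)); rewrite -comp_addr !addr0. Qed.

Lemma compNl X Y Z (g : hom Y Z) (f : hom X Y) : (- g) \oc f = - (g \oc f).
Proof. by apply: (addrI (g \oc f)); rewrite -comp_addl !subrr comp0l. Qed.

Lemma compNr X Y Z (g : hom Y Z) (f : hom X Y) : g \oc (- f) = - (g \oc f).
Proof. by apply: (addrI (g \oc f)); rewrite -comp_addr !subrr comp0r. Qed.

Definition isomorphism X Y (f : hom X Y) :=
  exists g : hom Y X, g \oc f = idm X /\ f \oc g = idm Y.

Definition isomorphic X Y := exists f : hom X Y, isomorphism f.

Definition is_zero X := idm X = 0.

Definition biproduct X Y S (iX : hom X S) (iY : hom Y S)
    (pX : hom S X) (pY : hom S Y) :=
  [/\ pX \oc iX = idm X, pY \oc iY = idm Y, pY \oc iX = 0, pX \oc iY = 0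
    & iX \oc pX + iY \oc pY = idm S].

Definition is_biproduct X Y S :=
  exists iX iY pX pY, @biproduct X Y S iX iY pX pY.

Definition is_additive := (exists Z, is_zero Z) /\
  (forall X Y, exists S, is_biproduct X Y S).

Definition is_finite_sum n (F : 'I_n -> C) S :=
  exists (inj : forall i, hom (F i) S) (prj : forall i, hom S (F i)),
  [/\ forall i, prj i \oc inj i = idm (F i),
      forall i j, i != j -> prj j \oc inj i = 0
    & \sum_i inj i \oc prj i = idm S].

Definition is_coproduct (I : Type) (F : I -> C) S
    (inj : forall i, hom (F i) S) :=
  forall T (f : forall i, hom (F i) T),
    exists! h : hom S T, forall i, h \oc inj i = f i.

Definition indecomposable X :=
  ~ is_zero X /\ forall Y Z, is_biproduct Y Z X -> is_zero Y \/ is_zero Z.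

Definition is_kernel X Y Z (i : hom X Y) (p : hom Y Z) :=
  p \oc i = 0 /\ forall T (f : hom T Y), p \oc f = 0 ->
    exists! g : hom T X, i \oc g = f.

Definition is_cokernel X Y Z (i : hom X Y) (p : hom Y Z) :=
  p \oc i = 0 /\ forall T (f : hom Y T), f \oc i = 0 ->
    exists! g : hom Z T, g \oc p = f.

Definition is_pushout X Y X' Y' (i : hom X Y) (f : hom X X')
    (i' : hom X' Y') (f' : hom Y Y') :=
  f' \oc i = i' \oc f /\
  forall T (u : hom Y T) (v : hom X' T), u \oc i = v \oc f ->
    exists! h : hom Y' T, h \oc f' = u /\ h \oc i' = v.

Definition is_pullback Y Z Y' Z' (p : hom Y Z) (f : hom Z' Z)
    (p' : hom Y' Z') (f' : hom Y' Y) :=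
  p \oc f' = f \oc p' /\
  forall T (u : hom T Y) (v : hom T Z'), p \oc u = f \oc v ->
    exists! h : hom T Y', f' \oc h = u /\ p' \oc h = v.

End Preadditive.

Record addcat := AddCat { addcat_base :> preaddcat; addcatP : is_additive addcat_base }.

Definition krull_schmidt (C : addcat) : Prop :=
  (forall X : C, exists n (F : 'I_n -> C),
     (forall i, indecomposable (F i)) /\ is_finite_sum F X) /\
  (forall (X : C) n m (F : 'I_n -> C) (F' : 'I_m -> C),
     (forall i, indecomposable (F i)) -> (forall i, indecomposable (F' i)) ->
     is_finite_sum F X -> is_finite_sum F' X ->
     exists2 s : 'I_n -> 'I_m, bijective s
       & forall i, isomorphic (F i) (F' (s i))).

(* 0 -> A -f-> B -g-> C -> 0 *)
Definition short_exact (A B C : zmodType) (f : A -> B) (g : B -> C) : Prop :=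
  [/\ injective f, forall y, g y = 0 <-> exists x, y = f x
    & forall z, exists y, g y = z].

Definition sequences (C : preaddcat) :=
  forall X Y Z : C, hom X Y -> hom Y Z -> Prop.

Section Exact.
Variables (C : addcat) (E : sequences C).

Definition inflation (X Y : C) (i : hom X Y) := exists Z (p : hom Y Z), E i p.
Definition deflation (Y Z : C) (p : hom Y Z) := exists X (i : hom X Y), E i p.

(* Quillen's axioms, in Buehler's self-dual form. *)
Record exact_category : Prop := ExactCategory {
  exact_kercoker : forall (X Y Z : C) (i : hom X Y) (p : hom Y Z),
    E i p -> is_kernel i p /\ is_cokernel i p;
  exact_iso : forall (X Y Z X' Y' Z' : C) (i : hom X Y) (p : hom Y Z)
      (i' : hom X' Y') (p' : hom Y' Z')
      (a : hom X X') (b : hom Y Y') (c : hom Z Z'),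
    isomorphism a -> isomorphism b -> isomorphism c ->
    b \oc i = i' \oc a -> c \oc p = p' \oc b -> E i p -> E i' p';
  exact_id_infl : forall X : C, inflation (idm X);
  exact_id_defl : forall X : C, deflation (idm X);
  exact_comp_infl : forall (X Y Z : C) (i : hom X Y) (j : hom Y Z),
    inflation i -> inflation j -> inflation (j \oc i);
  exact_comp_defl : forall (X Y Z : C) (p : hom X Y) (q : hom Y Z),
    deflation p -> deflation q -> deflation (q \oc p);
  exact_pushout : forall (X Y X' : C) (i : hom X Y) (f : hom X X'),
    inflation i -> exists (Y' : C) (i' : hom X' Y') (f' : hom Y Y'),
      is_pushout i f i' f' /\ inflation i';
  exact_pullback : forall (Y Z Z' : C) (p : hom Y Z) (f : hom Z' Z),
    deflation p -> exists (Y' : C) (p' : hom Y' Z') (f' : hom Y' Y),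
      is_pullback p f p' f' /\ deflation p' }.

Definition projective (P : C) :=
  forall (X Y Z : C) (i : hom X Y) (p : hom Y Z), E i p ->
    short_exact (fun f : hom P X => i \oc f) (fun f : hom P Y => p \oc f).

Definition injective_object (J : C) :=
  forall (X Y Z : C) (i : hom X Y) (p : hom Y Z), E i p ->
    short_exact (fun f : hom Z J => f \oc p) (fun f : hom Y J => f \oc i).

Definition enough_projectives :=
  forall X : C, exists P (p : hom P X), projective P /\ deflation p.

Definition enough_injectives :=
  forall X : C, exists J (i : hom X J), injective_object J /\ inflation i.

Record frobenius : Prop := Frobenius {
  frobenius_exact : exact_category;
  frobenius_proj : enough_projectives;
  frobenius_inj : enough_injectives;
  frobenius_eq : forall X : C, projective X <-> injective_object X }.

Definition factors_proj (X Y : C) (f : hom X Y) :=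
  exists (P : C) (u : hom X P) (v : hom P Y), projective P /\ f = v \oc u.

Lemma projective_zero (Z : C) : is_zero Z -> projective Z.
Proof.
move=> Z0; have hom0 (T : C) (f : hom Z T) : f = 0.
  by rewrite -(comp_idr f) Z0 comp0r.
move=> A B D i p _; split=> [f g _|f|f]; first by rewrite (hom0 _ f) (hom0 _ g).
  by split=> _; [exists 0; rewrite (hom0 _ f) comp0r | rewrite (hom0 _ f) comp0r].
by exists 0; rewrite (hom0 _ f) comp0r.
Qed.

Lemma projective_biproduct (P Q S : C) :
  is_biproduct P Q S -> projective P -> projective Q -> projective S.
Proof.
move=> [iP [iQ [pP [pQ [PP QQ QP PQ sum1]]]]] projP projQ A B D i p Eip.
have [injP midP surP] := projP _ _ _ _ _ Eip.
have [injQ midQ surQ] := projQ _ _ _ _ _ Eip.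
have split_hom (T : C) (f : hom S T) :
    f = (f \oc iP) \oc pP + (f \oc iQ) \oc pQ.
  by rewrite -!comp_assoc -comp_addr sum1 comp_idr.
split=> [f g /= fg|f|f].
- have eP : f \oc iP = g \oc iP by apply: injP; rewrite /= !comp_assoc fg.
  have eQ : f \oc iQ = g \oc iQ by apply: injQ; rewrite /= !comp_assoc fg.
  by rewrite (split_hom _ f) eP eQ -split_hom.
- split=> [pf|[x ->]]; last first.
    have piP := (midP (i \oc (x \oc iP))).2 (ex_intro _ _ erefl).
    have piQ := (midQ (i \oc (x \oc iQ))).2 (ex_intro _ _ erefl).
    rewrite (split_hom _ (p \oc (i \oc x))) -!(comp_assoc p) -!(comp_assoc i).
    rewrite (comp_assoc i _ pP) (comp_assoc i _ pQ) (comp_assoc p _ pP).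
    by rewrite (comp_assoc p _ pQ) piP piQ !comp0l addr0.
  have [x xP] : exists x, f \oc iP = i \oc x.
    by apply/midP; rewrite comp_assoc pf comp0l.
  have [y yP] : exists y, f \oc iQ = i \oc y.
    by apply/midQ; rewrite comp_assoc pf comp0l.
  exists (x \oc pP + y \oc pQ).
  by rewrite (split_hom _ f) xP yP comp_addr !comp_assoc.
have [x xP] := surP (f \oc iP); have [y yP] := surQ (f \oc iQ).
exists (x \oc pP + y \oc pQ).
by rewrite (split_hom _ f) -xP -yP comp_addr !comp_assoc.
Qed.

Definition proj_ideal (X Y : C) : {pred hom X Y} :=
  [pred f | `[< factors_proj f >]].

Lemma proj_ideal_closed (X Y : C) : zmod_closed (@proj_ideal X Y).
Proof.
split=> [|f g /asboolP[P [u [v [projP ->]]]] /asboolP[Q [w [x [projQ ->]]]]].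
  have [Z Z0] := (addcatP C).1.
  by apply/asboolP; exists Z, 0, 0; rewrite comp0r; split=> //; apply: projective_zero.
have [S [iP [iQ [pP [pQ S_PQ]]]]] := (addcatP C).2 P Q.
apply/asboolP; exists S, (iP \oc u - iQ \oc w), (v \oc pP + x \oc pQ); split.
  by apply: projective_biproduct projQ => //; [exists iP, iQ, pP, pQ; exact: S_PQ|].
have [PP QQ QP PQ _] := S_PQ.
rewrite comp_addr compNr !comp_addl -!comp_assoc !(comp_assoc pP) !(comp_assoc pQ).
by rewrite PP QQ QP PQ !comp0l !comp0r addr0 add0r !comp_idl.
Qed.

HB.instance Definition _ (X Y : C) :=
  GRing.isZmodClosed.Build (hom X Y) (@proj_ideal X Y) (@proj_ideal_closed X Y).

Definition quot_hom (X Y : C) : zmodType :=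
  Quotient.quot (@proj_ideal X Y : zmodClosed (hom X Y)).

Definition quot_class (X Y : C) (f : hom X Y) : quot_hom X Y :=
  \pi_(Quotient.quot (@proj_ideal X Y : zmodClosed (hom X Y))) f.

Definition quot_repr (X Y : C) (f : quot_hom X Y) : hom X Y :=
  repr (f : Quotient.quot (@proj_ideal X Y : zmodClosed (hom X Y))).

Lemma quot_reprK (X Y : C) (f : quot_hom X Y) : quot_class (quot_repr f) = f.
Proof. exact: reprK. Qed.

Lemma quot_classP (X Y : C) (f g : hom X Y) :
  quot_class f = quot_class g <-> factors_proj (f - g).
Proof.
split=> [/eqP|fg]; last apply/eqP.
  by rewrite /quot_class -Quotient.idealrBE => /asboolP.
by rewrite /quot_class -Quotient.idealrBE; apply/asboolP.
Qed.

Lemma quot_classD (X Y : C) (f g : hom X Y) :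
  quot_class (f + g) = quot_class f + quot_class g.
Proof. exact: Quotient.pi_add. Qed.

Lemma quot_class0 (X Y : C) : quot_class (0 : hom X Y) = 0.
Proof. by apply: (addrI (quot_class 0)); rewrite -quot_classD !addr0. Qed.

Definition quot_comp (X Y Z : C) (g : quot_hom Y Z) (f : quot_hom X Y) :
  quot_hom X Z := quot_class (quot_repr g \oc quot_repr f).

Lemma quot_compE (X Y Z : C) (g : hom Y Z) (f : hom X Y) :
  quot_comp (quot_class g) (quot_class f) = quot_class (g \oc f).
Proof.
set g' := quot_repr (quot_class g); set f' := quot_repr (quot_class f).
have /quot_classP[P [u [v [projP gP]]]] : quot_class g' = quot_class g.
  exact: quot_reprK.
have /quot_classP[Q [w [x [projQ fQ]]]] : quot_class f' = quot_class f.
  exact: quot_reprK.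
have e1 : quot_class (g' \oc f') = quot_class (g \oc f').
  apply/quot_classP; exists P, (u \oc f'), v; split=> //.
  by rewrite comp_assoc -gP comp_addl compNl.
have e2 : quot_class (g \oc f') = quot_class (g \oc f).
  apply/quot_classP; exists Q, w, (g \oc x); split=> //.
  by rewrite -comp_assoc -fQ comp_addr compNr.
by rewrite /quot_comp e1 e2.
Qed.

Lemma quot_compA (X Y Z T : C) (h : quot_hom Z T) (g : quot_hom Y Z)
    (f : quot_hom X Y) :
  quot_comp h (quot_comp g f) = quot_comp (quot_comp h g) f.
Proof.
rewrite -(quot_reprK h) -(quot_reprK g) -(quot_reprK f).
by rewrite !quot_compE comp_assoc.
Qed.

Lemma quot_comp1l (X Y : C) (f : quot_hom X Y) :
  quot_comp (quot_class (idm Y)) f = f.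
Proof. by rewrite -(quot_reprK f) quot_compE comp_idl. Qed.

Lemma quot_comp1r (X Y : C) (f : quot_hom X Y) :
  quot_comp f (quot_class (idm X)) = f.
Proof. by rewrite -(quot_reprK f) quot_compE comp_idr. Qed.

Lemma quot_compDl (X Y Z : C) (g g' : quot_hom Y Z) (f : quot_hom X Y) :
  quot_comp (g + g') f = quot_comp g f + quot_comp g' f.
Proof.
rewrite -(quot_reprK g) -(quot_reprK g') -(quot_reprK f).
by rewrite -quot_classD !quot_compE comp_addl quot_classD.
Qed.

Lemma quot_compDr (X Y Z : C) (g : quot_hom Y Z) (f f' : quot_hom X Y) :
  quot_comp g (f + f') = quot_comp g f + quot_comp g f'.
Proof.
rewrite -(quot_reprK g) -(quot_reprK f) -(quot_reprK f').
by rewrite -quot_classD !quot_compE comp_addr quot_classD.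
Qed.

Definition quot_preaddcat : preaddcat :=
  {| obj := C; hom := quot_hom; idm := fun X => quot_class (idm X);
     comp := quot_comp; comp_assoc := quot_compA;
     comp_idl := quot_comp1l; comp_idr := quot_comp1r;
     comp_addl := quot_compDl; comp_addr := quot_compDr |}.

Lemma quot_additive : is_additive quot_preaddcat.
Proof.
split.
  by have [Z Z0] := (addcatP C).1; exists Z; rewrite /is_zero /= Z0 quot_class0.
move=> X Y.
have [S [iX [iY [pX [pY [XX YY YX XY sum1]]]]]] := (addcatP C).2 X Y.
exists S, (quot_class iX), (quot_class iY), (quot_class pX), (quot_class pY).
by split; rewrite /= !quot_compE ?XX ?YY ?YX ?XY ?quot_class0 // -quot_classD sum1.
Qed.

Definition quot_proj : addcat := AddCat quot_additive.

End Exact.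

Section FullSubcategory.
Variables (C : preaddcat) (P : C -> Prop).

Definition full_preaddcat : preaddcat :=
  {| obj := {X : C | P X};
     hom := fun X Y => hom (sval X) (sval Y);
     idm := fun X => idm (sval X);
     comp := fun X Y Z g f => g \oc f;
     comp_assoc := fun _ _ _ _ h g f => comp_assoc h g f;
     comp_idl := fun _ _ f => comp_idl f;
     comp_idr := fun _ _ f => comp_idr f;
     comp_addl := fun _ _ _ g g' f => comp_addl g g' f;
     comp_addr := fun _ _ _ g f f' => comp_addr g f f' |}.

Lemma full_additive : is_additive C ->
  (forall Z, is_zero Z -> P Z) ->
  (forall X Y S, is_biproduct X Y S -> P X -> P Y -> P S) ->
  is_additive full_preaddcat.
Proof.
move=> [[Z Z0] addC] P0 Pbip; split; first by exists (exist _ Z (P0 _ Z0)).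
move=> [X PX] [Y PY]; have [S bipS] := addC X Y.
exists (exist _ S (Pbip _ _ _ bipS PX PY)).
have [iX [iY [pX [pY bip]]]] := bipS.
by exists iX, iY, pX, pY.
Qed.

End FullSubcategory.

Section Complexes.
Variable C : preaddcat.

Record complex := Complex {
  term :> int -> C;
  diff : forall n : int, hom (term n) (term (n + 1));
  diff_diff : forall n, diff (n + 1) \oc diff n = 0 }.

Record chain_map (X Y : complex) := ChainMap {
  cmap :> forall n, hom (X n) (Y n);
  cmapP : forall n, cmap (n + 1) \oc diff X n = diff Y n \oc cmap n }.

Lemma chain_map_ext X Y (f g : chain_map X Y) : (forall n, f n = g n) -> f = g.
Proof.
case: f g => f fP [g gP] /= fg.
have e : f = g by apply: functional_extensionality_dep.
by case: _ / e gP => gP; congr ChainMap; apply: Prop_irrelevance.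
Qed.

HB.instance Definition _ X Y := gen_eqMixin (chain_map X Y).
HB.instance Definition _ X Y := gen_choiceMixin (chain_map X Y).

Section ChainMapGroup.
Variables X Y : complex.

Fact cmap0P n : (0 : hom (X (n + 1)) (Y (n + 1))) \oc diff X n =
  diff Y n \oc (0 : hom (X n) (Y n)).
Proof. by rewrite comp0l comp0r. Qed.
Definition cmap0 := ChainMap cmap0P.

Fact cmapNP (f : chain_map X Y) n :
  (- f (n + 1)) \oc diff X n = diff Y n \oc (- f n).
Proof. by rewrite compNl compNr cmapP. Qed.
Definition cmapN f := ChainMap (cmapNP f).

Fact cmapDP (f g : chain_map X Y) n :
  (f (n + 1) + g (n + 1)) \oc diff X n = diff Y n \oc (f n + g n).
Proof. by rewrite comp_addl comp_addr !cmapP. Qed.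
Definition cmapD f g := ChainMap (cmapDP f g).

Fact cmapDA : associative cmapD.
Proof. by move=> f g h; apply: chain_map_ext => n; exact: addrA. Qed.
Fact cmapDC : commutative cmapD.
Proof. by move=> f g; apply: chain_map_ext => n; exact: addrC. Qed.
Fact cmap0D : left_id cmap0 cmapD.
Proof. by move=> f; apply: chain_map_ext => n; exact: add0r. Qed.
Fact cmapND : left_inverse cmap0 cmapN cmapD.
Proof. by move=> f; apply: chain_map_ext => n; exact: addNr. Qed.

HB.instance Definition _ :=
  GRing.isZmodule.Build (chain_map X Y) cmapDA cmapDC cmap0D cmapND.

End ChainMapGroup.

Fact cmap1P (X : complex) n :
  idm (X (n + 1)) \oc diff X n = diff X n \oc idm (X n).
Proof. by rewrite comp_idl comp_idr. Qed.
Definition cmap1 X := ChainMap (@cmap1P X).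

Fact cmap_compP X Y Z (g : chain_map Y Z) (f : chain_map X Y) n :
  (g (n + 1) \oc f (n + 1)) \oc diff X n = diff Z n \oc (g n \oc f n).
Proof. by rewrite comp_assoc -(cmapP g) -!comp_assoc (cmapP f). Qed.
Definition cmap_comp X Y Z g f := ChainMap (@cmap_compP X Y Z g f).

Fact cmap_compA X Y Z T (h : chain_map Z T) (g : chain_map Y Z)
    (f : chain_map X Y) :
  cmap_comp h (cmap_comp g f) = cmap_comp (cmap_comp h g) f.
Proof. by apply: chain_map_ext => n; exact: comp_assoc. Qed.
Fact cmap_comp1l X Y (f : chain_map X Y) : cmap_comp (cmap1 Y) f = f.
Proof. by apply: chain_map_ext => n; exact: comp_idl. Qed.
Fact cmap_comp1r X Y (f : chain_map X Y) : cmap_comp f (cmap1 X) = f.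
Proof. by apply: chain_map_ext => n; exact: comp_idr. Qed.
Fact cmap_compDl X Y Z (g g' : chain_map Y Z) (f : chain_map X Y) :
  cmap_comp (g + g') f = cmap_comp g f + cmap_comp g' f.
Proof. by apply: chain_map_ext => n; exact: comp_addl. Qed.
Fact cmap_compDr X Y Z (g : chain_map Y Z) (f f' : chain_map X Y) :
  cmap_comp g (f + f') = cmap_comp g f + cmap_comp g f'.
Proof. by apply: chain_map_ext => n; exact: comp_addr. Qed.

Definition complexes : preaddcat :=
  {| obj := complex; hom := chain_map; idm := cmap1; comp := cmap_comp;
     comp_assoc := cmap_compA; comp_idl := cmap_comp1l;
     comp_idr := cmap_comp1r; comp_addl := cmap_compDl;
     comp_addr := cmap_compDr |}.

Lemma complexes_additive : is_additive C -> is_additive complexes.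
Proof.
move=> [[Z Z0] addC]; split.
  have dd0 (n : int) : (0 : hom Z Z) \oc (0 : hom Z Z) = 0 by rewrite comp0l.
  exists (@Complex (fun _ => Z) (fun _ => 0) dd0).
  by apply: chain_map_ext => n; exact: Z0.
move=> X Y.
pose cS n := cid (addC (X n) (Y n)).
pose ciX n := cid (svalP (cS n)); pose ciY n := cid (svalP (ciX n)).
pose cpX n := cid (svalP (ciY n)); pose cpY n := cid (svalP (cpX n)).
pose iX n := sval (ciX n); pose iY n := sval (ciY n).
pose pX n := sval (cpX n); pose pY n := sval (cpY n).
have bip n : biproduct (iX n) (iY n) (pX n) (pY n) := svalP (cpY n).
pose d n := iX (n + 1) \oc diff X n \oc pX n + iY (n + 1) \oc diff Y n \oc pY n.
have bXX n : pX n \oc iX n = idm _ by case: (bip n).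
have bYY n : pY n \oc iY n = idm _ by case: (bip n).
have bYX n : pY n \oc iX n = 0 by case: (bip n).
have bXY n : pX n \oc iY n = 0 by case: (bip n).
have b1 n : iX n \oc pX n + iY n \oc pY n = idm _ by case: (bip n).
have diX n : d n \oc iX n = iX (n + 1) \oc diff X n.
  by rewrite comp_addl -!comp_assoc bXX bYX !comp0r comp_idr addr0.
have diY n : d n \oc iY n = iY (n + 1) \oc diff Y n.
  by rewrite comp_addl -!comp_assoc bYY bXY !comp0r comp_idr add0r.
have pXd n : pX (n + 1) \oc d n = diff X n \oc pX n.
  by rewrite comp_addr !comp_assoc bXX bXY !comp0l comp_idl addr0.
have pYd n : pY (n + 1) \oc d n = diff Y n \oc pY n.
  by rewrite comp_addr !comp_assoc bYY bYX !comp0l comp_idl add0r.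
have dd n : d (n + 1) \oc d n = 0.
  rewrite {2}/d comp_addr !comp_assoc diX diY.
  rewrite -(comp_assoc _ (diff X _) (diff X _)) -(comp_assoc _ (diff Y _) (diff Y _)).
  by rewrite !diff_diff !comp0r !comp0l addr0.
have iXd n : iX (n + 1) \oc diff X n = d n \oc iX n by [].
have iYd n : iY (n + 1) \oc diff Y n = d n \oc iY n by [].
exists (Complex dd), (@ChainMap X (Complex dd) iX iXd),
  (@ChainMap Y (Complex dd) iY iYd), (@ChainMap (Complex dd) X pX pXd),
  (@ChainMap (Complex dd) Y pY pYd).
by split; apply: chain_map_ext => n; [exact: bXX|exact: bYY|exact: bYX|exact: bXY|exact: b1].
Qed.

Definition bounded_above (X : complex) :=
  exists N : int, forall n, N < n -> is_zero (X n).

Definition bounded_below (X : complex) :=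
  exists N : int, forall n, n < N -> is_zero (X n).

Definition split_complex (X : complex) :=
  exists s : forall n, hom (X (n + 1)) (X n),
  forall n, diff X n \oc s n \oc diff X n = diff X n.

(* The identity is null-homotopic; every degree has the form n + 1. *)
Definition contractible (X : complex) :=
  exists s : forall n, hom (X (n + 1)) (X n),
  forall n, diff X n \oc s n + s (n + 1) \oc diff X (n + 1) = idm (X (n + 1)).

(* The complex ... -> 0 -> W -> W -> 0 -> ... with identity differential and
   W in degrees n and n + 1, where 0 is the given object Z *)
Section Disk.
Variables (Z W : C) (n : int).

Definition disk_term (m : int) : C :=
  if (m == n) || (m == n + 1) then W else Z.

Definition to_disk (m : int) : hom W (disk_term m) :=
  match (m == n) || (m == n + 1) as b return hom W (if b then W else Z) with
  | true => idm W
  | false => 0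
  end.

Definition of_disk (m : int) : hom (disk_term m) W :=
  match (m == n) || (m == n + 1) as b return hom (if b then W else Z) W with
  | true => idm W
  | false => 0
  end.

Definition disk_diff (m : int) : hom (disk_term m) (disk_term (m + 1)) :=
  if m == n then to_disk (m + 1) \oc of_disk m else 0.

Fact disk_diff_diff m : disk_diff (m + 1) \oc disk_diff m = 0.
Proof.
rewrite /disk_diff; case: (m =P n) => [->|_]; last by rewrite comp0r.
have -> : (n + 1 == n) = false by rewrite -subr_eq0 addrAC subrr add0r.
by rewrite comp0l.
Qed.

Definition disk := Complex disk_diff_diff.
End Disk.

End Complexes.

HB.mixin Record Lmodule_hasGAction (k : pzRingType) (G : finGroupType) M
    of GRing.Lmodule k M := {
  gact : G -> M -> M;
  gact_linear : forall g, linear (gact g);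
  gact1 : forall x, gact 1%g x = x;
  gactM : forall g h x, gact (g * h)%g x = gact g (gact h x) }.

#[short(type="gmodType")]
HB.structure Definition GModule (k : pzRingType) (G : finGroupType) :=
  {M of GRing.Lmodule k M & Lmodule_hasGAction k G M}.

HB.instance Definition _ (k : pzRingType) (G : finGroupType) (M : gmodType k G)
    (g : G) :=
  GRing.isLinear.Build k M M *:%R (gact g) (@gact_linear k G M g).

Section GModules.
Variables (k : pzRingType) (G : finGroupType).
Implicit Types M N : gmodType k G.

Record ghom M N := GHom {
  ghom_fun :> M -> N;
  ghom_linear : linear ghom_fun;
  ghomJ : forall (g : G) x, ghom_fun (gact g x) = gact g (ghom_fun x) }.

HB.instance Definition _ M N (f : ghom M N) :=
  GRing.isLinear.Build k M N *:%R (ghom_fun f) (ghom_linear f).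

Lemma ghom_ext M N (f g : ghom M N) : f =1 g -> f = g.
Proof.
case: f g => f fL fG [g gL gG] /= /funext e.
by case: _ / e gL gG => gL gG; congr GHom; apply: Prop_irrelevance.
Qed.

HB.instance Definition _ M N := gen_eqMixin (ghom M N).
HB.instance Definition _ M N := gen_choiceMixin (ghom M N).

Section GHomGroup.
Variables M N : gmodType k G.

Fact ghom0_linear : linear (fun _ : M => 0 : N).
Proof. by move=> a x y; rewrite scaler0 addr0. Qed.
Fact ghom0J (g : G) (x : M) : 0 = gact g (0 : N).
Proof. by rewrite raddf0. Qed.
Definition ghom0 := GHom ghom0_linear ghom0J.

Fact ghomN_linear (f : ghom M N) : linear (fun x => - f x).
Proof. by move=> a x y; rewrite linearP opprD scalerN. Qed.
Fact ghomNJ (f : ghom M N) (g : G) x : - f (gact g x) = gact g (- f x).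
Proof. by rewrite ghomJ raddfN. Qed.
Definition ghomN f := GHom (ghomN_linear f) (ghomNJ f).

Fact ghomD_linear (f h : ghom M N) : linear (fun x => f x + h x).
Proof. by move=> a x y; rewrite !linearP scalerDr addrACA. Qed.
Fact ghomDJ (f h : ghom M N) (g : G) x :
  f (gact g x) + h (gact g x) = gact g (f x + h x).
Proof. by rewrite !ghomJ raddfD. Qed.
Definition ghomD f h := GHom (ghomD_linear f h) (ghomDJ f h).

Fact ghomDA : associative ghomD.
Proof. by move=> f g h; apply: ghom_ext => x; exact: addrA. Qed.
Fact ghomDC : commutative ghomD.
Proof. by move=> f g; apply: ghom_ext => x; exact: addrC. Qed.
Fact ghom0D : left_id ghom0 ghomD.
Proof. by move=> f; apply: ghom_ext => x; exact: add0r. Qed.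
Fact ghomND : left_inverse ghom0 ghomN ghomD.
Proof. by move=> f; apply: ghom_ext => x; exact: addNr. Qed.

HB.instance Definition _ :=
  GRing.isZmodule.Build (ghom M N) ghomDA ghomDC ghom0D ghomND.

End GHomGroup.

Fact ghom1_linear M : linear (@id M). Proof. by []. Qed.
Fact ghom1J M (g : G) (x : M) : id (gact g x) = gact g (id x). Proof. by []. Qed.
Definition ghom1 M := GHom (@ghom1_linear M) (@ghom1J M).

Fact ghom_comp_linear L M N (g : ghom M N) (f : ghom L M) : linear (g \o f).
Proof. by move=> a x y /=; rewrite !linearP. Qed.
Fact ghom_compJ L M N (g : ghom M N) (f : ghom L M) (h : G) x :
  (g \o f) (gact h x) = gact h ((g \o f) x).
Proof. by rewrite /= !ghomJ. Qed.
Definition ghom_comp L M N g f :=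
  GHom (@ghom_comp_linear L M N g f) (@ghom_compJ L M N g f).

Fact ghom_compA L M N T (h : ghom N T) (g : ghom M N) (f : ghom L M) :
  ghom_comp h (ghom_comp g f) = ghom_comp (ghom_comp h g) f.
Proof. exact: ghom_ext. Qed.
Fact ghom_comp1l M N (f : ghom M N) : ghom_comp (ghom1 N) f = f.
Proof. exact: ghom_ext. Qed.
Fact ghom_comp1r M N (f : ghom M N) : ghom_comp f (ghom1 M) = f.
Proof. exact: ghom_ext. Qed.
Fact ghom_compDl L M N (g g' : ghom M N) (f : ghom L M) :
  ghom_comp (g + g') f = ghom_comp g f + ghom_comp g' f.
Proof. exact: ghom_ext. Qed.
Fact ghom_compDr L M N (g : ghom M N) (f f' : ghom L M) :
  ghom_comp g (f + f') = ghom_comp g f + ghom_comp g f'.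
Proof. by apply: ghom_ext => x; exact: raddfD. Qed.

Definition Mod : preaddcat :=
  {| obj := gmodType k G; hom := ghom; idm := ghom1; comp := ghom_comp;
     comp_assoc := ghom_compA; comp_idl := ghom_comp1l;
     comp_idr := ghom_comp1r; comp_addl := ghom_compDl;
     comp_addr := ghom_compDr |}.

Definition zero_gmod_type : Type := 'rV[k]_0.
HB.instance Definition _ := GRing.Lmodule.on zero_gmod_type.
Fact zero_gact_linear (g : G) : linear (@id zero_gmod_type). Proof. by []. Qed.
HB.instance Definition _ :=
  Lmodule_hasGAction.Build k G zero_gmod_type zero_gact_linear
    (fun _ => erefl) (fun _ _ _ => erefl).
Definition zero_gmod : gmodType k G := zero_gmod_type.

Section GProd.
Variables M N : gmodType k G.
Definition prod_gact (g : G) (x : M * N) : M * N := (gact g x.1, gact g x.2).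
Fact prod_gact_linear g : linear (prod_gact g).
Proof. by move=> a [x y] [x' y']; rewrite /prod_gact /= !linearP. Qed.
Fact prod_gact1 x : prod_gact 1%g x = x.
Proof. by case: x => x y; rewrite /prod_gact /= !gact1. Qed.
Fact prod_gactM g h x : prod_gact (g * h)%g x = prod_gact g (prod_gact h x).
Proof. by case: x => x y; rewrite /prod_gact /= !gactM. Qed.
HB.instance Definition _ :=
  Lmodule_hasGAction.Build k G (M * N)%type prod_gact_linear prod_gact1 prod_gactM.
End GProd.

Lemma Mod_additive : is_additive Mod.
Proof.
split.
  by exists zero_gmod; apply: ghom_ext => x; apply/rowP => -[].
move=> M N; pose S : gmodType k G := (M * N)%type.
have iML : linear (fun x : M => (x, 0) : S).
  by move=> a x y; congr (_, _); rewrite /= scaler0 addr0.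
have iMJ (g : G) x : (gact g x, 0) = gact g ((x, 0) : S).
  by congr (_, _); rewrite /= raddf0.
have iNL : linear (fun x : N => (0, x) : S).
  by move=> a x y; congr (_, _); rewrite /= scaler0 addr0.
have iNJ (g : G) x : (0, gact g x) = gact g ((0, x) : S).
  by congr (_, _); rewrite /= raddf0.
have pML : linear (fun x : S => x.1) by [].
have pNL : linear (fun x : S => x.2) by [].
exists S, (GHom iML iMJ), (GHom iNL iNJ),
  (@GHom S M _ pML (fun _ _ => erefl)), (@GHom S N _ pNL (fun _ _ => erefl)).
by split; apply: ghom_ext => // -[x y]; congr (_, _); rewrite /= ?addr0 ?add0r.
Qed.

Definition fin_gen M :=
  exists n (e : 'I_n -> M), forall x : M, exists a : 'I_n -> G -> k,
    x = \sum_i \sum_g a i g *: gact g (e i).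

Definition free_of_rank M n :=
  exists e : 'I_n -> M, forall x : M,
    exists! a : 'rV[k]_n, x = \sum_i a 0 i *: e i.

Lemma fin_gen_zero M : @is_zero Mod M -> fin_gen M.
Proof.
move=> M0; exists 0%N, (fun _ => 0) => x; exists (fun _ _ => 0).
by rewrite big_ord0; have := congr1 (fun f : ghom M M => f x) M0.
Qed.

Lemma fin_gen_biproduct M N (S : gmodType k G) :
  @is_biproduct Mod M N S -> fin_gen M -> fin_gen N -> fin_gen S.
Proof.
move=> [/= iM [iN [pM [pN [_ _ _ _ sum1]]]]] [m [e eP]] [n [f fP]].
have {sum1}sum1 x : iM (pM x) + iN (pN x) = x.
  by have := congr1 (fun h : ghom S S => h x) sum1.
exists (m + n)%N, (fun i => match split i with
  inl j => iM (e j) | inr j => iN (f j) end) => x.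
have [a aP] := eP (pM x); have [b bP] := fP (pN x).
exists (fun i => match split i with inl j => a j | inr j => b j end).
rewrite -[LHS]sum1 aP bP big_split_ord /=; congr (_ + _).
  rewrite raddf_sum; apply: eq_bigr => i _; rewrite (unsplitK (inl i)) raddf_sum.
  by apply: eq_bigr => g _; rewrite /= linearZZ /= ghomJ.
rewrite raddf_sum; apply: eq_bigr => i _; rewrite (unsplitK (inr i)) raddf_sum.
by apply: eq_bigr => g _; rewrite /= linearZZ /= ghomJ.
Qed.

End GModules.

Section Tensor.
Variables (k : comPzRingType) (G : finGroupType).
Section Construction.
Variables V X : gmodType k G.

(* The list [:: (v_1, x_1); ...; (v_n, x_n)] stands for the sum of the
   v_i \otimes x_i; V \otimes_k X is the quotient of these formal sums by the
   congruence generated by the bilinearity relations. *)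
Inductive tens_eq : seq (V * X) -> seq (V * X) -> Prop :=
| TensRefl s : tens_eq s s
| TensSym s t : tens_eq s t -> tens_eq t s
| TensTrans s t u : tens_eq s t -> tens_eq t u -> tens_eq s u
| TensCat s s' t t' : tens_eq s s' -> tens_eq t t' -> tens_eq (s ++ t) (s' ++ t')
| TensSwap s t : tens_eq (s ++ t) (t ++ s)
| TensZero x : tens_eq [:: (0, x)] [::]
| TensAddl v w x : tens_eq [:: (v + w, x)] [:: (v, x); (w, x)]
| TensAddr v x y : tens_eq [:: (v, x + y)] [:: (v, x); (v, y)]
| TensScale a v x : tens_eq [:: (a *: v, x)] [:: (v, a *: x)].

Definition tens_rel : rel (seq (V * X)) := fun s t => `[< tens_eq s t >].

Fact tens_rel_equiv : equiv_class_of tens_rel.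
Proof.
split=> [s|s t|t s u].
- by apply/asboolP; exact: TensRefl.
- by apply/asboolP/asboolP; exact: TensSym.
- by move=> /asboolP st /asboolP tu; apply/asboolP; exact: TensTrans tu.
Qed.
Canonical tens_equiv_rel := EquivRelPack tens_rel_equiv.
Canonical tens_encModRel := defaultEncModRel tens_rel.

Definition tensor := {eq_quot tens_rel}.
HB.instance Definition _ := Choice.on tensor.

Definition tens_class (s : seq (V * X)) : tensor := \pi_tensor s.
Definition tens_repr (t : tensor) : seq (V * X) := repr t.

Lemma tens_reprK t : tens_class (tens_repr t) = t.
Proof. exact: reprK. Qed.

Lemma tens_classP s t : tens_class s = tens_class t <-> tens_eq s t.
Proof.
split=> [/eqP|st]; last apply/eqP.
  by rewrite /tens_class piE => /asboolP.
by rewrite /tens_class piE; apply/asboolP.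
Qed.

Lemma tens_reprP s : tens_eq (tens_repr (tens_class s)) s.
Proof. exact/tens_classP/tens_reprK. Qed.

Definition tens_add (t u : tensor) := tens_class (tens_repr t ++ tens_repr u).

Definition tens_map1 (f : V -> V) (h : X -> X) (t : tensor) :=
  tens_class [seq (f p.1, h p.2) | p <- tens_repr t].

Definition tens_opp := tens_map1 -%R id.
Definition tens_scale (a : k) := tens_map1 ( *:%R a) id.
Definition tens_gact (g : G) := tens_map1 (gact g) (gact g).

Lemma tens_addE s t : tens_add (tens_class s) (tens_class t) = tens_class (s ++ t).
Proof. by apply/tens_classP/TensCat; exact: tens_reprP. Qed.

Lemma tens_eq_map (f : {linear V -> V}) (h : {linear X -> X}) s t :
  tens_eq s t ->
  tens_eq [seq (f p.1, h p.2) | p <- s] [seq (f p.1, h p.2) | p <- t].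
Proof.
elim=> /= {s t}.
- by move=> *; exact: TensRefl.
- by move=> *; exact: TensSym.
- by move=> s1 s2 s3 _ e12 _ e23; exact: TensTrans e23.
- by move=> *; rewrite !map_cat; exact: TensCat.
- by move=> *; rewrite !map_cat; exact: TensSwap.
- by move=> x; rewrite raddf0; exact: TensZero.
- by move=> v w x; rewrite raddfD; exact: TensAddl.
- by move=> v x y; rewrite raddfD; exact: TensAddr.
- by move=> a v x; rewrite !linearZZ; exact: TensScale.
Qed.

Lemma tens_map1E (f : {linear V -> V}) (h : {linear X -> X}) s :
  tens_map1 f h (tens_class s) = tens_class [seq (f p.1, h p.2) | p <- s].
Proof. by apply/tens_classP/tens_eq_map; exact: tens_reprP. Qed.

Lemma tens_oppE s : tens_opp (tens_class s) = tens_class [seq (- p.1, p.2) | p <- s].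
Proof. exact: (tens_map1E (-%R) idfun). Qed.

Lemma tens_scaleE a s :
  tens_scale a (tens_class s) = tens_class [seq (a *: p.1, p.2) | p <- s].
Proof. exact: (tens_map1E ( *:%R a) idfun). Qed.

Lemma tens_gactE g s :
  tens_gact g (tens_class s) = tens_class [seq (gact g p.1, gact g p.2) | p <- s].
Proof. exact: (tens_map1E (gact g) (gact g)). Qed.

Fact tens_addA : associative tens_add.
Proof.
move=> t u v; rewrite -(tens_reprK t) -(tens_reprK u) -(tens_reprK v).
by rewrite !tens_addE catA.
Qed.
Fact tens_addC : commutative tens_add.
Proof. by move=> t u; apply/tens_classP/TensSwap. Qed.
Fact tens_add0 : left_id (tens_class [::]) tens_add.
Proof. by move=> t; rewrite -(tens_reprK t) tens_addE. Qed.

Lemma tens_eq_rearrange s t u v :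
  tens_eq ((s ++ t) ++ (u ++ v)) ((s ++ u) ++ (t ++ v)).
Proof.
rewrite -!catA; apply: TensCat (TensRefl _) _.
by rewrite !catA; apply: TensCat (TensSwap _ _) (TensRefl _).
Qed.

Lemma tens_eq_zip (f g h : V * X -> V * X) s :
  (forall p, tens_eq [:: h p] [:: f p; g p]) ->
  tens_eq (map h s) (map f s ++ map g s).
Proof.
move=> hP; elim: s => [|p s IHs] /=; first exact: TensRefl.
apply: TensTrans (TensCat (hP p) IHs) _.
exact: (tens_eq_rearrange [:: f p] [:: g p]).
Qed.

Fact tens_addN : left_inverse (tens_class [::]) tens_opp tens_add.
Proof.
move=> t; rewrite -(tens_reprK t) tens_oppE tens_addE; apply/tens_classP.
have zipP (p : V * X) : tens_eq [:: (0, p.2)] [:: (- p.1, p.2); p].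
  by case: p => v x /=; rewrite -[X in (X, _)](addNr v); exact: TensAddl.
have := tens_eq_zip (tens_repr t) zipP; rewrite map_id => e.
apply: TensTrans (TensSym e) _; elim: (tens_repr t) => [|p s IHs] /=.
  exact: TensRefl.
exact: (TensCat (TensZero p.2) IHs).
Qed.

HB.instance Definition _ :=
  GRing.isZmodule.Build tensor tens_addA tens_addC tens_add0 tens_addN.

Lemma tens_classD s t : tens_class (s ++ t) = tens_class s + tens_class t.
Proof. by rewrite -tens_addE. Qed.

Fact tens_scaleA a b t : tens_scale a (tens_scale b t) = tens_scale (a * b) t.
Proof.
rewrite -(tens_reprK t) !tens_scaleE -map_comp; congr tens_class.
by apply: eq_map => p /=; rewrite scalerA.
Qed.
Fact tens_scale1 : left_id 1 tens_scale.
Proof.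
move=> t; rewrite -[RHS](tens_reprK t) -[X in tens_scale _ X](tens_reprK t).
rewrite tens_scaleE; congr tens_class; rewrite -[RHS]map_id.
by apply: eq_map => -[v x] /=; rewrite scale1r.
Qed.
Fact tens_scaleDr : right_distributive tens_scale +%R.
Proof.
move=> a t u; rewrite -(tens_reprK t) -(tens_reprK u) -tens_classD !tens_scaleE.
by rewrite map_cat tens_classD.
Qed.
Fact tens_scaleDl t : {morph tens_scale^~ t : a b / a + b}.
Proof.
move=> a b; rewrite -(tens_reprK t) !tens_scaleE -tens_classD.
by apply/tens_classP/tens_eq_zip => p; rewrite scalerDl; exact: TensAddl.
Qed.

HB.instance Definition _ := GRing.Zmodule_isLmodule.Build k tensor
  tens_scaleA tens_scale1 tens_scaleDr tens_scaleDl.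

Lemma tens_classZ a s :
  a *: tens_class s = tens_class [seq (a *: p.1, p.2) | p <- s].
Proof. exact: tens_scaleE. Qed.

Fact tens_gact_linear g : linear (tens_gact g).
Proof.
move=> a t u; rewrite -(tens_reprK t) -(tens_reprK u).
rewrite tens_classZ -tens_classD !tens_gactE tens_classZ -tens_classD.
rewrite map_cat -!map_comp; congr (tens_class (_ ++ _)).
by apply: eq_map => p /=; rewrite linearZZ.
Qed.
Fact tens_gact1 t : tens_gact 1%g t = t.
Proof.
rewrite -[RHS](tens_reprK t) -[X in tens_gact _ X](tens_reprK t) tens_gactE.
congr tens_class; rewrite -[RHS]map_id.
by apply: eq_map => -[v x] /=; rewrite !gact1.
Qed.
Fact tens_gactM g h t : tens_gact (g * h)%g t = tens_gact g (tens_gact h t).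
Proof.
rewrite -(tens_reprK t) !tens_gactE -map_comp; congr tens_class.
by apply: eq_map => p /=; rewrite !gactM.
Qed.

HB.instance Definition _ := Lmodule_hasGAction.Build k G tensor
  tens_gact_linear tens_gact1 tens_gactM.

Lemma tens_classJ (g : G) s :
  gact g (tens_class s) = tens_class [seq (gact g p.1, gact g p.2) | p <- s].
Proof. exact: tens_gactE. Qed.

Definition tens (v : V) (x : X) : tensor := tens_class [:: (v, x)].

Lemma tens_classE s : tens_class s = \sum_(p <- s) tens p.1 p.2.
Proof.
elim: s => [|[v x] s IHs]; first by rewrite big_nil.
by rewrite big_cons -IHs -tens_classD.
Qed.

Lemma tensDl v w x : tens (v + w) x = tens v x + tens w x.
Proof. by rewrite -tens_classD; apply/tens_classP/TensAddl. Qed.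
Lemma tensDr v x y : tens v (x + y) = tens v x + tens v y.
Proof. by rewrite -tens_classD; apply/tens_classP/TensAddr. Qed.
Lemma tensZl a v x : tens (a *: v) x = a *: tens v x.
Proof. by rewrite tens_classZ. Qed.
Lemma tensZr a v x : tens v (a *: x) = a *: tens v x.
Proof. by rewrite -tensZl; apply/esym/tens_classP/TensScale. Qed.
Lemma tensJ (g : G) v x : gact g (tens v x) = tens (gact g v) (gact g x).
Proof. exact: tens_gactE. Qed.

Lemma tensor_universal (W : lmodType k) (b : V -> X -> W) :
  (forall v, linear (b v)) -> (forall x, linear (b^~ x)) ->
  exists! f : tensor -> W, linear f /\ forall v x, f (tens v x) = b v x.
Proof.
move=> br bl.
have bDr v x y : b v (x + y) = b v x + b v y.
  by have := br v 1 x y; rewrite !scale1r.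
have bDl v w x : b (v + w) x = b v x + b w x.
  by have := bl x 1 v w; rewrite !scale1r.
have b0l x : b 0 x = 0 by apply: (addrI (b 0 x)); rewrite -bDl !addr0.
have b0r v : b v 0 = 0 by apply: (addrI (b v 0)); rewrite -bDr !addr0.
have bZr a v x : b v (a *: x) = a *: b v x.
  by have := br v a x 0; rewrite !b0r !addr0.
have bZl a v x : b (a *: v) x = a *: b v x.
  by have := bl x a v 0; rewrite !b0l !addr0.
pose F (s : seq (V * X)) := \sum_(p <- s) b p.1 p.2.
have FP s t : tens_eq s t -> F s = F t.
  rewrite /F; elim=> //= *; rewrite ?big_cat ?big_cons ?big_nil /= ?addr0 //.
  - by etransitivity; eassumption.
  - by congr (_ + _).
  - exact: addrC.
  - by rewrite bZr bZl.
pose f (t : tensor) := F (tens_repr t).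
have fE s : f (tens_class s) = F s by apply: FP; exact: tens_reprP.
exists f; split.
  split=> [a t u|v x]; last by rewrite fE /F big_seq1.
  rewrite -(tens_reprK t) -(tens_reprK u).
  rewrite tens_classZ -tens_classD !fE /F big_cat big_map /=.
  congr (_ + _); rewrite scaler_sumr.
  by apply: eq_bigr => p _; rewrite bZl.
move=> h [hL hE]; apply: funext => t; rewrite -(tens_reprK t) fE.
have hD t' u : h (t' + u) = h t' + h u.
  by have := hL 1 t' u; rewrite !scale1r.
have h0 : h 0 = 0 by apply: (addrI (h 0)); rewrite -hD !addr0.
rewrite /F; elim: (tens_repr t) => [|[v x] s IHs].
  by rewrite big_nil -h0.
by rewrite big_cons IHs -cat1s tens_classD hD hE.
Qed.

End Construction.

Section Functoriality.
Variables (V X Y : gmodType k G) (f : ghom X Y).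

(* id_V \otimes f *)
Definition tens_hom_fun (t : tensor V X) : tensor V Y :=
  tens_class [seq (p.1, f p.2) | p <- tens_repr t].

Lemma tens_eq_hom (s t : seq (V * X)) : tens_eq s t ->
  tens_eq [seq (p.1, f p.2) | p <- s] [seq (p.1, f p.2) | p <- t].
Proof.
elim=> /= {s t}.
- by move=> *; exact: TensRefl.
- by move=> *; exact: TensSym.
- by move=> s1 s2 s3 _ e12 _ e23; exact: TensTrans e23.
- by move=> *; rewrite !map_cat; exact: TensCat.
- by move=> *; rewrite !map_cat; exact: TensSwap.
- by move=> x; exact: TensZero.
- by move=> v w x; exact: TensAddl.
- by move=> v x y; rewrite raddfD; exact: TensAddr.
- by move=> a v x; rewrite linearZZ; exact: TensScale.
Qed.

Lemma tens_hom_funE (s : seq (V * X)) :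
  tens_hom_fun (tens_class s) = tens_class [seq (p.1, f p.2) | p <- s].
Proof. by apply/tens_classP/tens_eq_hom; exact: tens_reprP. Qed.

Fact tens_hom_linear : linear tens_hom_fun.
Proof.
move=> a t u; rewrite -(tens_reprK t) -(tens_reprK u).
rewrite tens_classZ -tens_classD !tens_hom_funE tens_classZ -tens_classD.
by rewrite map_cat -!map_comp.
Qed.

Fact tens_homJ (g : G) t : tens_hom_fun (gact g t) = gact g (tens_hom_fun t).
Proof.
rewrite -(tens_reprK t) tens_classJ !tens_hom_funE tens_classJ -!map_comp.
by congr tens_class; apply: eq_map => p /=; rewrite ghomJ.
Qed.

Definition tens_hom : ghom (tensor V X) (tensor V Y) :=
  GHom tens_hom_linear tens_homJ.

Lemma tens_homE v x : tens_hom (tens v x) = tens v (f x).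
Proof. exact: tens_hom_funE. Qed.

End Functoriality.
End Tensor.

(* BoundedAbove, BoundedBelow and Bounded are the superscripts +, - and b. *)
Inductive boundedness := Unbounded | BoundedAbove | BoundedBelow | Bounded.

Section Main.
Variables (k : comPzRingType) (G : finGroupType).
Implicit Types V W : gmodType k G.

Definition field_ring := (1 : k) <> 0 /\
  forall x : k, x <> 0 -> exists y, y * x = 1.

Definition split_sequence (L M N : gmodType k G) (f : ghom L M) (g : ghom M N) :=
  short_exact f g /\ exists s : ghom N M, forall z, g (s z) = z.

Definition Vprojective V W :=
  exists X W' : gmodType k G, @is_biproduct (Mod k G) W W' (tensor V X).

Definition Cpx_all : preaddcat := complexes (Mod k G).

Definition in_Cpx (fg : bool) (b : boundedness) (X : Cpx_all) : Prop :=
  (fg -> forall n, fin_gen (X n)) /\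
  match b with
  | Unbounded => True
  | BoundedAbove => bounded_above X
  | BoundedBelow => bounded_below X
  | Bounded => bounded_above X /\ bounded_below X
  end.

Lemma bounded_above_biproduct (X Y S : Cpx_all) :
  is_biproduct X Y S -> bounded_above X -> bounded_above Y -> bounded_above S.
Proof.
move=> [iX [iY [pX [pY [_ _ _ _ sum1]]]]] [N XN] [N' YN].
exists (Num.max N N') => n; rewrite gt_max => /andP[Nn N'n].
have e : iX n \oc pX n + iY n \oc pY n = idm (S n).
  exact: (congr1 (fun f : chain_map S S => f n) sum1).
rewrite /is_zero -e.
have -> : iX n = 0 by rewrite -[LHS]comp_idr XN // comp0r.
by have -> : iY n = 0; [rewrite -[LHS]comp_idr YN // comp0r|rewrite !comp0l addr0].
Qed.

Lemma bounded_below_biproduct (X Y S : Cpx_all) :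
  is_biproduct X Y S -> bounded_below X -> bounded_below Y -> bounded_below S.
Proof.
move=> [iX [iY [pX [pY [_ _ _ _ sum1]]]]] [N XN] [N' YN].
exists (Num.min N N') => n; rewrite lt_min => /andP[Nn N'n].
have e : iX n \oc pX n + iY n \oc pY n = idm (S n).
  exact: (congr1 (fun f : chain_map S S => f n) sum1).
rewrite /is_zero -e.
have -> : iX n = 0 by rewrite -[LHS]comp_idr XN // comp0r.
by have -> : iY n = 0; [rewrite -[LHS]comp_idr YN // comp0r|rewrite !comp0l addr0].
Qed.

Lemma in_Cpx_additive fg b : is_additive (full_preaddcat (in_Cpx fg b)).
Proof.
apply: full_additive; first exact/complexes_additive/Mod_additive.
  move=> Z Z0; have Zn0 n : is_zero (Z n).
    exact: (congr1 (fun f : chain_map Z Z => f n) Z0).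
  have Zab : bounded_above Z by exists 0 => n _; exact: Zn0.
  have Zbe : bounded_below Z by exists 0 => n _; exact: Zn0.
  by split; [move=> _ n; exact/fin_gen_zero/Zn0 | case: b].
move=> X Y S bipS [fgX bX] [fgY bY]; split.
  move=> fg1 n; apply: fin_gen_biproduct (fgX fg1 n) (fgY fg1 n).
  have [iX [iY [pX [pY [XX YY YX XY sum1]]]]] := bipS.
  exists (iX n), (iY n), (pX n), (pY n); split.
  - exact: (congr1 (fun f : chain_map X X => f n) XX).
  - exact: (congr1 (fun f : chain_map Y Y => f n) YY).
  - exact: (congr1 (fun f : chain_map X Y => f n) YX).
  - exact: (congr1 (fun f : chain_map Y X => f n) XY).
  - exact: (congr1 (fun f : chain_map S S => f n) sum1).
case: b bX bY => //=.
- exact: bounded_above_biproduct bipS.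
- exact: bounded_below_biproduct bipS.
move=> [aX bX] [aY bY]; split.
  exact: bounded_above_biproduct bipS aX aY.
exact: bounded_below_biproduct bipS bX bY.
Qed.

(* Cpx fg b is cpx(kG) or Cpx(kG), with the superscript b, according to
   whether fg is true or false. *)
Definition Cpx (fg : bool) (b : boundedness) : addcat :=
  AddCat (in_Cpx_additive fg b).

Definition Vts V (fg : bool) (b : boundedness) : sequences (Cpx fg b) :=
  fun X Y Z (i : chain_map (sval X) (sval Y)) (p : chain_map (sval Y) (sval Z)) =>
  (forall n, short_exact (i n : ghom _ _) (p n : ghom _ _)) /\
  (forall n, split_sequence (tens_hom V (i n)) (tens_hom V (p n))).

Definition K_Vts V fg b : addcat := quot_proj (@Vts V fg b).

Definition split_contractible_Vproj V (X : Cpx_all) :=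
  [/\ split_complex X, contractible X & forall n, Vprojective V (X n)].

Definition Cpx_disk W (n : int) : Cpx_all := @disk (Mod k G) (zero_gmod k G) W n.

(* The direct sum is the one of Cpx(kG); the summands are not required to lie
   in a given subcategory. *)
Definition sum_of_Vdisks V (X : Cpx_all) :=
  exists (I : Type) (W : I -> gmodType k G) (n : I -> int)
    (inj : forall i, hom (Cpx_disk (W i) (n i)) X),
  (forall i, Vprojective V (W i)) /\ is_coproduct inj.

End Main.

Arguments Vts {k G} V fg b.
Arguments K_Vts {k G} V fg b.

(* Main.v *)
(* Write F for V (x) -. Contracting V against its dual basis turns a G-map
   F A -> F B into a G-map A -> B, and turns the swap of F (F A) into the identity
   of F A; hence V-projective modules lift along maps p with F p split epi and
   extend along maps i with F i split mono. The evaluation F Hom(V, X) -> X and the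
   coevaluation X -> F Hom(V, X) are such maps, because F ev o swap o F coev = 1,
   and cones of identities turn them into a cover and a hull of any complex. If a
   complex has contracting homotopy s and the g n lift (or extend) a chain map
   degreewise, then g s d + d g s (or d s g + s g d) does so as a chain map: the
   contractible complexes with V-projective terms are both projective and
   injective. Conversely such objects are retracts of cones. The images of the
   idempotents s d exhibit a contractible complex as a coproduct of disks.
   Over a field, Cayley-Hamilton makes every endomorphism of a bounded complex
   algebraic, so by Fitting's argument and induction on the dimension complexes
   are sums of objects with local endomorphism ring; this passes to the quotient
   category, where Azumaya's exchange argument gives uniqueness. *)

From HB Require Import structures.
From mathcomp Require Import fingroup all_boot all_order all_algebra.
From mathcomp Require Import zify.
From mathcomp Require Import boolp.
Require Import Defs.

Set Implicit Arguments.
Unset Strict Implicit.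
Unset Printing Implicit Defensive.

Import Order.TTheory GRing.Theory Num.Theory.
Local Open Scope ring_scope.
Local Open Scope quotient_scope.

(** * Preadditive categories and complexes *)

(** Exactness is settled degree by degree: a chain map is an inflation or a deflation exactly when
    all its components become split mono or split epi after tensoring with V. This requires
    recovering injectivity and surjectivity of a map from its tensor product with V, which is where
    positive rank enters: for V = 0 every map would be V-split. As k need not be noetherian, a
    kernel in a complex of finitely generated modules is not finitely generated for free; it is so
    here because a V-split epi has a k-linear section, read off from one basis vector of V. The
    coproducts of disks have their universal property among all complexes only, so the last
    description of the projectives is proved there and transferred through the contractible
    complexes with V-projective terms, a notion that does not mention the subcategory. Over a field
    no basis of a term is chosen: Cayley-Hamilton is applied to a matrix of the endomorphism on a
    spanning family, and the induction runs on the sizes of spanning families. *)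

Section PreadditiveFacts.
Variable C : preaddcat.
Implicit Types X Y Z S T : C.

Lemma compBl X Y Z (g g' : hom Y Z) (f : hom X Y) :
  (g - g') \oc f = g \oc f - g' \oc f.
Proof. by rewrite comp_addl compNl. Qed.

Lemma compBr X Y Z (g : hom Y Z) (f f' : hom X Y) :
  g \oc (f - f') = g \oc f - g \oc f'.
Proof. by rewrite comp_addr compNr. Qed.

Lemma zero_dom X Y (f : hom X Y) : is_zero X -> f = 0.
Proof. by move=> X0; rewrite -(comp_idr f) X0 comp0r. Qed.

Lemma zero_cod X Y (f : hom X Y) : is_zero Y -> f = 0.
Proof. by move=> Y0; rewrite -(comp_idl f) Y0 comp0l. Qed.

Lemma biproduct_zero X Y S : is_biproduct X Y S ->
  is_zero X -> is_zero Y -> is_zero S.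
Proof.
move=> [iX [iY [pX [pY [_ _ _ _ sum1]]]]] X0 Y0.
by rewrite /is_zero -sum1 (zero_dom iX X0) (zero_dom iY Y0) !comp0l addr0.
Qed.

Lemma kernel_inj X Y Z (i : hom X Y) (p : hom Y Z) T (f g : hom T X) :
  is_kernel i p -> i \oc f = i \oc g -> f = g.
Proof.
move=> [pi0 univ] fg.
have [|h [_ hU]] := univ _ (i \oc f); first by rewrite comp_assoc pi0 comp0l.
by rewrite -(hU _ erefl) (hU g).
Qed.

Lemma cokernel_inj X Y Z (i : hom X Y) (p : hom Y Z) T (f g : hom Z T) :
  is_cokernel i p -> f \oc p = g \oc p -> f = g.
Proof.
move=> [pi0 univ] fg.
have [|h [_ hU]] := univ _ (f \oc p); first by rewrite -comp_assoc pi0 comp0r.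
by rewrite -(hU _ erefl) (hU g).
Qed.

(** A map out of the biproduct is a pair [(u, v)], and it kills the antidiagonal
    [iY \oc i - iX' \oc f] exactly when [u \oc i = v \oc f]. *)
Lemma cokernel_pushout X Y X' S Q (i : hom X Y) (f : hom X X')
    (iY : hom Y S) (iX' : hom X' S) (pY : hom S Y) (pX' : hom S X')
    (q : hom S Q) :
  biproduct iY iX' pY pX' -> is_cokernel (iY \oc i - iX' \oc f) q ->
  is_pushout i f (q \oc iX') (q \oc iY).
Proof.
move=> [YY XX XY YX sum1] [qj univ]; split.
  by apply/eqP; rewrite -subr_eq0 -!comp_assoc -compBr qj.
move=> T u v uv.
have [|h [hq hU]] := univ T (u \oc pY + v \oc pX').
  rewrite comp_addl !compBr -!comp_assoc !(comp_assoc pY) !(comp_assoc pX').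
  by rewrite YY XX XY YX !comp0l !comp_idl !comp0r subr0 sub0r uv subrr.
exists h; split.
  rewrite !comp_assoc hq !comp_addl -!comp_assoc YY XX XY YX.
  by rewrite !comp0r !comp_idr addr0 add0r.
move=> h' [h'Y h'X]; apply: hU.
by rewrite -[LHS]comp_idr -sum1 comp_addr -h'Y -h'X !comp_assoc.
Qed.

Lemma kernel_pullback Y Z Z' S K (p : hom Y Z) (f : hom Z' Z)
    (iY : hom Y S) (iZ' : hom Z' S) (pY : hom S Y) (pZ' : hom S Z')
    (j : hom K S) :
  biproduct iY iZ' pY pZ' -> is_kernel j (p \oc pY - f \oc pZ') ->
  is_pullback p f (pZ' \oc j) (pY \oc j).
Proof.
move=> [YY ZZ ZY YZ sum1] [qj univ]; split.
  by apply/eqP; rewrite -subr_eq0 !comp_assoc -compBl qj.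
move=> T u v uv.
have [|h [hq hU]] := univ T (iY \oc u + iZ' \oc v).
  rewrite comp_addr !compBl !comp_assoc -!(comp_assoc _ pY) -!(comp_assoc _ pZ').
  by rewrite YY ZZ ZY YZ !comp0r !comp_idr !comp0l subr0 sub0r uv subrr.
exists h; split.
  rewrite -!comp_assoc hq !comp_addr !comp_assoc YY ZZ ZY YZ.
  by rewrite !comp0l !comp_idl addr0 add0r.
move=> h' [h'Y h'X]; apply: hU.
by rewrite -[LHS]comp_idl -sum1 comp_addl -h'Y -h'X !comp_assoc.
Qed.

Definition retract X Y :=
  exists (i : hom X Y) (p : hom Y X), p \oc i = idm X.

Lemma retract_trans X Y Z : retract X Y -> retract Y Z -> retract X Z.
Proof.
move=> [i [p pi]] [j [q qj]]; exists (j \oc i), (p \oc q).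
by rewrite -comp_assoc (comp_assoc q) qj comp_idl.
Qed.

Lemma biproduct_retract X Y S : is_biproduct X Y S -> retract X S.
Proof. by move=> [iX [iY [pX [pY [XX _ _ _ _]]]]]; exists iX, pX. Qed.

Definition splits_idempotents := forall X (e : hom X X), e \oc e = e ->
  exists Y (i : hom Y X) (p : hom X Y), p \oc i = idm Y /\ i \oc p = e.

(** Turns retracts into direct summands: the complement is the image of the complementary
    idempotent. *)
Lemma idempotent_biproduct : splits_idempotents ->
  forall Y X (i : hom Y X) (p : hom X Y), p \oc i = idm Y ->
  exists Z (j : hom Z X) (q : hom X Z),
    biproduct i j p q /\ j \oc q = idm X - i \oc p.
Proof.
move=> splitC Y X i p pi.
have ee : (idm X - i \oc p) \oc (idm X - i \oc p) = idm X - i \oc p.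
  rewrite compBl comp_idl compBr comp_idr -comp_assoc (comp_assoc p) pi.
  by rewrite comp_idl subrr subr0.
have [Z [j [q [qj jq]]]] := splitC _ _ ee.
exists Z, j, q; split=> //; split=> //; last by rewrite jq addrC subrK.
  rewrite -(comp_idl (q \oc i)) -qj -comp_assoc (comp_assoc j) jq.
  by rewrite compBl comp_idl -comp_assoc pi comp_idr subrr comp0r.
rewrite -(comp_idr (p \oc j)) -qj -comp_assoc (comp_assoc j) jq.
by rewrite compBl comp_idl compBr -(comp_assoc i) !(comp_assoc p) pi comp_idl subrr.
Qed.

End PreadditiveFacts.

(** A homotopy goes from degree [n + 1] to degree [n], so identities that involve one can be typed
    only in degrees of the form [m + 1]; this extends them to all degrees. *)
Lemma int_succ (P : int -> Prop) : (forall m, P (m + 1)) -> forall n, P n.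
Proof. by move=> Psucc n; rewrite -(subrK 1 n). Qed.

(* Families indexed by all degrees are often given in the degrees written m + 1;
   this removes every cast along n - 1 + 1 = n. *)
Lemma succ_family (P : int -> Type) (a : forall m, P (m + 1)) :
  {h : forall n, P n | forall m, h (m + 1) = a m}.
Proof.
have e (n : int) : n - 1 + 1 = n by rewrite subrK.
exists (fun n => eq_rect _ P (a (n - 1)) _ (e n)) => m.
(* Once [m + 1 - 1] is generalised and replaced by [m], the cast runs along a proof of
   [m + 1 = m + 1], which is trivial by uniqueness of identity proofs on [int]. *)
move: (e (m + 1)); have: m + 1 - 1 = m by rewrite addrK.
by move: (m + 1 - 1) => m' -> em; rewrite (eq_axiomK em).
Qed.

(** * Complexes: degreewise constructions, homotopies and cones *)

Section ComplexFacts.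
Variable C : preaddcat.
Implicit Types X Y Z T : complex C.

Lemma complex_kernel X Y Z (i : chain_map X Y) (p : chain_map Y Z) :
  (forall n, is_kernel (i n) (p n)) -> @is_kernel (complexes C) X Y Z i p.
Proof.
move=> ker; split; first by apply: chain_map_ext => n; exact: (ker n).1.
move=> T f pf.
have pfn n : p n \oc f n = 0 by exact: (congr1 (fun h : chain_map T Z => h n) pf).
pose g n := sval (cid ((ker n).2 _ _ (pfn n))).
have gP n : i n \oc g n = f n by rewrite /g; case: cid => h [].
have gC n : g (n + 1) \oc diff T n = diff X n \oc g n.
  apply: (kernel_inj (ker _)).
  by rewrite comp_assoc gP (cmapP f) comp_assoc (cmapP i) -comp_assoc gP.
exists (ChainMap gC); split; first by apply: chain_map_ext => n; exact: gP.
move=> h ih; apply: chain_map_ext => n; apply: (kernel_inj (ker n)).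
by rewrite /= gP -ih.
Qed.

Lemma complex_cokernel X Y Z (i : chain_map X Y) (p : chain_map Y Z) :
  (forall n, is_cokernel (i n) (p n)) -> @is_cokernel (complexes C) X Y Z i p.
Proof.
move=> coker; split; first by apply: chain_map_ext => n; exact: (coker n).1.
move=> T f fi.
have fin n : f n \oc i n = 0 by exact: (congr1 (fun h : chain_map X T => h n) fi).
pose g n := sval (cid ((coker n).2 _ _ (fin n))).
have gP n : g n \oc p n = f n by rewrite /g; case: cid => h [].
have gC n : g (n + 1) \oc diff Z n = diff T n \oc g n.
  apply: (cokernel_inj (coker _)).
  by rewrite -comp_assoc -(cmapP p) comp_assoc gP (cmapP f) -comp_assoc gP.
exists (ChainMap gC); split; first by apply: chain_map_ext => n; exact: gP.
move=> h hp; apply: chain_map_ext => n; apply: (cokernel_inj (coker n)).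
by rewrite /= gP -hp.
Qed.

(** The relation [R] lets the degreewise choice carry more than the kernel property: later it also
    records V-exactness and the existence of a finite spanning family. *)
Lemma kernel_complex Y Z (p : chain_map Y Z)
    (R : forall n (K : C), hom K (Y n) -> Prop) :
  (forall n K i, R n K i -> is_kernel i (p n)) ->
  (forall n, exists K i, R n K i) ->
  exists X (i : chain_map X Y), forall n, R n (X n) (i n).
Proof.
move=> Rker exR.
pose K n := sval (cid (exR n)); pose cK n := svalP (cid (exR n)).
pose i n : hom (K n) (Y n) := sval (cid (cK n)).
have iR n : R n (K n) (i n) by exact: svalP (cid (cK n)).
have ker n := Rker _ _ _ (iR n).
have pdi n : p (n + 1) \oc (diff Y n \oc i n) = 0.
  by rewrite comp_assoc cmapP -comp_assoc (ker n).1 comp0r.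
pose d n := sval (cid ((ker (n + 1)).2 _ _ (pdi n))).
have dP n : i (n + 1) \oc d n = diff Y n \oc i n by rewrite /d; case: cid => h [].
have dd n : d (n + 1) \oc d n = 0.
  apply: (kernel_inj (ker _)).
  by rewrite comp_assoc dP -comp_assoc dP comp_assoc diff_diff comp0l comp0r.
by exists (Complex dd), (@ChainMap _ (Complex dd) Y i dP).
Qed.

Lemma cokernel_complex X Y (i : chain_map X Y)
    (R : forall n (Q : C), hom (Y n) Q -> Prop) :
  (forall n Q p, R n Q p -> is_cokernel (i n) p) ->
  (forall n, exists Q p, R n Q p) ->
  exists Z (p : chain_map Y Z), forall n, R n (Z n) (p n).
Proof.
move=> Rcoker exR.
pose Q n := sval (cid (exR n)); pose cQ n := svalP (cid (exR n)).
pose p n : hom (Y n) (Q n) := sval (cid (cQ n)).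
have pR n : R n (Q n) (p n) by exact: svalP (cid (cQ n)).
have coker n := Rcoker _ _ _ (pR n).
have pdi n : (p (n + 1) \oc diff Y n) \oc i n = 0.
  by rewrite -comp_assoc -cmapP comp_assoc (coker _).1 comp0l.
pose d n := sval (cid ((coker n).2 _ _ (pdi n))).
have dP n : d n \oc p n = p (n + 1) \oc diff Y n by rewrite /d; case: cid => h [].
have dd n : d (n + 1) \oc d n = 0.
  apply: (cokernel_inj (coker _)).
  by rewrite -comp_assoc dP comp_assoc dP -comp_assoc diff_diff comp0l comp0r.
by exists (Complex dd), (@ChainMap _ Y (Complex dd) p (fun n => esym (dP n))).
Qed.

Lemma complexes_split_idempotents :
  splits_idempotents C -> splits_idempotents (complexes C).
Proof.
move=> splitC X e ee.
have een n : e n \oc e n = e n by exact: (congr1 (fun h : chain_map X X => h n) ee).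
pose cY n := cid (splitC _ _ (een n)); pose Y n := sval (cY n).
pose ci n := cid (svalP (cY n)); pose i n : hom (Y n) (X n) := sval (ci n).
pose cp n := cid (svalP (ci n)); pose p n : hom (X n) (Y n) := sval (cp n).
have pi n : p n \oc i n = idm (Y n) by exact: (svalP (cp n)).1.
have ip n : i n \oc p n = e n by exact: (svalP (cp n)).2.
pose d n := p (n + 1) \oc diff X n \oc i n.
have iC n : i (n + 1) \oc d n = diff X n \oc i n.
  by rewrite !comp_assoc ip cmapP -comp_assoc -ip -comp_assoc pi comp_idr.
have pC n : p (n + 1) \oc diff X n = d n \oc p n.
  by rewrite -!comp_assoc ip -cmapP (comp_assoc _ (e _)) -ip comp_assoc pi comp_idl.
have dd n : d (n + 1) \oc d n = 0.
  rewrite [d (n + 1)]/d -!comp_assoc iC (comp_assoc (diff X _)) diff_diff.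
  by rewrite comp0l comp0r.
exists (Complex dd), (@ChainMap _ (Complex dd) X i iC),
  (@ChainMap _ X (Complex dd) p pC).
by split; apply: chain_map_ext => n; [exact: pi|exact: ip].
Qed.

Lemma contractible_homotopy_split X (s : forall n, hom (X (n + 1)) (X n)) :
  (forall n, diff X n \oc s n + s (n + 1) \oc diff X (n + 1) = idm (X (n + 1))) ->
  forall n, diff X n \oc s n \oc diff X n = diff X n.
Proof.
move=> sP; apply: int_succ => m.
rewrite -[RHS]comp_idr -sP comp_addr (comp_assoc _ (diff X m)) diff_diff comp0l.
by rewrite add0r comp_assoc.
Qed.

Lemma contractible_split X : contractible X -> split_complex X.
Proof. by move=> [s sP]; exists s; exact: contractible_homotopy_split. Qed.

Lemma retract_contractible X Y : @retract (complexes C) X Y ->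
  contractible Y -> contractible X.
Proof.
move=> [i [p pi]] [s sP]; exists (fun n => p n \oc s n \oc i (n + 1)) => n.
rewrite !comp_assoc -(cmapP p) -(comp_assoc _ (i (n + 1 + 1))) (cmapP i).
rewrite -!comp_assoc -comp_addr !(comp_assoc _ _ (i _)) -comp_addl sP comp_idl.
exact: (congr1 (fun h : chain_map X X => h (n + 1)) pi).
Qed.

(* If g lifts f degreewise, then g s d + d g s lifts f and is a chain map. *)
Lemma contractible_lift X Y Z (p : chain_map Y Z) (f : chain_map X Z)
    (g : forall n, hom (X n) (Y n)) :
  contractible X -> (forall n, p n \oc g n = f n) ->
  exists h : chain_map X Y, cmap_comp p h = f.
Proof.
move=> [s sP] pg.
have [h hE] := succ_family (P := fun n => hom (X n) (Y n)) (fun m =>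
  g (m + 1) \oc s (m + 1) \oc diff X (m + 1) + diff Y m \oc g m \oc s m).
have hC n : h (n + 1) \oc diff X n = diff Y n \oc h n.
  rewrite hE comp_addl -(comp_assoc _ (diff X (n + 1))) diff_diff comp0r add0r.
  move: n; apply: int_succ => m; rewrite hE comp_addr !comp_assoc diff_diff.
  by rewrite !comp0l addr0.
exists (ChainMap hC); apply: chain_map_ext; apply: int_succ => m /=.
rewrite hE comp_addr !comp_assoc pg (cmapP p) -(comp_assoc (diff Z m)) pg.
by rewrite -(cmapP f) -!comp_assoc -comp_addr [X in _ \oc X]addrC sP comp_idr.
Qed.

Lemma contractible_extend X Y Z (i : chain_map Y Z) (f : chain_map Y X)
    (g : forall n, hom (Z n) (X n)) :
  contractible X -> (forall n, g n \oc i n = f n) ->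
  exists h : chain_map Z X, cmap_comp h i = f.
Proof.
move=> [s sP] gi.
have [h hE] := succ_family (P := fun n => hom (Z n) (X n)) (fun m =>
  diff X m \oc s m \oc g (m + 1) + s (m + 1) \oc g (m + 1 + 1) \oc diff Z (m + 1)).
have hC n : h (n + 1) \oc diff Z n = diff X n \oc h n.
  rewrite hE comp_addl -(comp_assoc _ (diff Z (n + 1))) diff_diff comp0r addr0.
  move: n; apply: int_succ => m; rewrite hE comp_addr !comp_assoc diff_diff.
  by rewrite !comp0l add0r.
exists (ChainMap hC); apply: chain_map_ext; apply: int_succ => m /=.
rewrite hE comp_addl -!comp_assoc gi -(cmapP i) (comp_assoc (g _)) gi.
by rewrite (cmapP f) !comp_assoc -comp_addl sP comp_idl.
Qed.

(** The cone of the identity of the graded object [A]: the differential maps the summand [A n] of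
    degree [n] isomorphically onto the second summand of degree [n + 1]. It is free on [A] and, up
    to a shift, cofree. The last two clauses keep only the factorisations of [e n] and [j n], from
    which V-splitness of [f] is deduced by cancellation. *)
Lemma cone_exists (addC : is_additive C) (A : int -> C) : exists P : complex C,
  [/\ contractible P, forall n, is_biproduct (A n) (A (n - 1)) (P n),
      forall X (e : forall n, hom (A n) (X n)), exists f : chain_map P X,
        forall n, exists a, f n \oc a = e n
    & forall X (j : forall n, hom (X (n + 1)) (A n)), exists f : chain_map X P,
        forall n, exists a, a \oc f (n + 1) = j n].
Proof.
pose B n := A (n - 1).
have eB m : B (m + 1) = A m by rewrite /B addrK.
(* [A m] and [B (m + 1)] are equal only propositionally; a pair of mutually inverse maps replaces
   the cast for the rest of the construction. *)
have [u [v [vu uv]]] : exists (u : forall m, hom (A m) (B (m + 1)))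
    (v : forall m, hom (B (m + 1)) (A m)),
    (forall m, v m \oc u m = idm _) /\ (forall m, u m \oc v m = idm _).
  have cast (X Y : C) (e : Y = X) :
      exists (u : hom X Y) (v : hom Y X), v \oc u = idm X /\ u \oc v = idm Y.
    by case: _ / e; exists (idm Y), (idm Y); rewrite comp_idl.
  pose cu m := cid (cast _ _ (eB m)); pose cv m := cid (svalP (cu m)).
  exists (fun m => sval (cu m)), (fun m => sval (cv m)).
  by split=> m; [exact: (svalP (cv m)).1|exact: (svalP (cv m)).2].
pose cS n := cid (addC.2 (A n) (B n)); pose S n := sval (cS n).
pose ciA n := cid (svalP (cS n)); pose ciB n := cid (svalP (ciA n)).
pose cpA n := cid (svalP (ciB n)); pose cpB n := cid (svalP (cpA n)).
pose iA n : hom (A n) (S n) := sval (ciA n).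
pose iB n : hom (B n) (S n) := sval (ciB n).
pose pA n : hom (S n) (A n) := sval (cpA n).
pose pB n : hom (S n) (B n) := sval (cpB n).
have bip n : biproduct (iA n) (iB n) (pA n) (pB n) := svalP (cpB n).
have AA n : pA n \oc iA n = idm _ by case: (bip n).
have BB n : pB n \oc iB n = idm _ by case: (bip n).
have BA n : pB n \oc iA n = 0 by case: (bip n).
have AB n : pA n \oc iB n = 0 by case: (bip n).
have sum1 n : iA n \oc pA n + iB n \oc pB n = idm _ by case: (bip n).
pose d n := iB (n + 1) \oc u n \oc pA n.
have dd n : d (n + 1) \oc d n = 0.
  by rewrite /d !comp_assoc -(comp_assoc _ (pA _)) AB comp0r !comp0l.
exists (Complex dd); split.
- exists (fun n => iA n \oc v n \oc pB (n + 1)) => n /=.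
  rewrite {1}/d !comp_assoc -(comp_assoc _ (pA n)) AA comp_idr.
  rewrite -(comp_assoc _ (u n)) uv comp_idr.
  rewrite -(comp_assoc _ (pB (n + 1 + 1))) BB comp_idr.
  by rewrite -(comp_assoc _ (v _)) vu comp_idr [LHS]addrC sum1.
- by move=> n; exists (iA n), (iB n), (pA n), (pB n).
- move=> X e.
  (* The summand [B (m + 1)] is the image of [A m] under the differential, so a chain map equal to
     [e] on [A] is forced to be [diff X m \oc e m] there, up to the identification [v]. *)
  have [dl dlE] := succ_family (P := fun n => hom (B n) (X n)) (fun m =>
    diff X m \oc e m \oc v m).
  have fC n : (e (n + 1) \oc pA (n + 1) + dl (n + 1) \oc pB (n + 1)) \oc d n
      = diff X n \oc (e n \oc pA n + dl n \oc pB n).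
    have -> : diff X n \oc (e n \oc pA n + dl n \oc pB n) = diff X n \oc e n \oc pA n.
      move: n; apply: int_succ => m.
      by rewrite dlE comp_addr !comp_assoc diff_diff !comp0l addr0.
    rewrite /d comp_addl !comp_assoc -(comp_assoc _ (pA _)) AB comp0r !comp0l add0r.
    rewrite -(comp_assoc _ (pB _)) BB comp_idr dlE.
    by rewrite -(comp_assoc _ (v n)) vu comp_idr.
  exists (@ChainMap _ (Complex dd) X _ fC) => n; exists (iA n) => /=.
  by rewrite comp_addl -!comp_assoc AA BA comp0r comp_idr addr0.
move=> X j.
(* Dually, once the component into [B (m + 1)] is [j m] up to [u], the component into [A n] is
   forced to be [j n \oc diff X n]. *)
have [b bE] := succ_family (P := fun n => hom (X n) (B n)) (fun m => u m \oc j m).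
have fC n : (iA (n + 1) \oc (j (n + 1) \oc diff X (n + 1)) + iB (n + 1) \oc b (n + 1))
      \oc diff X n
    = d n \oc (iA n \oc (j n \oc diff X n) + iB n \oc b n).
  rewrite comp_addl bE -!comp_assoc diff_diff !comp0r add0r.
  rewrite /d !comp_addr !comp_assoc -(comp_assoc _ (pA n) (iA n)) AA comp_idr.
  by rewrite -(comp_assoc _ (pA n) (iB n)) AB comp0r !comp0l addr0.
exists (@ChainMap _ X (Complex dd) _ fC) => n; exists (v n \oc pB (n + 1)) => /=.
rewrite comp_addr !comp_assoc -!(comp_assoc (v n)) BA !comp0l comp0r add0r.
by rewrite BB comp_idl bE comp_assoc vu comp_idl.
Qed.

(** * Disks and their universal property *)

Section DiskFacts.
Variables (O : C) (O0 : is_zero O).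

Lemma disk_outside W n m : m != n -> m != n + 1 -> is_zero (disk_term O W n m).
Proof. by rewrite /disk_term => /negPf-> /negPf->. Qed.

Lemma of_to_disk W n m : (m == n) || (m == n + 1) ->
  of_disk O W n m \oc to_disk O W n m = idm W.
Proof.
rewrite /of_disk /to_disk /disk_term; case: (_ || _) => // _.
by rewrite comp_idl.
Qed.

Lemma to_of_disk W n m : to_disk O W n m \oc of_disk O W n m = idm _.
Proof.
rewrite /of_disk /to_disk /disk_term; case: (_ || _); first by rewrite comp_idl.
by rewrite comp0l O0.
Qed.

Lemma disk_contractible W n : contractible (disk O W n).
Proof.
exists (fun m => if m == n then to_disk O W n m \oc of_disk O W n (m + 1) else 0) => m.
rewrite /= /disk_diff; have [->|mn] := eqVneq m n.
  have -> : (n + 1 == n) = false by rewrite -subr_eq0 addrAC subrr.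
  rewrite comp0r addr0.
  rewrite comp_assoc -(comp_assoc _ (of_disk _ _ _ n)) of_to_disk ?eqxx //.
  by rewrite comp_idr to_of_disk.
rewrite comp0l add0r; have [<-|m1n] := eqVneq (m + 1) n.
  rewrite comp_assoc -(comp_assoc _ (of_disk _ _ _ (m + 1 + 1))).
  by rewrite of_to_disk ?eqxx ?orbT // comp_idr to_of_disk.
rewrite comp0l; apply/esym; apply: disk_outside => //.
by apply: contra mn => /eqP/addIr->.
Qed.

(** With [disk_hom_ext] this says that the disk is the free complex on [W] placed in degree [n]. *)
Lemma disk_hom_exists W n T (phi : hom W (T n)) :
  exists f : chain_map (disk O W n) T, f n \oc to_disk O W n n = phi.
Proof.
have [psi [psi_n psi_n1]] : exists psi : forall m, hom W (T m),
    psi n = phi /\ psi (n + 1) = diff T n \oc phi.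
  (* The family is [phi] in degree [n], its differential in degree [n + 1] and zero elsewhere. Since
     the type varies with the degree, each member is specified by the relation [a], which compares
     it with transports, and is then extracted by choice. *)
  pose P m := hom W (T m).
  pose a m (x : P m) := (forall e : n = m, x = eq_rect n P phi m e) /\
    (forall e : n + 1 = m, x = eq_rect (n + 1) P (diff T n \oc phi) m e).
  have n1n : n + 1 <> n by move/eqP; rewrite -subr_eq0 addrAC subrr.
  have exa m : exists x, a m x.
    case: (pselect (n = m)) => [<-|mn].
      by exists phi; split=> [e|/n1n//]; rewrite (eq_axiomK e).
    case: (pselect (n + 1 = m)) => [<-|mn1]; last by exists 0; split.
    by exists (diff T n \oc phi); split=> [/esym/n1n//|e]; rewrite (eq_axiomK e).
  exists (fun m => sval (cid (exa m))).
  split; first exact: ((svalP (cid (exa n))).1 erefl).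
  exact: ((svalP (cid (exa (n + 1)))).2 erefl).
have fC m : (psi (m + 1) \oc of_disk O W n (m + 1)) \oc disk_diff O W n m
    = diff T m \oc (psi m \oc of_disk O W n m).
  rewrite /disk_diff; have [->|mn] := eqVneq m n.
    rewrite !comp_assoc -(comp_assoc (psi _)) of_to_disk ?eqxx ?orbT // comp_idr.
    by rewrite psi_n psi_n1.
  rewrite comp0r; have [->|mn1] := eqVneq m (n + 1).
    by rewrite psi_n1 !comp_assoc diff_diff !comp0l.
  by rewrite (zero_dom (of_disk _ _ _ m)) ?comp0r //; exact: disk_outside.
exists (@ChainMap _ (disk O W n) T _ fC) => /=.
by rewrite -comp_assoc of_to_disk ?eqxx // comp_idr psi_n.
Qed.

Lemma disk_hom_ext W n T (f g : chain_map (disk O W n) T) :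
  f n \oc to_disk O W n n = g n \oc to_disk O W n n -> f = g.
Proof.
move=> fg; have fgn : f n = g n.
  by rewrite -[LHS]comp_idr -(to_of_disk W n n) comp_assoc fg -comp_assoc
    to_of_disk comp_idr.
apply: chain_map_ext => m; have [->//|mn] := eqVneq m n.
have [->|mn1] := eqVneq m (n + 1); last first.
  rewrite (zero_dom (f m)) ?(zero_dom (g m)) //; exact: disk_outside.
suff dK : diff (disk O W n) n \oc (to_disk O W n n \oc of_disk O W n (n + 1)) = idm _.
  by rewrite -(comp_idr (f _)) -(comp_idr (g _)) -dK !comp_assoc !cmapP fgn.
rewrite /= /disk_diff eqxx comp_assoc -(comp_assoc _ (of_disk _ _ _ n)).
by rewrite of_to_disk ?eqxx // comp_idr to_of_disk.
Qed.

(* The summand with bottom degree n is the image of the idempotent s d of X n. *)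
Lemma contractible_sum_of_disks X : splits_idempotents C -> contractible X ->
  exists (W : int -> C) (inj : forall n, chain_map (disk O (W n) n) X),
    (forall n, retract (W n) (X n)) /\ @is_coproduct (complexes C) _ _ X inj.
Proof.
move=> splitC [s sP]; have dsd := contractible_homotopy_split sP.
have ee n : (s n \oc diff X n) \oc (s n \oc diff X n) = s n \oc diff X n.
  by rewrite -comp_assoc (comp_assoc (diff X n)) dsd.
pose cW n := cid (splitC _ _ (ee n)); pose W n := sval (cW n).
pose ci n := cid (svalP (cW n)); pose i n : hom (W n) (X n) := sval (ci n).
pose cp n := cid (svalP (ci n)); pose p n : hom (X n) (W n) := sval (cp n).
have pi n : p n \oc i n = idm (W n) by exact: (svalP (cp n)).1.
have ip n : i n \oc p n = s n \oc diff X n by exact: (svalP (cp n)).2.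
have psd n : p n \oc s n \oc diff X n = p n.
  by rewrite -comp_assoc -ip comp_assoc pi comp_idl.
have pd n : p (n + 1) \oc diff X n = 0.
  by rewrite -psd -comp_assoc diff_diff comp0r.
have dip n : diff X n \oc i n \oc p n = diff X n by rewrite -comp_assoc ip comp_assoc dsd.
(* Nothing says that [s] squares to zero. Instead, in degree [n + 1] the map d s is the idempotent
   complementary to s d, so it kills [i (n + 1)]; the equation [p = p s d] brings it into play. *)
have psi n : p n \oc s n \oc i (n + 1) = 0.
  have dsi : diff X n \oc s n \oc i (n + 1) = 0.
    have -> : diff X n \oc s n = idm _ - i (n + 1) \oc p (n + 1).
      by rewrite -(sP n) ip addrK.
    by rewrite compBl comp_idl -comp_assoc pi comp_idr subrr.
  by rewrite -[X in X \oc s n]psd -!comp_assoc (comp_assoc (diff X n)) dsi !comp0r.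
pose inj n := sval (cid (disk_hom_exists (i n))).
have injE n : inj n n \oc to_disk O (W n) n n = i n by rewrite /inj; case: cid.
exists W, inj; split; first by move=> n; exists (i n), (p n).
move=> T f; pose phi n := f n n \oc to_disk O (W n) n n.
(* [X (m + 1)] is the sum of the images of s d, the bottom of disk [m + 1], and of d s, the top of
   disk [m]; the two terms are the values forced on these two parts. *)
have [h hE] := succ_family (P := fun n => hom (X n) (T n)) (fun m =>
  phi (m + 1) \oc p (m + 1) + diff T m \oc phi m \oc p m \oc s m).
have hC n : h (n + 1) \oc diff X n = diff T n \oc h n.
  rewrite hE comp_addl -comp_assoc pd comp0r add0r -!comp_assoc (comp_assoc (p n)) psd.
  move: n; apply: int_succ => m; rewrite hE comp_addr !comp_assoc diff_diff.
  by rewrite !comp0l addr0.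
exists (ChainMap hC); split.
  move=> n; apply: disk_hom_ext => /=; rewrite -comp_assoc injE.
  rewrite -/(phi n); move: n; apply: int_succ => m.
  rewrite hE comp_addl -comp_assoc pi comp_idr -!comp_assoc (comp_assoc (p m)) psi.
  by rewrite !comp0r addr0.
move=> h' h'E; apply: chain_map_ext; apply: int_succ => m /=.
have h'i n : h' n \oc i n = phi n.
  by rewrite /phi -(h'E n) /= -comp_assoc injE.
rewrite hE -[RHS]comp_idr -sP comp_addr [RHS]addrC; congr (_ + _).
  by rewrite -ip comp_assoc h'i.
rewrite -h'i -[X in h' _ \oc (X \oc _)]dip !comp_assoc.
by rewrite (cmapP h').
Qed.

End DiskFacts.
End ComplexFacts.

(** * Kernels and cokernels of module homomorphisms *)

Section GKernel.
Variables (k : pzRingType) (G : finGroupType) (M N : gmodType k G) (f : ghom M N).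

Definition gker_pred : {pred M} := [pred x | f x == 0].

Fact gker_submod_closed : submod_closed gker_pred.
Proof.
split=> [|a x y]; rewrite !inE ?raddf0 // => /eqP fx /eqP fy.
by rewrite linearP /= fx fy scaler0 addr0.
Qed.
HB.instance Definition _ :=
  GRing.isSubmodClosed.Build k M gker_pred gker_submod_closed.

Record gker := GKer { gker_val : M; gker_valP : gker_val \in gker_pred }.
HB.instance Definition _ := [isSub for gker_val].
HB.instance Definition _ := [Choice of gker by <:].
HB.instance Definition _ := [SubChoice_isSubLmodule of gker by <:].

Fact gker_gact_subproof (g : G) (x : gker) : gact g (val x) \in gker_pred.
Proof. by case: x => x /= /eqP fx; rewrite inE ghomJ fx raddf0. Qed.
Definition gker_gact g x := GKer (gker_gact_subproof g x).

Fact gker_gact_linear g : linear (gker_gact g).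
Proof. by move=> a x y; apply: val_inj; rewrite /= linearP. Qed.
Fact gker_gact1 x : gker_gact 1%g x = x.
Proof. by apply: val_inj; exact: gact1. Qed.
Fact gker_gactM g h x : gker_gact (g * h)%g x = gker_gact g (gker_gact h x).
Proof. by apply: val_inj; exact: gactM. Qed.
HB.instance Definition _ :=
  Lmodule_hasGAction.Build k G gker gker_gact_linear gker_gact1 gker_gactM.

Lemma gker_exists : exists (K : gmodType k G) (i : ghom K M),
  injective i /\ forall y, f y = 0 <-> exists x, y = i x.
Proof.
have iL : linear (gker_val : gker -> M) by [].
exists gker, (@GHom k G gker M _ iL (fun _ _ => erefl)); split; first exact: val_inj.
move=> y; split=> [fy|[[x /= /eqP fx] ->]//].
have yP : y \in gker_pred by rewrite inE fy.
by exists (GKer yP).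
Qed.

End GKernel.

Section GCokernel.
Variables (k : pzRingType) (G : finGroupType) (M N : gmodType k G) (f : ghom M N).

Definition gim_pred : {pred N} := [pred y | `[< exists x, y = f x >]].

Fact gim_zmod_closed : zmod_closed gim_pred.
Proof.
split=> [|y z /asboolP[x ->] /asboolP[x' ->]]; apply/asboolP.
  by exists 0; rewrite raddf0.
by exists (x - x'); rewrite raddfB.
Qed.
HB.instance Definition _ := GRing.isZmodClosed.Build N gim_pred gim_zmod_closed.

Definition gcoker := Quotient.quot (gim_pred : zmodClosed N).
HB.instance Definition _ := GRing.Zmodule.on gcoker.

Definition gcoker_pi (y : N) : gcoker := \pi_(Quotient.quot (gim_pred : zmodClosed N)) y.
Definition gcoker_repr (t : gcoker) : N :=
  repr (t : Quotient.quot (gim_pred : zmodClosed N)).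

Lemma gcoker_reprK t : gcoker_pi (gcoker_repr t) = t.
Proof. exact: reprK. Qed.

Lemma gcoker_piP y z : gcoker_pi y = gcoker_pi z <-> exists x, y - z = f x.
Proof.
split=> [/eqP|yz]; last apply/eqP.
  by rewrite /gcoker_pi -Quotient.idealrBE => /asboolP.
by rewrite /gcoker_pi -Quotient.idealrBE; apply/asboolP.
Qed.

Lemma gcoker_piD y z : gcoker_pi (y + z) = gcoker_pi y + gcoker_pi z.
Proof. exact: Quotient.pi_add. Qed.

Definition gcoker_scale (a : k) t := gcoker_pi (a *: gcoker_repr t).
Definition gcoker_gact (g : G) t := gcoker_pi (gact g (gcoker_repr t)).

Lemma gcoker_scaleE a y : gcoker_scale a (gcoker_pi y) = gcoker_pi (a *: y).
Proof.
have /gcoker_piP[x xP] := gcoker_reprK (gcoker_pi y).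
by apply/gcoker_piP; exists (a *: x); rewrite -scalerBr xP linearZZ.
Qed.

Lemma gcoker_gactE g y : gcoker_gact g (gcoker_pi y) = gcoker_pi (gact g y).
Proof.
have /gcoker_piP[x xP] := gcoker_reprK (gcoker_pi y).
by apply/gcoker_piP; exists (gact g x); rewrite -raddfB xP ghomJ.
Qed.

Fact gcoker_scaleA a b t : gcoker_scale a (gcoker_scale b t) = gcoker_scale (a * b) t.
Proof. by rewrite -(gcoker_reprK t) !gcoker_scaleE scalerA. Qed.
Fact gcoker_scale1 : left_id 1 gcoker_scale.
Proof. by move=> t; rewrite -(gcoker_reprK t) gcoker_scaleE scale1r. Qed.
Fact gcoker_scaleDr : right_distributive gcoker_scale +%R.
Proof.
move=> a t u; rewrite -(gcoker_reprK t) -(gcoker_reprK u).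
by rewrite -gcoker_piD !gcoker_scaleE scalerDr gcoker_piD.
Qed.
Fact gcoker_scaleDl t : {morph gcoker_scale^~ t : a b / a + b}.
Proof.
by move=> a b; rewrite -(gcoker_reprK t) !gcoker_scaleE scalerDl gcoker_piD.
Qed.
HB.instance Definition _ := GRing.Zmodule_isLmodule.Build k gcoker
  gcoker_scaleA gcoker_scale1 gcoker_scaleDr gcoker_scaleDl.

Fact gcoker_gact_linear g : linear (gcoker_gact g).
Proof.
move=> a t u; rewrite -(gcoker_reprK t) -(gcoker_reprK u).
rewrite -[a *: _]/(gcoker_scale a _) !gcoker_gactE gcoker_scaleE -gcoker_piD.
by rewrite gcoker_gactE linearP gcoker_piD -gcoker_scaleE.
Qed.
Fact gcoker_gact1 t : gcoker_gact 1%g t = t.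
Proof. by rewrite -(gcoker_reprK t) gcoker_gactE gact1. Qed.
Fact gcoker_gactM g h t : gcoker_gact (g * h)%g t = gcoker_gact g (gcoker_gact h t).
Proof. by rewrite -(gcoker_reprK t) !gcoker_gactE gactM. Qed.
HB.instance Definition _ :=
  Lmodule_hasGAction.Build k G gcoker gcoker_gact_linear gcoker_gact1 gcoker_gactM.

Lemma gcoker_exists : exists (Q : gmodType k G) (p : ghom N Q),
  (forall z, exists y, p y = z) /\ forall y, p y = 0 <-> exists x, y = f x.
Proof.
have pL : linear gcoker_pi.
  by move=> a y z; rewrite gcoker_piD -gcoker_scaleE.
exists gcoker, (@GHom k G N gcoker _ pL (fun g y => esym (gcoker_gactE g y))).
split; first by move=> t; exists (gcoker_repr t); exact: gcoker_reprK.
move=> y; have pi0 : gcoker_pi 0 = 0.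
  by apply: (addrI (gcoker_pi 0)); rewrite -gcoker_piD !addr0.
by split=> [/= py|[x yx]/=]; [rewrite -[y]subr0; apply/gcoker_piP; rewrite py pi0
  |rewrite -pi0; apply/gcoker_piP; exists x; rewrite subr0].
Qed.

End GCokernel.

(** * Exactness, split idempotents and finite spanning of modules *)

Section ModuleFacts.
Variables (k : pzRingType) (G : finGroupType).
Implicit Types L M N : gmodType k G.

Lemma injective_kernel L M N (i : ghom L M) (p : ghom M N) :
  injective i -> (forall y, p y = 0 <-> exists x, y = i x) ->
  @is_kernel (Mod k G) L M N i p.
Proof.
move=> i_inj mid; split; first by apply: ghom_ext => x; apply/mid; exists x.
move=> T f pf; have fP t : exists x, f t = i x.
  by apply/mid; exact: (congr1 (fun h : ghom T N => h t) pf).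
pose u t := sval (cid (fP t)).
have uP t : i (u t) = f t by rewrite /u; case: cid.
have uL : linear u.
  by move=> a x y; apply: i_inj; rewrite linearP /= !uP linearP.
have uJ (g : G) x : u (gact g x) = gact g (u x).
  by apply: i_inj; rewrite ghomJ !uP ghomJ.
exists (GHom uL uJ); split; first by apply: ghom_ext => t; exact: uP.
move=> v iv; apply: ghom_ext => t; apply: i_inj; rewrite [LHS]uP.
by rewrite -iv.
Qed.

Lemma short_exact_kernel L M N (i : ghom L M) (p : ghom M N) :
  short_exact i p -> @is_kernel (Mod k G) L M N i p.
Proof. by case=> i_inj mid _; exact: injective_kernel. Qed.

Lemma short_exact_cokernel L M N (i : ghom L M) (p : ghom M N) :
  short_exact i p -> @is_cokernel (Mod k G) L M N i p.
Proof.
case=> i_inj mid p_surj; split.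
  by apply: ghom_ext => x; apply/mid; exists x.
move=> T f fi; pose q z := sval (cid (p_surj z)).
have qP z : p (q z) = z by rewrite /q; case: cid.
have fE y y' : p y = p y' -> f y = f y'.
  move=> pyy; have /mid[x xP] : p (y - y') = 0 by rewrite raddfB /= pyy subrr.
  apply/eqP; rewrite -subr_eq0 -raddfB xP; apply/eqP.
  exact: (congr1 (fun h : ghom L T => h x) fi).
have uL : linear (fun z => f (q z)).
  by move=> a x y; rewrite -linearP; apply: fE; rewrite linearP /= !qP.
have uJ (g : G) x : f (q (gact g x)) = gact g (f (q x)).
  by rewrite -ghomJ; apply: fE; rewrite ghomJ !qP.
exists (GHom uL uJ); split; first by apply: ghom_ext => y; apply: fE; exact: qP.
move=> v vp; apply: ghom_ext => z /=; rewrite -[in RHS](qP z).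
by rewrite -vp.
Qed.

(** The image of [e] is obtained as the kernel of [idm X - e]. *)
Lemma Mod_splits_idempotents : splits_idempotents (Mod k G).
Proof.
move=> X e ee; have [K [i [i_inj iP]]] := gker_exists (idm X - e : ghom X X).
have ker := injective_kernel i_inj iP.
have [p [ip _]] : exists! p : hom X K, (i : @hom (Mod k G) K X) \oc p = e.
  by apply: ker.2; rewrite compBl comp_idl ee subrr.
exists K, i, p; split=> //; apply: (kernel_inj ker).
have /eqP := ker.1; rewrite compBl comp_idl subr_eq0 => /eqP ei.
by rewrite comp_assoc ip comp_idr -ei.
Qed.

(** As [G] is finite, this is finite generation over kG; it is the form that passes through tensor
    products and through sections that are merely k-linear. *)
Definition kspan M := exists (I : finType) (e : I -> M),
  forall x : M, exists a : I -> k, x = \sum_i a i *: e i.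

Lemma kspan_fin_gen M : kspan M <-> fin_gen M.
Proof.
split=> [[I [e eP]]|[n [e eP]]].
  exists #|I|, (fun i => e (enum_val i)) => x; have [a ->] := eP x.
  exists (fun i g => if g == 1%g then a (enum_val i) else 0).
  rewrite (reindex (@enum_val I predT)) /=; last exact/onW_bij/enum_val_bij.
  apply: eq_bigr => i _; rewrite (bigD1 1%g) //= eqxx gact1 big1 ?addr0 // => g.
  by move=> /negPf->; rewrite scale0r.
exists ('I_n * G)%type, (fun ig => gact ig.2 (e ig.1)) => x; have [a ->] := eP x.
exists (fun ig => a ig.1 ig.2).
by rewrite pair_big.
Qed.

Lemma kspan_surj M N (p : M -> N) : linear p -> (forall z, exists y, p y = z) ->
  kspan M -> kspan N.
Proof.
move=> pL p_surj [I [e eP]]; exists I, (fun i => p (e i)) => z.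
have [y <-] := p_surj z; have [a ->] := eP y; exists a.
pose pl : {linear M -> N} := HB.pack p (GRing.isLinear.Build k M N _ p pL).
rewrite -[p]/(pl : M -> N) raddf_sum.
by apply: eq_bigr => i _; exact: (linearZZ pl).
Qed.

Lemma kspan_retract M N : @retract (Mod k G) M N -> kspan N -> kspan M.
Proof.
move=> [i [p pi]]; apply: (kspan_surj (ghom_linear (p : ghom N M))) => x.
by exists ((i : ghom M N) x); exact: (congr1 (fun h : ghom M M => h x) pi).
Qed.

(** The map [1 - s p] projects [M] onto the kernel and carries a spanning family along. The section
    need not commute with [G], and the one supplied by a V-split epi does not in general. *)
Lemma kspan_kernel L M N (i : ghom L M) (p : ghom M N) (s : N -> M) : linear s ->
  cancel s p -> injective i -> (forall y, p y = 0 <-> exists x, y = i x) ->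
  kspan M -> kspan L.
Proof.
move=> sL sK i_inj mid [I [e eP]].
pose sl : {linear N -> M} := HB.pack s (GRing.isLinear.Build k N M _ s sL).
have uP j : exists x, e j - sl (p (e j)) = i x.
  by apply/mid; rewrite raddfB [X in _ - X]sK subrr.
pose u j := sval (cid (uP j)).
have uE j : i (u j) = e j - sl (p (e j)) by rewrite /u; case: cid.
exists I, u => x; have [a aP] := eP (i x); exists a; apply: i_inj.
have pix : p (i x) = 0 by apply/mid; exists x.
have slpE : sl (p (i x)) = \sum_j a j *: sl (p (e j)).
  rewrite aP (raddf_sum p) (raddf_sum sl); apply: eq_bigr => j _.
  by rewrite -(linearZZ sl) -(linearZZ p).
rewrite raddf_sum; transitivity (i x - sl (p (i x))).
  by rewrite pix raddf0 subr0.
rewrite slpE aP -sumrB; apply: eq_bigr => j _.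
by rewrite -scalerBr -uE; exact: esym (linearZZ i _ _).
Qed.

End ModuleFacts.

(** * Relative splitting *)

Section TensorFacts.
Variables (k : comPzRingType) (G : finGroupType) (V : gmodType k G).
Implicit Types (X Y Z W : gmodType k G).

Lemma tens0l X (x : X) : tens (0 : V) x = 0.
Proof. by apply: (addrI (tens 0 x)); rewrite -tensDl !addr0. Qed.

Lemma tens0r X (v : V) : tens v (0 : X) = 0.
Proof. by apply: (addrI (tens v 0)); rewrite -tensDr !addr0. Qed.

Lemma tens_suml X (I : Type) (s : seq I) (F : I -> V) (x : X) :
  tens (\sum_(i <- s) F i) x = \sum_(i <- s) tens (F i) x.
Proof.
by elim: s => [|i s IHs]; rewrite ?big_nil ?tens0l // !big_cons tensDl IHs.
Qed.

Lemma tens_sumr X (I : Type) (s : seq I) (F : I -> X) (v : V) :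
  tens v (\sum_(i <- s) F i) = \sum_(i <- s) tens v (F i).
Proof.
by elim: s => [|i s IHs]; rewrite ?big_nil ?tens0r // !big_cons tensDr IHs.
Qed.

Lemma tens_ext X (U : zmodType) (f h : tensor V X -> U) :
  {morph f : t u / t + u} -> {morph h : t u / t + u} ->
  (forall v x, f (tens v x) = h (tens v x)) -> f =1 h.
Proof.
move=> fD hD fh t.
have f0 : f 0 = 0 by apply: (addrI (f 0)); rewrite -fD !addr0.
have h0 : h 0 = 0 by apply: (addrI (h 0)); rewrite -hD !addr0.
rewrite -(tens_reprK t) tens_classE (big_morph _ fD f0) (big_morph _ hD h0).
by apply: eq_bigr => p _.
Qed.

Lemma tens_ghom_ext X W (f h : ghom (tensor V X) W) :
  (forall v x, f (tens v x) = h (tens v x)) -> f = h.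
Proof. by move=> fh; apply: ghom_ext; apply: tens_ext fh; exact: raddfD. Qed.

Lemma tens_lift X (U : lmodType k) (b : V -> X -> U) :
  (forall v, linear (b v)) -> (forall x, linear (b^~ x)) ->
  exists f : {linear tensor V X -> U}, forall v x, f (tens v x) = b v x.
Proof.
move=> br bl; have [f [[fL fE] _]] := tensor_universal br bl.
pose fl : {linear tensor V X -> U} := HB.pack f (GRing.isLinear.Build k _ _ _ f fL).
by exists fl.
Qed.

Lemma tens_ghom_lift X W (b : V -> X -> W) :
  (forall v, linear (b v)) -> (forall x, linear (b^~ x)) ->
  (forall (g : G) v x, b (gact g v) (gact g x) = gact g (b v x)) ->
  exists f : ghom (tensor V X) W, forall v x, f (tens v x) = b v x.
Proof.
move=> br bl bJ; have [f fE] := tens_lift br bl.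
have fJ (g : G) t : f (gact g t) = gact g (f t).
  move: t; apply: tens_ext => [t u|t u|v x]; rewrite ?raddfD ?raddfD //.
  by rewrite tensJ !fE bJ.
by exists (GHom (linearP f) fJ).
Qed.

Definition Vtens (X : Mod k G) : Mod k G := tensor V X.
Definition Vtens_map (X Y : Mod k G) (f : hom X Y) : hom (Vtens X) (Vtens Y) :=
  tens_hom V (f : ghom X Y).

Lemma Vtens_map_id (X : Mod k G) : Vtens_map (idm X) = idm (Vtens X).
Proof. by apply: tens_ghom_ext => v x; rewrite tens_homE. Qed.

Lemma Vtens_map_comp (X Y Z : Mod k G) (g : hom Y Z) (f : hom X Y) :
  Vtens_map (g \oc f) = Vtens_map g \oc Vtens_map f.
Proof.
apply: tens_ghom_ext => v x; transitivity (tens v ((g : ghom _ _) ((f : ghom _ _) x))).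
  exact: tens_homE.
by symmetry; apply: etrans (congr1 (tens_hom V g) (tens_homE f v x)) _; exact: tens_homE.
Qed.

Lemma Vtens_mapD (X Y : Mod k G) (f g : hom X Y) :
  Vtens_map (f + g) = Vtens_map f + Vtens_map g.
Proof.
apply: tens_ghom_ext => v x; apply: etrans (tens_homE _ _ _) _.
by rewrite [LHS]tensDr; congr (_ + _); symmetry; exact: tens_homE.
Qed.

Lemma Vtens_map0 (X Y : Mod k G) : Vtens_map (0 : hom X Y) = 0.
Proof. by apply: (addrI (Vtens_map 0)); rewrite -Vtens_mapD !addr0. Qed.

Lemma Vtens_zero (X : Mod k G) : is_zero X -> is_zero (Vtens X).
Proof. by rewrite /is_zero => X0; rewrite -Vtens_map_id X0 Vtens_map0. Qed.

Definition Vsplit_mono (X Y : Mod k G) (i : hom X Y) :=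
  exists t, t \oc Vtens_map i = idm (Vtens X).
Definition Vsplit_epi (X Y : Mod k G) (p : hom X Y) :=
  exists s, Vtens_map p \oc s = idm (Vtens Y).
Definition Vexact (X Y Z : Mod k G) (i : hom X Y) (p : hom Y Z) :=
  short_exact (i : ghom X Y) (p : ghom Y Z) /\
  split_sequence (Vtens_map i : ghom _ _) (Vtens_map p : ghom _ _).

Lemma Vsplit_mono_id (X : Mod k G) : Vsplit_mono (idm X).
Proof. by exists (idm _); rewrite Vtens_map_id comp_idl. Qed.

Lemma Vsplit_epi_id (X : Mod k G) : Vsplit_epi (idm X).
Proof. by exists (idm _); rewrite Vtens_map_id comp_idl. Qed.

Lemma Vsplit_mono_comp (X Y Z : Mod k G) (j : hom Y Z) (i : hom X Y) :
  Vsplit_mono i -> Vsplit_mono j -> Vsplit_mono (j \oc i).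
Proof.
move=> [t ti] [u uj]; exists (t \oc u).
by rewrite Vtens_map_comp -comp_assoc (comp_assoc u) uj comp_idl.
Qed.

Lemma Vsplit_epi_comp (X Y Z : Mod k G) (q : hom Y Z) (p : hom X Y) :
  Vsplit_epi p -> Vsplit_epi q -> Vsplit_epi (q \oc p).
Proof.
move=> [s ps] [u qu]; exists (s \oc u).
by rewrite Vtens_map_comp -comp_assoc (comp_assoc _ s) ps comp_idl.
Qed.

Lemma Vsplit_mono_cancel (X Y Z : Mod k G) (j : hom Y Z) (i : hom X Y) :
  Vsplit_mono (j \oc i) -> Vsplit_mono i.
Proof. by move=> [t]; rewrite Vtens_map_comp comp_assoc; exists (t \oc Vtens_map j). Qed.

Lemma Vsplit_epi_cancel (X Y Z : Mod k G) (q : hom Y Z) (p : hom X Y) :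
  Vsplit_epi (q \oc p) -> Vsplit_epi q.
Proof. by move=> [s]; rewrite Vtens_map_comp -comp_assoc; exists (Vtens_map p \oc s). Qed.

Lemma Vexact_kernel (X Y Z : Mod k G) (i : hom X Y) (p : hom Y Z) :
  Vexact i p -> is_kernel i p.
Proof. by move=> [se _]; exact: short_exact_kernel. Qed.

Lemma Vexact_cokernel (X Y Z : Mod k G) (i : hom X Y) (p : hom Y Z) :
  Vexact i p -> is_cokernel i p.
Proof. by move=> [se _]; exact: short_exact_cokernel. Qed.

Lemma Vexact_epi (X Y Z : Mod k G) (i : hom X Y) (p : hom Y Z) :
  Vexact i p -> Vsplit_epi p.
Proof. by move=> [_ [_ [s sP]]]; exists s; exact: ghom_ext. Qed.

(** A split sequence comes with a section of its epi only; the retraction of its mono is the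
    factorisation of [1 - s p] through the kernel. *)
Lemma Vexact_mono (X Y Z : Mod k G) (i : hom X Y) (p : hom Y Z) :
  Vexact i p -> Vsplit_mono i.
Proof.
move=> ex; have [s ps] := Vexact_epi ex; have [_ [se _]] := ex.
have ker := short_exact_kernel se.
have [t [it _]] : exists! t : hom (Vtens Y) (Vtens X),
    Vtens_map i \oc t = idm (Vtens Y) - s \oc Vtens_map p.
  by apply: ker.2; rewrite compBr comp_idr comp_assoc ps comp_idl subrr.
exists t; apply: (kernel_inj ker); rewrite comp_assoc it compBl comp_idl comp_idr.
by rewrite -comp_assoc (ker.1 : Vtens_map p \oc Vtens_map i = 0) comp0r subr0.
Qed.

(** [Vtens_map q] is again a cokernel, so a retraction may be defined on the tensored biproduct:
    take [Vtens_map f \oc t] on the part from [Y] and the identity on the part from [X'], which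
    together kill the antidiagonal. *)
Lemma Vsplit_mono_pushout (X Y X' S Q : Mod k G) (i : hom X Y) (f : hom X X')
    (iY : hom Y S) (iX' : hom X' S) (pY : hom S Y) (pX' : hom S X')
    (q : hom S Q) :
  biproduct iY iX' pY pX' -> Vsplit_mono i ->
  Vexact (iY \oc i - iX' \oc f) q -> Vsplit_mono (q \oc iX').
Proof.
move=> [YY XX XY YX sum1] [t ti] [_ [/short_exact_cokernel [_ univ] _]].
have e0 : (Vtens_map f \oc t \oc Vtens_map pY + Vtens_map pX') \oc
    Vtens_map (iY \oc i - iX' \oc f) = 0.
  rewrite comp_addl -!comp_assoc -!Vtens_map_comp !compBr.
  rewrite !(comp_assoc pY) !(comp_assoc pX') YY XX XY YX !comp0l !comp_idl subr0 sub0r.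
  by rewrite ti comp_idr -Vtens_mapD subrr Vtens_map0.
have [h [hq _]] := univ _ _ e0.
exists h; rewrite Vtens_map_comp comp_assoc.
have -> : h \oc Vtens_map q = Vtens_map f \oc t \oc Vtens_map pY + Vtens_map pX' := hq.
rewrite comp_addl -comp_assoc -!Vtens_map_comp YX XX Vtens_map0 comp0r add0r.
by rewrite Vtens_map_id.
Qed.

Lemma Vsplit_epi_pullback (Y Z Z' S K : Mod k G) (p : hom Y Z) (f : hom Z' Z)
    (iY : hom Y S) (iZ' : hom Z' S) (pY : hom S Y) (pZ' : hom S Z')
    (j : hom K S) :
  biproduct iY iZ' pY pZ' -> Vsplit_epi p ->
  Vexact j (p \oc pY - f \oc pZ') -> Vsplit_epi (pZ' \oc j).
Proof.
move=> [YY ZZ ZY YZ sum1] [s ps] [_ [/short_exact_kernel [_ univ] _]].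
have e0 : Vtens_map (p \oc pY - f \oc pZ') \oc
    (Vtens_map iY \oc (s \oc Vtens_map f) + Vtens_map iZ') = 0.
  rewrite comp_addr !comp_assoc -!Vtens_map_comp !compBl -!(comp_assoc p) -!(comp_assoc f).
  rewrite YY ZZ ZY YZ !comp0r !comp_idr subr0 sub0r.
  by rewrite ps comp_idl -Vtens_mapD subrr Vtens_map0.
have [h [jh _]] := univ _ _ e0.
exists h; rewrite Vtens_map_comp -comp_assoc.
have -> : Vtens_map j \oc h = Vtens_map iY \oc (s \oc Vtens_map f) + Vtens_map iZ' := jh.
rewrite comp_addr comp_assoc -!Vtens_map_comp ZY ZZ Vtens_map0 comp0l add0r.
by rewrite Vtens_map_id.
Qed.

Lemma Vexact_iso (X Y Z X' Y' Z' : Mod k G) (i : hom X Y) (p : hom Y Z)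
    (i' : hom X' Y') (p' : hom Y' Z') (a : hom X X') (b : hom Y Y') (c : hom Z Z') :
  isomorphism a -> isomorphism b -> isomorphism c ->
  b \oc i = i' \oc a -> c \oc p = p' \oc b -> Vexact i p -> Vexact i' p'.
Proof.
have se_iso (X0 Y0 Z0 X0' Y0' Z0' : Mod k G) (i0 : hom X0 Y0) (p0 : hom Y0 Z0)
    (i0' : hom X0' Y0') (p0' : hom Y0' Z0')
    (a0 : hom X0 X0') (b0 : hom Y0 Y0') (c0 : hom Z0 Z0') :
    isomorphism a0 -> isomorphism b0 -> isomorphism c0 ->
    b0 \oc i0 = i0' \oc a0 -> c0 \oc p0 = p0' \oc b0 ->
    short_exact (i0 : ghom _ _) (p0 : ghom _ _) ->
    short_exact (i0' : ghom _ _) (p0' : ghom _ _).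
  move=> [a' [a'a aa']] [b' [b'b bb']] [c' [c'c cc']] bi cp [i_inj mid p_surj].
  have E (U U' : gmodType k G) (f g : ghom U U') : f = g -> forall x, f x = g x.
    by move=> ->.
  move: (E _ _ _ _ a'a) (E _ _ _ _ aa') => /= {}a'a {}aa'.
  move: (E _ _ _ _ b'b) (E _ _ _ _ bb') => /= {}b'b {}bb'.
  move: (E _ _ _ _ c'c) (E _ _ _ _ cc') => /= {}c'c {}cc'.
  move: (E _ _ _ _ bi) (E _ _ _ _ cp) => /= {}bi {}cp.
  split.
  - move=> x y; rewrite -(aa' x) -(aa' y) -!bi => /(can_inj b'b)/i_inj.
    by move=> ->.
  - move=> y; rewrite -(bb' y) -cp; split=> [cpy|[x]].
      have /mid[x ->] : (p0 : ghom _ _) ((b' : ghom _ _) y) = 0.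
        by rewrite -[LHS]c'c cpy raddf0.
      by exists ((a0 : ghom _ _) x); rewrite bi.
    rewrite -(aa' x) -bi => /(can_inj b'b) yx.
    by rewrite (iffRL (mid _)) ?raddf0 //; exists ((a' : ghom _ _) x).
  move=> z; have [y yz] := p_surj ((c' : ghom _ _) z).
  by exists ((b0 : ghom _ _) y); rewrite -cp yz cc'.
have F_iso (U U' : Mod k G) (f : hom U U') : isomorphism f -> isomorphism (Vtens_map f).
  by move=> [g [gf fg]]; exists (Vtens_map g); rewrite -!Vtens_map_comp gf fg !Vtens_map_id.
move=> ia ib ic bi cp ex; have [se [seF _]] := ex.
have FbFi := congr1 (@Vtens_map _ _) bi; have FcFp := congr1 (@Vtens_map _ _) cp.
rewrite !Vtens_map_comp in FbFi FcFp.
split; first exact: se_iso bi cp se.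
split; first exact: se_iso (F_iso _ _ _ ia) (F_iso _ _ _ ib) (F_iso _ _ _ ic) FbFi FcFp seF.
have [s ps] := Vexact_epi ex; have [c' [c'c cc']] := F_iso _ _ _ ic.
exists (Vtens_map b \oc s \oc c' : ghom _ _) => z.
suff : Vtens_map p' \oc (Vtens_map b \oc s \oc c') = idm _.
  by move=> /(congr1 (fun h : ghom _ _ => h z)).
by rewrite !comp_assoc -FcFp -(comp_assoc _ _ s) ps comp_idr cc'.
Qed.

Lemma Vprojective_retract W :
  Vprojective V W <-> exists X : Mod k G, @retract (Mod k G) W (Vtens X).
Proof.
split=> [[X [W' /biproduct_retract WX]]|[X [i [p pi]]]]; first by exists X.
have [Z [j [q [bip _]]]] := idempotent_biproduct (@Mod_splits_idempotents k G) pi.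
by exists X, Z, i, j, p, q.
Qed.

Lemma Vprojective_summand W W' :
  @retract (Mod k G) W W' -> Vprojective V W' -> Vprojective V W.
Proof.
move=> WW' /Vprojective_retract[X W'X]; apply/Vprojective_retract.
by exists X; exact: retract_trans W'X.
Qed.

Lemma Vprojective_zero W : @is_zero (Mod k G) W -> Vprojective V W.
Proof.
move=> W0; apply/Vprojective_retract; exists W, 0, 0.
by rewrite comp0l W0.
Qed.

Lemma Vprojective_biproduct W W' S : @is_biproduct (Mod k G) W W' S ->
  Vprojective V W -> Vprojective V W' -> Vprojective V S.
Proof.
move=> [i [i' [p [p' [pi p'i' p'i pi' sum1]]]]].
move=> /Vprojective_retract[X [j [q qj]]] /Vprojective_retract[X' [j' [q' q'j']]].
have [B [u [u' [w [w' [wu w'u' w'u wu' _]]]]]] := (Mod_additive k G).2 X X'.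
apply/Vprojective_retract; exists B.
exists (Vtens_map u \oc j \oc p + Vtens_map u' \oc j' \oc p').
exists (i \oc q \oc Vtens_map w + i' \oc q' \oc Vtens_map w').
rewrite comp_addl !comp_addr !comp_assoc -!(comp_assoc _ (Vtens_map w)).
rewrite -!(comp_assoc _ (Vtens_map w')) -!Vtens_map_comp wu w'u' w'u wu'.
rewrite !Vtens_map_id !Vtens_map0 !comp0r !comp0l !comp_idr addr0 add0r.
by rewrite -!(comp_assoc _ q) -(comp_assoc _ q') qj q'j' !comp_idr.
Qed.

End TensorFacts.

(** * Contraction and lifting *)

Lemma free_coordinates (k : comPzRingType) (G : finGroupType) (V : gmodType k G) r :
  free_of_rank V r -> exists (e : 'I_r -> V) (co : 'I_r -> V -> k),
  [/\ forall i a v w, co i (a *: v + w) = a * co i v + co i w,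
      forall v, v = \sum_i co i v *: e i & forall i j, co i (e j) = (i == j)%:R].
Proof.
move=> [e eP]; pose c v := sval (cid (eP v)).
have cP v : v = \sum_i c v 0 i *: e i by rewrite /c; case: cid => a [].
have cU v (a : 'rV[k]_r) : v = \sum_i a 0 i *: e i -> c v = a.
  by move=> va; have [_ U] := svalP (cid (eP v)); exact: U.
exists e, (fun i v => c v 0 i); split=> // [i a v w|i j].
  have -> : c (a *: v + w) = a *: c v + c w; last by rewrite !mxE.
  apply: cU; rewrite {1}(cP v) {1}(cP w) scaler_sumr -big_split /=.
  by apply: eq_bigr => j _; rewrite !mxE scalerDl scalerA.
have -> : c (e j) = \row_l (l == j)%:R; last by rewrite mxE.
apply: cU; rewrite (bigD1 j) //= mxE eqxx scale1r big1 ?addr0 // => l /negPf lj.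
by rewrite mxE lj scale0r.
Qed.

Section FreeTensor.
Variables (k : comPzRingType) (G : finGroupType) (V : gmodType k G) (r : nat).
Variables (e : 'I_r -> V) (co : 'I_r -> V -> k).
Hypothesis co_lin : forall i a v w, co i (a *: v + w) = a * co i v + co i w.
Hypothesis co_sum : forall v, v = \sum_i co i v *: e i.
Hypothesis co_basis : forall i j, co i (e j) = (i == j)%:R.
Implicit Types X Y Z : Mod k G.

Lemma tcoord_subproof (X : gmodType k G) i :
  exists f : {linear tensor V X -> X}, forall v x, f (tens v x) = co i v *: x.
Proof.
apply: tens_lift => [v|x] a y z.
  by rewrite scalerDr !scalerA mulrC.
by rewrite co_lin scalerDl scalerA.
Qed.

(** The i-th dual basis vector tensored with [X]; it is k-linear but in general not
    G-equivariant. *)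
Definition tcoord (X : gmodType k G) i : {linear tensor V X -> X} :=
  sval (cid (tcoord_subproof X i)).

Lemma tcoordE (X : gmodType k G) i v (x : X) : tcoord X i (tens v x) = co i v *: x.
Proof. exact: (svalP (cid (tcoord_subproof X i))). Qed.

Lemma tcoord_sum (X : gmodType k G) (t : tensor V X) :
  t = \sum_i tens (e i) (tcoord X i t).
Proof.
move: t; apply: tens_ext => [t u //|t u|v x].
  rewrite -big_split; apply: eq_bigr => i _.
  by rewrite raddfD; exact: tensDr.
rewrite {1}[v]co_sum tens_suml; apply: eq_bigr => i _.
by rewrite tcoordE tensZl tensZr.
Qed.

Lemma tcoord_inj (X : gmodType k G) (t u : tensor V X) :
  (forall i, tcoord X i t = tcoord X i u) -> t = u.
Proof.
by move=> tu; rewrite [t]tcoord_sum [u]tcoord_sum; apply: eq_bigr => i _; rewrite tu.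
Qed.

Lemma tcoord_hom (X Y : gmodType k G) (f : ghom X Y) i t :
  tcoord Y i (tens_hom V f t) = f (tcoord X i t).
Proof.
move: t; apply: tens_ext => [t u|t u|v x]; rewrite ?raddfD //.
by rewrite tens_homE !tcoordE linearZZ.
Qed.

(** As V is free, its tensor product with [X] is r copies of [X] through the coordinates, and
    exactness is checked in each coordinate. *)
Lemma tens_short_exact (X Y Z : gmodType k G) (f : ghom X Y) (g : ghom Y Z) :
  short_exact f g -> short_exact (tens_hom V f) (tens_hom V g).
Proof.
move=> [f_inj mid g_surj]; split.
- move=> t u ftu; apply: tcoord_inj => i; apply: f_inj.
  by rewrite -!tcoord_hom ftu.
- move=> t; split=> [gt|[u ->]]; last first.
    apply: tcoord_inj => i; rewrite !tcoord_hom raddf0.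
    by apply/mid; exists (tcoord X i u).
  have cP i : exists x, tcoord Y i t = f x.
    by apply/mid; rewrite -tcoord_hom gt raddf0.
  pose x i := sval (cid (cP i)).
  have xP i : tcoord Y i t = f (x i) by rewrite /x; case: cid.
  exists (\sum_i tens (e i) (x i)); rewrite raddf_sum [LHS]tcoord_sum.
  by apply: eq_bigr => i _; rewrite xP; exact: esym (tens_homE f _ _).
move=> u; pose y i := sval (cid (g_surj (tcoord Z i u))).
have yP i : g (y i) = tcoord Z i u by rewrite /y; case: cid.
exists (\sum_i tens (e i) (y i)); rewrite raddf_sum [RHS]tcoord_sum.
by apply: eq_bigr => i _; rewrite -yP; exact: tens_homE.
Qed.

Hypothesis r_gt0 : (0 < r)%N.
Let i0 := Ordinal r_gt0.

(** The map [tens (e i0)] embeds [X] k-linearly into [Vtens V X], with retraction [tcoord X i0];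
    this takes one basis vector, hence positive rank. *)
Lemma Vsplit_mono_inj X Y (i : hom X Y) :
  Vsplit_mono V i -> injective (i : ghom X Y).
Proof.
move=> [t ti] x y ixy.
have tiE u : (t : ghom _ _) ((Vtens_map V i : ghom _ _) u) = u.
  exact: (congr1 (fun h : ghom (Vtens V X) (Vtens V X) => h u) ti).
have FE z : (Vtens_map V i : ghom _ _) (tens (e i0) z) = tens (e i0) ((i : ghom X Y) z).
  exact: tens_homE.
have : tens (e i0) x = tens (e i0) y by rewrite -[LHS]tiE -[RHS]tiE !FE ixy.
by move=> /(congr1 (tcoord X i0)); rewrite !tcoordE co_basis eqxx !scale1r.
Qed.

Lemma Vsplit_epi_section X Y (p : hom X Y) : Vsplit_epi V p ->
  exists2 s : Y -> X, linear s & cancel s (p : ghom X Y).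
Proof.
move=> [s ps]; exists (fun y => tcoord X i0 ((s : ghom _ _) (tens (e i0) y))).
  by move=> a y z; rewrite tensDr tensZr !linearP.
move=> y; rewrite -tcoord_hom.
have -> : tens_hom V p ((s : ghom _ _) (tens (e i0) y)) = tens (e i0) y.
  exact: (congr1 (fun h : ghom (Vtens V Y) (Vtens V Y) => h (tens (e i0) y)) ps).
by rewrite tcoordE co_basis eqxx scale1r.
Qed.

Lemma Vsplit_epi_kernel X Y (p : hom X Y) : Vsplit_epi V p ->
  exists K (i : hom K X), Vexact V i p /\ (kspan X -> kspan K).
Proof.
move=> p_split; have [K [i [i_inj mid]]] := gker_exists (p : ghom X Y).
have [s sL sK] := Vsplit_epi_section p_split.
exists K, i; split; last exact: kspan_kernel sL sK i_inj mid.
have se : short_exact i (p : ghom X Y) by split=> // y; exists (s y); exact: sK.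
split=> //; split; first exact: tens_short_exact.
have [u pu] := p_split; exists u => z.
exact: (congr1 (fun h : ghom (Vtens V Y) (Vtens V Y) => h z) pu).
Qed.

Lemma Vsplit_mono_cokernel X Y (i : hom X Y) : Vsplit_mono V i ->
  exists Q (p : hom Y Q), Vexact V i p /\ (kspan Y -> kspan Q).
Proof.
move=> i_split; have [Q [p [p_surj mid]]] := gcoker_exists (i : ghom X Y).
have i_inj := Vsplit_mono_inj i_split.
pose p' : @hom (Mod k G) Y Q := p.
exists Q, p; split; last exact: kspan_surj (ghom_linear p) p_surj.
have se : short_exact (i : ghom X Y) p by [].
split=> //; have seF := tens_short_exact se; split=> //.
have coker := short_exact_cokernel seF; have [t ti] := i_split.
have [|s [sp _]] := coker.2 _ (idm (Vtens V Y) - Vtens_map V i \oc t).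
  by rewrite compBl comp_idl -comp_assoc [t \oc _]ti comp_idr subrr.
have ps : Vtens_map V p' \oc s = idm (Vtens V Q).
  apply: (cokernel_inj coker); rewrite -comp_assoc [s \oc _]sp compBr comp_idr comp_idl.
  by rewrite comp_assoc coker.1 comp0l subr0.
exists s => z.
exact: (congr1 (fun h : ghom (Vtens V Q) (Vtens V Q) => h z) ps).
Qed.

Lemma trace_linear X Y (h : ghom (tensor V X) (tensor V Y)) :
  linear (fun x : X => \sum_i tcoord Y i (h (tens (e i) x))).
Proof.
move=> a x y; rewrite scaler_sumr -big_split; apply: eq_bigr => i _.
by rewrite tensDr tensZr !linearP.
Qed.

(** The contraction is a partial trace over V. It is equivariant because the canonical element, the
    sum of the basis vectors tensored with their dual vectors, is fixed by [G]. *)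
Lemma traceJ X Y (h : ghom (tensor V X) (tensor V Y)) (g : G) (x : X) :
  \sum_i tcoord Y i (h (tens (e i) (gact g x))) =
  gact g (\sum_i tcoord Y i (h (tens (e i) x))).
Proof.
have coordJ i (t : tensor V Y) :
    tcoord Y i (gact g t) = \sum_j co i (gact g (e j)) *: gact g (tcoord Y j t).
  rewrite [in LHS](tcoord_sum t) !raddf_sum; apply: eq_bigr => j _.
  by rewrite /= tensJ tcoordE.
transitivity (\sum_i \sum_j co i (gact g (e j)) *:
    gact g (tcoord Y j (h (tens (gact g^-1%g (e i)) x)))).
  apply: eq_bigr => i _; rewrite -coordJ -ghomJ tensJ -gactM mulgV gact1 //.
(* After the exchange the inner sum over [i] is [e j], written as [g^-1] applied to the expansion of
   [gact g (e j)] in the basis. *)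
rewrite exchange_big raddf_sum; apply: eq_bigr => j _ /=.
rewrite -[e j in RHS](gact1 (G := G)) -(mulVg g) gactM [in RHS](co_sum (gact g (e j))).
rewrite raddf_sum tens_suml !raddf_sum; apply: eq_bigr => i _ /=.
by rewrite linearZZ tensZl !linearZZ.
Qed.

Definition ptrace X Y (h : hom (Vtens V X) (Vtens V Y)) : hom X Y :=
  GHom (trace_linear h) (traceJ h).

Lemma ptrace_compr X Y Z (h : hom (Vtens V Y) (Vtens V Z)) (f : hom X Y) :
  ptrace h \oc f = ptrace (h \oc Vtens_map V f).
Proof.
apply: ghom_ext => x; apply: eq_bigr => i _.
by congr (tcoord Z i ((h : ghom _ _) _)); symmetry; exact: tens_homE.
Qed.

Lemma ptrace_compl X Y Z (f : hom Y Z) (h : hom (Vtens V X) (Vtens V Y)) :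
  f \oc ptrace h = ptrace (Vtens_map V f \oc h).
Proof.
apply: ghom_ext => x; rewrite [LHS](raddf_sum (f : ghom Y Z)).
by apply: eq_bigr => i _; symmetry; exact: tcoord_hom.
Qed.

(** The universal property consumes one tensor factor at a time, so the inner tensor is first
    expanded in coordinates; equivariance of the resulting bilinear map is then checked on pure
    tensors. *)
Lemma tswap_exists X : exists s : hom (Vtens V (Vtens V X)) (Vtens V (Vtens V X)),
  forall v w (x : X), (s : ghom _ _) (tens v (tens w x)) = tens w (tens v x).
Proof.
pose b (v : V) (t : tensor V X) : tensor V (tensor V X) :=
  \sum_i tens (e i) (tens v (tcoord X i t)).
have bE v w (x : X) : b v (tens w x) = tens w (tens v x).
  rewrite [in RHS](co_sum w) tens_suml; apply: eq_bigr => i _.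
  by rewrite tcoordE tensZr tensZr tensZl.
have bL v : linear (b v).
  move=> a t u; rewrite scaler_sumr -big_split; apply: eq_bigr => i _.
  by rewrite linearP tensDr tensZr tensDr tensZr.
have [x a v w|g v|s sE] := @tens_ghom_lift _ _ V (tensor V X) (tensor V (tensor V X)) b bL.
- rewrite scaler_sumr -big_split; apply: eq_bigr => i _.
  by rewrite tensDl tensZl tensDr tensZr.
- have bD v' t u : b v' (t + u) = b v' t + b v' u.
    by have := bL v' 1 t u; rewrite !scale1r.
  apply: tens_ext => [t u|t u|w x]; [by rewrite raddfD bD|by rewrite bD raddfD|].
  by rewrite tensJ !bE !tensJ.
by exists s => v w x; rewrite sE bE.
Qed.

Definition tswap X := sval (cid (tswap_exists X)).

Lemma tswapE X v w (x : X) :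
  (tswap X : ghom _ _) (tens v (tens w x)) = tens w (tens v x).
Proof. exact: (svalP (cid (tswap_exists X))). Qed.

Lemma ptrace_swap X : ptrace (tswap X) = idm (Vtens V X).
Proof.
apply: tens_ghom_ext => v x; rewrite [RHS]/= [in RHS](co_sum v) tens_suml.
by apply: eq_bigr => i _; rewrite tswapE tcoordE tensZl.
Qed.

(* Given a section s of V (x) p, the contraction of s o (V (x) f) o swap is a
   lift of f, since the contraction of the swap is the identity. *)
Lemma Vprojective_lift (W X Y : Mod k G) (p : hom X Y) (f : hom W Y) :
  Vprojective V W -> Vsplit_epi V p -> exists g : hom W X, p \oc g = f.
Proof.
move=> /Vprojective_retract[U [j [q qj]]] [s ps].
exists (ptrace (s \oc Vtens_map V (f \oc q) \oc tswap U) \oc j).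
rewrite comp_assoc ptrace_compl !comp_assoc ps comp_idl -ptrace_compl ptrace_swap.
by rewrite comp_idr -comp_assoc qj comp_idr.
Qed.

(** Mirror image of the lift: the swap now stands after the retraction [t], and the contraction is
    followed by the projection [q]. *)
Lemma Vprojective_extend (W X Y : Mod k G) (i : hom X Y) (f : hom X W) :
  Vprojective V W -> Vsplit_mono V i -> exists g : hom Y W, g \oc i = f.
Proof.
move=> /Vprojective_retract[U [j [q qj]]] [t ti].
exists (q \oc ptrace (tswap U \oc (Vtens_map V (j \oc f) \oc t))).
rewrite -comp_assoc ptrace_compr -!comp_assoc ti comp_idr -ptrace_compr ptrace_swap.
by rewrite comp_idl comp_assoc qj comp_idl.
Qed.

Lemma kspan_tensor (X : gmodType k G) : kspan X -> kspan (tensor V X).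
Proof.
move=> [I [x xP]]; exists ('I_r * I)%type, (fun il => tens (e il.1) (x il.2)) => t.
pose a i := sval (cid (xP (tcoord X i t))).
have aP i : tcoord X i t = \sum_l a i l *: x l by rewrite /a; case: cid.
exists (fun il => a il.1 il.2); rewrite -(pair_bigA _ (fun i l => a i l *: tens (e i) (x l))).
rewrite [LHS]tcoord_sum; apply: eq_bigr => i _; rewrite aP tens_sumr.
by apply: eq_bigr => l _; rewrite tensZr.
Qed.

(* H is Hom_k(V, X), a linear map being given by its values on the basis e. *)
Lemma evaluation_coevaluation X : exists (H : Mod k G)
    (ev : hom (Vtens V H) X) (coev : hom X (Vtens V H)),
  [/\ Vsplit_epi V ev, Vsplit_mono V coev, kspan X -> kspan H
    & is_zero X -> is_zero H].
Proof.
have coD i v w : co i (v + w) = co i v + co i w.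
  by rewrite -[v in LHS]scale1r co_lin mul1r.
have co0 i : co i 0 = 0 by apply: (addrI (co i 0)); rewrite -coD !addr0.
have coZ i a v : co i (a *: v) = a * co i v by rewrite -[a *: v]addr0 co_lin co0 addr0.
have co_sumE i (I : finType) (F : I -> V) : co i (\sum_j F j) = \sum_j co i (F j).
  exact: (big_morph (co i) (coD i) (co0 i)).
have coM i (g h : G) v :
    co i (gact (g * h)%g v) = \sum_l co l (gact h v) * co i (gact g (e l)).
  rewrite gactM [in LHS](co_sum (gact h v)) raddf_sum co_sumE.
  have gZ a x : gact g (a *: x) = a *: gact g x by exact: linearZZ.
  by apply: eq_bigr => l _; rewrite /= gZ coZ.
pose T := {ffun 'I_r -> X : gmodType k G}.
(* These are the values on the basis of the conjugate map sending v to g phi(g^-1 v). *)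
pose ha (g : G) (phi : T) : T :=
  [ffun i => \sum_j co j (gact g^-1%g (e i)) *: gact g (phi j)].
have haL g : linear (ha g).
  move=> a phi psi; apply/ffunP => i; rewrite !ffunE scaler_sumr -big_split.
  apply: eq_bigr => j _; rewrite !ffunE linearP scalerDr !scalerA.
  by rewrite (mulrC _ a).
have ha1 phi : ha 1%g phi = phi.
  apply/ffunP => i; rewrite ffunE invg1 (bigD1 i) //= !gact1 co_basis eqxx scale1r.
  by rewrite big1 ?addr0 // => j /negPf ji; rewrite gact1 co_basis ji scale0r.
have haM g h phi : ha (g * h)%g phi = ha g (ha h phi).
  apply/ffunP => i; rewrite !ffunE invMg.
  under eq_bigr do rewrite coM scaler_suml.
  rewrite exchange_big; apply: eq_bigr => l _ /=.
  rewrite ffunE raddf_sum scaler_sumr; apply: eq_bigr => j _.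
  by rewrite /= linearZZ scalerA gactM.
pose H : gmodType k G := HB.pack T (Lmodule_hasGAction.Build k G T haL ha1 haM).
(* As a linear map, [dl i x] is the i-th dual basis vector times [x]. *)
pose dl i (x : X : gmodType k G) : H := [ffun l => if l == i then x else 0].
have dlL i : linear (dl i).
  move=> a x y; apply/ffunP => l; rewrite !ffunE.
  by case: ifP => // _; rewrite scaler0 addr0.
have dl_sum (phi : H) : phi = \sum_i dl i ((phi : T) i).
  apply/ffunP => l; rewrite sum_ffunE (bigD1 l) //= !ffunE eqxx big1 ?addr0 // => i il.
  by rewrite ffunE eq_sym (negPf il).
have [|x a v w|g v phi|ev evE] := @tens_ghom_lift _ _ V H X
    (fun v phi => \sum_i co i v *: (phi : T) i).
- move=> v a phi psi; rewrite scaler_sumr -big_split; apply: eq_bigr => i _.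
  by rewrite !ffunE scalerDr !scalerA mulrC.
- rewrite scaler_sumr -big_split; apply: eq_bigr => i _.
  by rewrite co_lin scalerDl scalerA.
- under eq_bigr do rewrite ffunE scaler_sumr.
  rewrite exchange_big raddf_sum; apply: eq_bigr => j _ /=.
  under eq_bigr do rewrite scalerA.
  by rewrite -scaler_suml -coM mulVg gact1 linearZZ.
pose cv (x : X : gmodType k G) := \sum_i tens (e i) (dl i x).
have cvL : linear cv.
  move=> a x y; rewrite scaler_sumr -big_split; apply: eq_bigr => i _.
  by rewrite dlL tensDr tensZr.
have cvJ (g : G) x : cv (gact g x) = gact g (cv x).
  have gdl i : gact g (dl i x) = \sum_l co i (gact g^-1%g (e l)) *: dl l (gact g x).
    apply/ffunP => m; transitivity (ha g (dl i x) m) => //.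
    rewrite ffunE sum_ffunE [LHS](bigD1 i) //= [RHS](bigD1 m) //= !ffunE !eqxx.
    rewrite !big1 // => [j jm|j ji]; rewrite !ffunE; last by rewrite (negPf ji) raddf0 scaler0.
    by rewrite eq_sym (negPf jm) scaler0.
  rewrite raddf_sum; under [RHS]eq_bigr => i _ do rewrite /= tensJ gdl tens_sumr.
  rewrite exchange_big; apply: eq_bigr => l _ /=.
  rewrite -[e l in LHS](gact1 (G := G)) -(mulgV g) gactM.
  rewrite [X in tens (gact g X) _](co_sum (gact g^-1%g (e l))) raddf_sum tens_suml.
  by apply: eq_bigr => i _; rewrite /= linearZZ tensZl tensZr.
pose coev := GHom cvL cvJ.
(* On v ⊗ x the composite gives the sum of the [e i] ⊗ ev(v ⊗ [dl i x]), that is of the [e i] ⊗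
   [co i v *: x], which is v ⊗ x. Bracketed in its two ways, the composite splits the evaluation and
   the coevaluation. *)
have evc : Vtens_map V (ev : @hom (Mod k G) (tensor V H) X) \oc tswap H \oc
    Vtens_map V (coev : @hom (Mod k G) X (tensor V H)) = idm (Vtens V X).
  apply: tens_ghom_ext => v x.
  transitivity (tens_hom V ev ((tswap H : ghom _ _) (tens v (cv x)))).
    by congr (tens_hom V ev ((tswap H : ghom _ _) _)); exact: tens_homE.
  rewrite tens_sumr raddf_sum raddf_sum /= [in RHS](co_sum v) tens_suml.
  apply: eq_bigr => i _; rewrite tswapE [LHS]tens_homE evE (bigD1 i) //= ffunE eqxx.
  rewrite big1 ?addr0 ?tensZl ?tensZr // => j ji.
  by rewrite ffunE (negPf ji) scaler0.
exists H, ev, coev; split.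
- by exists (tswap H \oc Vtens_map V (coev : @hom (Mod k G) X (tensor V H))); rewrite comp_assoc.
- by exists (Vtens_map V (ev : @hom (Mod k G) (tensor V H) X) \oc tswap H).
- move=> [I [x xP]]; exists ('I_r * I)%type, (fun il => dl il.1 (x il.2)) => phi.
  pose a i := sval (cid (xP ((phi : T) i))).
  have aP i : (phi : T) i = \sum_l a i l *: x l by rewrite /a; case: cid.
  exists (fun il => a il.1 il.2).
  rewrite -(pair_bigA _ (fun i l => a i l *: dl i (x l))) [LHS]dl_sum.
  apply: eq_bigr => i _; rewrite aP.
  pose dli : {linear (X : gmodType k G) -> H} :=
    HB.pack (dl i) (GRing.isLinear.Build k _ _ _ (dl i) (dlL i)).
  by rewrite -[dl i]/(dli : _ -> _) raddf_sum; apply: eq_bigr => l _; exact: (linearZZ dli).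
move=> X0; apply: ghom_ext => phi; apply/ffunP => i; rewrite [RHS]ffunE.
exact: (congr1 (fun h : ghom X X => h ((phi : T) i)) X0).
Qed.

End FreeTensor.

(** * The Frobenius structure *)

Lemma kernel_zero (C : preaddcat) (X Y Z : C) (i : hom X Y) (p : hom Y Z) :
  is_kernel i p -> is_zero Y -> is_zero X.
Proof.
move=> ker Y0; apply: (kernel_inj ker).
by rewrite (zero_cod i Y0) !comp0l.
Qed.

Lemma cokernel_zero (C : preaddcat) (X Y Z : C) (i : hom X Y) (p : hom Y Z) :
  is_cokernel i p -> is_zero Y -> is_zero Z.
Proof.
move=> coker Y0; apply: (cokernel_inj coker).
by rewrite (zero_dom p Y0) !comp0r.
Qed.

Lemma biproduct_term (C : preaddcat) (X Y S : complex C) (iX : chain_map X S)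
    (iY : chain_map Y S) (pX : chain_map S X) (pY : chain_map S Y) :
  @biproduct (complexes C) X Y S iX iY pX pY ->
  forall n, biproduct (iX n) (iY n) (pX n) (pY n).
Proof.
case=> XX YY YX XY sum1 n; split.
- exact: (congr1 (fun f : chain_map X X => f n) XX).
- exact: (congr1 (fun f : chain_map Y Y => f n) YY).
- exact: (congr1 (fun f : chain_map X Y => f n) YX).
- exact: (congr1 (fun f : chain_map Y X => f n) XY).
- exact: (congr1 (fun f : chain_map S S => f n) sum1).
Qed.

Lemma isomorphism_term (C : preaddcat) (X Y : complex C) (f : chain_map X Y) :
  @isomorphism (complexes C) X Y f -> forall n, isomorphism (f n).
Proof.
move=> [g [gf fg]] n; exists ((g : chain_map Y X) n); split.
- exact: (congr1 (fun f : chain_map X X => f n) gf).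
- exact: (congr1 (fun f : chain_map Y Y => f n) fg).
Qed.

Lemma zero_gmod_is_zero (k : pzRingType) (G : finGroupType) :
  @is_zero (Mod k G) (zero_gmod k G).
Proof. by apply: ghom_ext => x; apply/rowP => -[]. Qed.

(** One criterion for all eight categories: degree [n] of each complex constructed below depends on
    degrees [n - 1], [n] and [n + 1] only, so a bound moves by at most one. *)
Lemma in_Cpx_near (k : comPzRingType) (G : finGroupType) fg b (X Y : Cpx_all k G) :
  in_Cpx fg b X ->
  ((forall m, kspan (X m)) -> forall n, kspan (Y n)) ->
  (forall n, is_zero (X (n - 1)) -> is_zero (X n) -> is_zero (X (n + 1)) ->
     is_zero (Y n)) ->
  in_Cpx fg b Y.
Proof.
move=> [fgX bX] kXY zXY; split.
  by move=> fgT n; apply/kspan_fin_gen/kXY => m; apply/kspan_fin_gen/fgX.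
have above : bounded_above X -> bounded_above Y.
  by move=> [N XN]; exists (N + 1) => n Nn; apply: zXY; apply: XN; lia.
have below : bounded_below X -> bounded_below Y.
  by move=> [N XN]; exists (N - 1) => n Nn; apply: zXY; apply: XN; lia.
by case: b bX => //= -[/above ? /below].
Qed.

Section FrobeniusStructure.
Variables (k : comPzRingType) (G : finGroupType) (V : gmodType k G) (r : nat).
Variables (e : 'I_r -> V) (co : 'I_r -> V -> k).
Hypothesis co_lin : forall i a v w, co i (a *: v + w) = a * co i v + co i w.
Hypothesis co_sum : forall v, v = \sum_i co i v *: e i.
Hypothesis co_basis : forall i j, co i (e j) = (i == j)%:R.
Hypothesis r_gt0 : (0 < r)%N.

Section FixedCategory.
Variables (fg : bool) (b : boundedness).
Implicit Types X Y Z : Cpx k G fg b.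
Local Notation E := (Vts V fg b).
Local Notation Eseq i p := (@Vts k G V fg b _ _ _ i p).

Lemma VtsP X Y Z (i : chain_map (sval X) (sval Y)) (p : chain_map (sval Y) (sval Z)) :
  @Vts k G V fg b X Y Z i p <-> forall n, Vexact V (i n) (p n).
Proof.
split=> [[se sp] n|ex]; first by split; [exact: se|exact: sp].
by split=> n; case: (ex n).
Qed.

Lemma Vts_kernel X Y Z (i : hom X Y) (p : hom Y Z) : Eseq i p -> is_kernel i p.
Proof.
move=> /VtsP ex; have [pi0 univ] := complex_kernel (fun n => Vexact_kernel (ex n)).
by split=> // T f; exact: univ.
Qed.

Lemma Vts_cokernel X Y Z (i : hom X Y) (p : hom Y Z) : Eseq i p -> is_cokernel i p.
Proof.
move=> /VtsP ex; have [pi0 univ] := complex_cokernel (fun n => Vexact_cokernel (ex n)).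
by split=> // T f; exact: univ.
Qed.

(** Conversely, V-exact cokernels are chosen in each degree and assembled into a complex; choosing
    them with finite spanning families keeps this complex in the category. *)
Lemma Vts_inflationP X Y (i : chain_map (sval X) (sval Y)) :
  @inflation _ E X Y i <-> forall n, Vsplit_mono V (i n).
Proof.
split=> [[Z [p /VtsP ex]] n|i_split]; first exact: Vexact_mono (ex n).
have [|n|Z [p pP]] := @cokernel_complex _ _ _ i
    (fun n Q p => Vexact V (i n) p /\ (kspan (sval Y n) -> kspan Q)).
- by move=> n Q p [/Vexact_cokernel].
- exact: Vsplit_mono_cokernel (i_split n).
have ZC : in_Cpx fg b Z.
  apply: in_Cpx_near (svalP Y) _ _ => [kY n|n _ Y0 _]; first exact: (pP n).2.
  exact: cokernel_zero (Vexact_cokernel (pP n).1) Y0.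
exists (exist _ Z ZC), p; apply/VtsP => n; exact: (pP n).1.
Qed.

Lemma Vts_deflationP Y Z (p : chain_map (sval Y) (sval Z)) :
  @deflation _ E Y Z p <-> forall n, Vsplit_epi V (p n).
Proof.
split=> [[X [i /VtsP ex]] n|p_split]; first exact: Vexact_epi (ex n).
have [|n|X [i iP]] := @kernel_complex _ _ _ p
    (fun n K i => Vexact V i (p n) /\ (kspan (sval Y n) -> kspan K)).
- by move=> n K i [/Vexact_kernel].
- exact: Vsplit_epi_kernel (p_split n).
have XC : in_Cpx fg b X.
  apply: in_Cpx_near (svalP Y) _ _ => [kY n|n _ Y0 _]; first exact: (iP n).2.
  exact: kernel_zero (Vexact_kernel (iP n).1) Y0.
exists (exist _ X XC), i; apply/VtsP => n; exact: (iP n).1.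
Qed.

Lemma Vts_exact : exact_category E.
Proof.
split.
- by move=> X Y Z i p ex; split; [exact: Vts_kernel ex|exact: Vts_cokernel ex].
- move=> X Y Z X' Y' Z' i p i' p' a b' c ia ib ic bi cp /VtsP ex; apply/VtsP => n.
  have term_iso (U U' : Cpx k G fg b) (f : hom U U') :
      isomorphism f -> isomorphism ((f : chain_map _ _) n).
    by move=> [f' f'P]; apply: (@isomorphism_term _ (sval U) (sval U') f); exists f'.
  apply: Vexact_iso (term_iso _ _ _ ia) (term_iso _ _ _ ib) (term_iso _ _ _ ic) _ _ (ex n).
    exact: (congr1 (fun h : chain_map (sval X) (sval Y') => h n) bi).
  exact: (congr1 (fun h : chain_map (sval Y) (sval Z') => h n) cp).
- by move=> X; apply/Vts_inflationP => n; exact: Vsplit_mono_id.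
- by move=> X; apply/Vts_deflationP => n; exact: Vsplit_epi_id.
- move=> X Y Z i j /Vts_inflationP iP /Vts_inflationP jP; apply/Vts_inflationP => n.
  exact: Vsplit_mono_comp.
- move=> X Y Z p q /Vts_deflationP pP /Vts_deflationP qP; apply/Vts_deflationP => n.
  exact: Vsplit_epi_comp.
- move=> X Y X' i f /Vts_inflationP iP.
  have [S [iY [iX' [pY [pX' bip]]]]] := (addcatP (Cpx k G fg b)).2 Y X'.
  have bipn := biproduct_term (bip : @biproduct (Cpx_all k G) _ _ _ iY iX' pY pX').
  (* The antidiagonal is an inflation because composing it with [pY] gives back [i]; its cokernel is
     the pushout. *)
  have /Vts_inflationP[Q [q jq]] n :
      Vsplit_mono V ((iY \oc i - iX' \oc f : chain_map (sval X) (sval S)) n).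
    apply: (@Vsplit_mono_cancel _ _ _ _ _ _ ((pY : chain_map _ _) n)).
    have [YY _ _ YX _] := bip.
    suff -> : (pY : chain_map _ _) n \oc
        (iY \oc i - iX' \oc f : chain_map (sval X) (sval S)) n = (i : chain_map _ _) n.
      exact: iP.
    apply: (congr1 (fun h : chain_map (sval X) (sval Y) => h n)
      (_ : pY \oc (iY \oc i - iX' \oc f) = i)).
    by rewrite compBr !comp_assoc YY YX comp_idl comp0l subr0.
  exists Q, (q \oc iX'), (q \oc iY).
  split; first exact: cokernel_pushout bip (Vts_cokernel jq).
  apply/Vts_inflationP => n; move/VtsP: jq => jq.
  exact: Vsplit_mono_pushout (bipn n) (iP n) (jq n).
move=> Y Z Z' p f /Vts_deflationP pP.
have [S [iY [iZ' [pY [pZ' bip]]]]] := (addcatP (Cpx k G fg b)).2 Y Z'.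
have bipn := biproduct_term (bip : @biproduct (Cpx_all k G) _ _ _ iY iZ' pY pZ').
have /Vts_deflationP[K [j jq]] n :
    Vsplit_epi V ((p \oc pY - f \oc pZ' : chain_map (sval S) (sval Z)) n).
  apply: (@Vsplit_epi_cancel _ _ _ _ _ _ _ ((iY : chain_map _ _) n)).
  have [YY _ ZY _ _] := bip.
  suff -> : (p \oc pY - f \oc pZ' : chain_map (sval S) (sval Z)) n \oc
      (iY : chain_map _ _) n = (p : chain_map _ _) n.
    exact: pP.
  apply: (congr1 (fun h : chain_map (sval Y) (sval Z) => h n)
    (_ : (p \oc pY - f \oc pZ') \oc iY = p)).
  by rewrite compBl -!comp_assoc YY ZY comp_idr comp0r subr0.
exists K, (pZ' \oc j), (pY \oc j).
split; first exact: kernel_pullback bip (Vts_kernel jq).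
apply/Vts_deflationP => n; move/VtsP: jq => jq.
exact: Vsplit_epi_pullback (bipn n) (pP n) (jq n).
Qed.

Lemma contractible_projective X : contractible (sval X) ->
  (forall n, Vprojective V (sval X n)) -> projective E X.
Proof.
move=> cX VX A B D i p ex; have [ker1 ker2] := Vts_kernel ex; split.
- by move=> f g; exact: kernel_inj (conj ker1 ker2).
- move=> f; split=> [/ker2[g [<- _]]|[x ->]]; first by exists g.
  by rewrite comp_assoc ker1 comp0l.
move=> f; move/VtsP: ex => ex.
have lift n := Vprojective_lift co_lin co_sum ((f : chain_map _ _) n)
  (VX n) (Vexact_epi (ex n)).
pose g n := sval (cid (lift n)).
exact: contractible_lift cX (fun n => svalP (cid (lift n))).
Qed.

Lemma contractible_injective X : contractible (sval X) ->
  (forall n, Vprojective V (sval X n)) -> injective_object E X.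
Proof.
move=> cX VX A B D i p ex; have [coker1 coker2] := Vts_cokernel ex; split.
- by move=> f g; exact: cokernel_inj (conj coker1 coker2).
- move=> f; split=> [/coker2[g [<- _]]|[x ->]]; first by exists g.
  by rewrite -comp_assoc coker1 comp0r.
move=> f; move/VtsP: ex => ex.
have ext n := Vprojective_extend co_lin co_sum ((f : chain_map _ _) n)
  (VX n) (Vexact_mono (ex n)).
exact: contractible_extend cX (fun n => svalP (cid (ext n))).
Qed.

Lemma Vts_cover X : exists (P : Cpx k G fg b) (p : hom P X),
  [/\ contractible (sval P), forall n, Vprojective V (sval P n) & deflation E p].
Proof.
pose cH n := cid (evaluation_coevaluation co_lin co_sum co_basis (sval X n)).
pose H n := sval (cH n); pose ce n := cid (svalP (cH n)).
pose ev n : hom (Vtens V (H n)) (sval X n) := sval (ce n).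
have evP n : [/\ Vsplit_epi V (ev n), kspan (sval X n) -> kspan (H n)
    & is_zero (sval X n) -> is_zero (H n)] by have [c []] := svalP (ce n).
have [P [cP Pn toP _]] := cone_exists (@Mod_additive k G) (fun n => Vtens V (H n)).
have [f fP] := toP (sval X) ev.
have PC : in_Cpx fg b P.
  apply: in_Cpx_near (svalP X) _ _ => [kX n|n X1 X0 _].
    apply/kspan_fin_gen/(fin_gen_biproduct (Pn n)); apply/kspan_fin_gen.
      by apply: (kspan_tensor co_lin co_sum); have [_ kH _] := evP n; exact: kH.
    by apply: (kspan_tensor co_lin co_sum); have [_ kH _] := evP (n - 1); exact: kH.
  apply: biproduct_zero (Pn n) _ _; apply: Vtens_zero.
    by have [_ _] := evP n; apply.
  by have [_ _] := evP (n - 1); apply.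
exists (exist _ P PC), f; split=> //.
  move=> n; have VT m : Vprojective V (Vtens V (H m)).
    by apply/Vprojective_retract; exists (H m), (idm _), (idm _); rewrite comp_idl.
  exact: Vprojective_biproduct (Pn n) (VT n) (VT (n - 1)).
apply/Vts_deflationP => n; have [a fa] := fP n.
by apply: (@Vsplit_epi_cancel _ _ _ _ _ _ _ a); rewrite fa; have [] := evP n.
Qed.

Lemma Vts_hull X : exists (J : Cpx k G fg b) (i : hom X J),
  [/\ contractible (sval J), forall n, Vprojective V (sval J n) & inflation E i].
Proof.
pose cH n := cid (evaluation_coevaluation co_lin co_sum co_basis (sval X n)).
pose H n := sval (cH n).
have [coev coevP] : exists coev : forall n, hom (sval X n) (Vtens V (H n)), forall n,
    [/\ Vsplit_mono V (coev n), kspan (sval X n) -> kspan (H n)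
    & is_zero (sval X n) -> is_zero (H n)].
  have exc n : exists c : hom (sval X n) (Vtens V (H n)),
      [/\ Vsplit_mono V c, kspan (sval X n) -> kspan (H n)
      & is_zero (sval X n) -> is_zero (H n)].
    by have [ev [c [_ ? ? ?]]] := svalP (cH n); exists c.
  by exists (fun n => sval (cid (exc n))) => n; exact: svalP (cid (exc n)).
(* Maps into the cone are given from degree [n + 1] into [A n], hence the shift of [H]. *)
have [P [cP Pn _ fromP]] := cone_exists (@Mod_additive k G) (fun n => Vtens V (H (n + 1))).
have [f fP] := fromP (sval X) (fun n => coev (n + 1)).
have PC : in_Cpx fg b P.
  apply: in_Cpx_near (svalP X) _ _ => [kX n|n _ X0 X1].
    apply/kspan_fin_gen/(fin_gen_biproduct (Pn n)); apply/kspan_fin_gen.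
      by apply: (kspan_tensor co_lin co_sum); have [_ kH _] := coevP (n + 1); exact: kH.
    by apply: (kspan_tensor co_lin co_sum); have [_ kH _] := coevP (n - 1 + 1); exact: kH.
  apply: biproduct_zero (Pn n) _ _; apply: Vtens_zero.
    by have [_ _] := coevP (n + 1); apply.
  by have [_ _] := coevP (n - 1 + 1); apply; rewrite subrK.
exists (exist _ P PC), f; split=> //.
  move=> n; have VT m : Vprojective V (Vtens V (H m)).
    by apply/Vprojective_retract; exists (H m), (idm _), (idm _); rewrite comp_idl.
  exact: Vprojective_biproduct (Pn n) (VT _) (VT _).
apply/Vts_inflationP; apply: int_succ => n; have [a af] := fP n.
by apply: (@Vsplit_mono_cancel _ _ _ _ _ _ a); rewrite af; have [] := coevP (n + 1).
Qed.

Lemma retract_contractible_Vprojective X P :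
  @retract (Cpx k G fg b) X P -> contractible (sval P) ->
  (forall n, Vprojective V (sval P n)) -> split_contractible_Vproj V (sval X).
Proof.
move=> [i [p pi]] cP VP.
have cX : contractible (sval X).
  by apply: (@retract_contractible _ _ (sval P)) cP; exists i, p.
split=> //; first exact: contractible_split.
move=> n; apply: Vprojective_summand (VP n).
exists ((i : chain_map _ _) n), ((p : chain_map _ _) n).
exact: (congr1 (fun h : chain_map (sval X) (sval X) => h n) pi).
Qed.

Lemma Vts_projectiveP X : projective E X <-> split_contractible_Vproj V (sval X).
Proof.
split=> [projX|[_ cX VX]]; last exact: contractible_projective.
have [P [p [cP VP [K [i ex]]]]] := Vts_cover X.
have [_ _ surj] := projX _ _ _ _ _ ex.
have [s ps] := surj (idm X).
by apply: retract_contractible_Vprojective cP VP; exists s, p.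
Qed.

Lemma Vts_injectiveP X : injective_object E X <-> split_contractible_Vproj V (sval X).
Proof.
split=> [injX|[_ cX VX]]; last exact: contractible_injective.
have [J [i [cJ VJ [Q [p ex]]]]] := Vts_hull X.
have [_ _ surj] := injX _ _ _ _ _ ex.
have [s si] := surj (idm X).
by apply: retract_contractible_Vprojective cJ VJ; exists i, s.
Qed.

Lemma Vts_frobenius : frobenius E.
Proof.
split.
- exact: Vts_exact.
- move=> X; have [P [p [cP VP dp]]] := Vts_cover X.
  by exists P, p; split=> //; exact: contractible_projective.
- move=> X; have [J [i [cJ VJ di]]] := Vts_hull X.
  by exists J, i; split=> //; exact: contractible_injective.
by move=> X; rewrite Vts_projectiveP Vts_injectiveP.
Qed.

Lemma disk_split_contractible (W : gmodType k G) n : Vprojective V W ->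
  split_contractible_Vproj V (Cpx_disk W n).
Proof.
move=> VW; have O0 := zero_gmod_is_zero k G.
have cW : contractible (Cpx_disk W n) by exact: disk_contractible.
split=> //; first exact: contractible_split.
move=> m; rewrite /= /disk_term; case: ifP => // _.
exact: Vprojective_zero.
Qed.

End FixedCategory.

(** For the converse one works in the category of all complexes, where the coproduct has its
    universal property: there each disk is projective, lifts on the disks glue to a lift on [X], and
    projectivity is read back as contractibility with V-projective terms. *)
Lemma sum_of_VdisksP (X : Cpx_all k G) :
  split_contractible_Vproj V X <-> sum_of_Vdisks V X.
Proof.
have O0 := zero_gmod_is_zero k G.
split=> [[_ cX VX]|[I [W [n [inj [VW cop]]]]]].
  have [W [inj [WX cop]]] := contractible_sum_of_disks O0 (@Mod_splits_idempotents k G) cX.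
  exists int, W, id, inj; split=> // n.
  exact: Vprojective_summand (WX n) (VX n).
have allC (Y : Cpx_all k G) : in_Cpx false Unbounded Y by [].
pose obj Y : Cpx k G false Unbounded := exist _ Y (allC Y).
apply/(Vts_projectiveP (obj X)) => A B D i p ex; have [ker1 ker2] := Vts_kernel ex; split.
- by move=> f g; exact: kernel_inj (conj ker1 ker2).
- move=> f; split=> [/ker2[g [<- _]]|[x ->]]; first by exists g.
  by rewrite comp_assoc ker1 comp0l.
move=> f; have lift j : exists g : hom (obj (Cpx_disk (W j) (n j))) B,
    p \oc g = f \oc (inj j : hom (obj (Cpx_disk (W j) (n j))) (obj X)).
  have [_ _ surj] := iffRL (Vts_projectiveP (obj (Cpx_disk (W j) (n j))))
    (disk_split_contractible (n j) (VW j)) _ _ _ _ _ ex.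
  exact: surj.
have [h [hE _]] := cop _ (fun j => sval (cid (lift j))).
exists h; have [h' [_ h'U]] := cop _ (fun j => (f : hom (X : Cpx_all k G) _) \oc inj j).
rewrite -(h'U f) //; apply/esym/h'U => j.
apply: etrans (esym (@comp_assoc (Cpx_all k G) _ _ _ _ p h (inj j))) _; rewrite hE.
exact: svalP (cid (lift j)).
Qed.

End FrobeniusStructure.

(** * Objects with local endomorphism rings *)

Section LocalObjects.
Variable C : preaddcat.
Implicit Types X Y Z : C.

(** Locality of the endomorphism ring, in a form free of ideals. *)
Definition local_object X :=
  ~ is_zero X /\ forall f : hom X X, isomorphism f \/ isomorphism (idm X - f).

Lemma comp_sumr X Y Z (g : hom Y Z) (I : Type) (s : seq I) (P : pred I)
    (f : I -> hom X Y) :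
  g \oc \sum_(i <- s | P i) f i = \sum_(i <- s | P i) g \oc f i.
Proof.
elim: s => [|i s IHs]; first by rewrite !big_nil comp0r.
by rewrite !big_cons; case: ifP => // _; rewrite comp_addr IHs.
Qed.

Lemma comp_suml X Y Z (f : hom X Y) (I : Type) (s : seq I) (P : pred I)
    (g : I -> hom Y Z) :
  (\sum_(i <- s | P i) g i) \oc f = \sum_(i <- s | P i) g i \oc f.
Proof.
elim: s => [|i s IHs]; first by rewrite !big_nil comp0l.
by rewrite !big_cons; case: ifP => // _; rewrite comp_addl IHs.
Qed.

Lemma isomorphism_comp X Y Z (g : hom Y Z) (f : hom X Y) :
  isomorphism f -> isomorphism g -> isomorphism (g \oc f).
Proof.
move=> [f' [f'f ff']] [g' [g'g gg']]; exists (f' \oc g'); split.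
  by rewrite -comp_assoc (comp_assoc g') g'g comp_idl.
by rewrite -comp_assoc (comp_assoc f) ff' comp_idl.
Qed.

Lemma isomorphism_comp_cancel X Y Z (g : hom Y Z) (f : hom X Y) :
  isomorphism g -> isomorphism (g \oc f) -> isomorphism f.
Proof.
move=> [g' [g'g gg']] gf; rewrite -[f]comp_idl -g'g -comp_assoc.
by apply: isomorphism_comp => //; exists g.
Qed.

Lemma idempotent_isomorphism X (e : hom X X) :
  e \oc e = e -> isomorphism e -> e = idm X.
Proof. by move=> ee [g [ge _]]; rewrite -[LHS]comp_idl -ge -comp_assoc ee. Qed.

(** Correcting [b] by an inverse makes [X] a retract of [Y]. The resulting idempotent of [Y] is the
    identity or zero, and zero would force [X] to vanish. *)
Lemma local_retract X Y (a : hom X Y) (b : hom Y X) : local_object Y ->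
  ~ is_zero X -> isomorphism (b \oc a) -> isomorphism a.
Proof.
move=> [_ locY] X0 [c [cba _]].
have [b' b'a] : exists b', b' \oc a = idm X by exists (c \oc b); rewrite -comp_assoc.
have ee : (a \oc b') \oc (a \oc b') = a \oc b'.
  by rewrite -comp_assoc (comp_assoc b') b'a comp_idl.
case: (locY (a \oc b')) => [/(idempotent_isomorphism ee) ab'|iso1].
  by exists b'.
case: X0; rewrite /is_zero.
have ee1 : (idm Y - a \oc b') \oc (idm Y - a \oc b') = idm Y - a \oc b'.
  by rewrite compBl comp_idl compBr comp_idr ee subrr subr0.
have /eqP := idempotent_isomorphism ee1 iso1.
rewrite -subr_eq0 addrAC subrr sub0r oppr_eq0 => /eqP ab0.
by rewrite -[LHS]comp_idl -b'a -!comp_assoc (comp_assoc a) ab0 comp0l comp0r.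
Qed.

(** After division by the whole sum, the first term and the rest add up to the identity, so one of
    them is invertible. *)
Lemma local_sum X (I : Type) (s : seq I) (P : pred I) (f : I -> hom X X) :
  local_object X -> isomorphism (\sum_(i <- s | P i) f i) ->
  exists i, P i /\ isomorphism (f i).
Proof.
move=> [X0 locX]; elim: s => [|i s IHs].
  by rewrite big_nil => -[g [gf _]]; case: X0; rewrite /is_zero -gf comp0r.
rewrite big_cons; case: ifP => [Pi [g [gf fg]]|_ /IHs//].
have g_iso : isomorphism g by exists (f i + \sum_(j <- s | P j) f j).
case: (locX (g \oc f i)) => [fi|].
  by exists i; split=> //; exact: isomorphism_comp_cancel fi.
rewrite -gf comp_addr addrAC subrr add0r => rest.
exact/IHs/isomorphism_comp_cancel/rest.
Qed.

Lemma indecomposable_isomorphic X Y : isomorphic X Y ->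
  indecomposable X -> indecomposable Y.
Proof.
move=> [f [g [gf fg]]] [X0 indX]; split.
  by move=> Y0; apply: X0; rewrite /is_zero -gf (zero_dom g Y0) comp0l.
move=> Z T [iZ [iT [pZ [pT [ZZ TT TZ ZT sum1]]]]]; apply: indX.
exists (g \oc iZ), (g \oc iT), (pZ \oc f), (pT \oc f).
split; rewrite -?comp_assoc ?(comp_assoc f) ?fg ?comp_idl //.
by rewrite -comp_addr !comp_assoc -comp_addl sum1 comp_idl gf.
Qed.

Lemma local_isomorphic X Y : isomorphic X Y -> local_object X -> local_object Y.
Proof.
move=> [f [g [gf fg]]] [X0 locX]; split.
  by move=> Y0; apply: X0; rewrite /is_zero -gf (zero_dom g Y0) comp0l.
have f_iso : isomorphism f by exists g.
have g_iso : isomorphism g by exists f.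
have conj_iso (h : hom Y Y) : isomorphism (g \oc h \oc f) -> isomorphism h.
  move=> ghf; have -> : h = f \oc (g \oc h \oc f) \oc g.
    by rewrite !comp_assoc fg comp_idl -comp_assoc fg comp_idr.
  by apply: isomorphism_comp => //; exact: isomorphism_comp.
move=> h; case: (locX (g \oc h \oc f)) => [/conj_iso|iso1]; [by left|right].
by apply: conj_iso; rewrite compBr comp_idr compBl gf.
Qed.

Lemma local_indecomposable X : local_object X -> indecomposable X.
Proof.
move=> [X0 locX]; split=> // Y Z [iY [iZ [pY [pZ [YY ZZ ZY YZ sum1]]]]].
have idem (T : C) (i : hom T X) (p : hom X T) : p \oc i = idm T ->
    (i \oc p) \oc (i \oc p) = i \oc p.
  by move=> pi; rewrite -comp_assoc (comp_assoc p) pi comp_idl.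
case: (locX (iY \oc pY)) => [/(idempotent_isomorphism (idem _ _ _ YY)) e1|].
  right; rewrite /is_zero -ZZ -[iZ]comp_idl -e1 -!comp_assoc YZ.
  by rewrite !comp0r.
rewrite -sum1 addrAC subrr add0r => /(idempotent_isomorphism (idem _ _ _ ZZ)) e1.
by left; rewrite /is_zero -YY -[iY]comp_idl -e1 -!comp_assoc ZY !comp0r.
Qed.

(** Zero leaves are allowed because a local object may become zero in the quotient category. *)
Inductive locally_decomposable : C -> Prop :=
| LDZero X : is_zero X -> locally_decomposable X
| LDLocal X : local_object X -> locally_decomposable X
| LDSum Y Z X : is_biproduct Y Z X -> locally_decomposable Y ->
    locally_decomposable Z -> locally_decomposable X.

Lemma biproduct_zerol Y Z X : is_biproduct Y Z X -> is_zero Y -> isomorphic Z X.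
Proof.
move=> [iY [iZ [pY [pZ [YY ZZ ZY YZ sum1]]]]] Y0; exists iZ, pZ; split=> //.
by rewrite -sum1 (zero_dom iY Y0) comp0l add0r.
Qed.

Lemma biproduct_zeror Y Z X : is_biproduct Y Z X -> is_zero Z -> isomorphic Y X.
Proof.
move=> [iY [iZ [pY [pZ [YY ZZ ZY YZ sum1]]]]] Z0; exists iY, pY; split=> //.
by rewrite -sum1 (zero_dom iZ Z0) comp0l addr0.
Qed.

Lemma isomorphic_sym X Y : isomorphic X Y -> isomorphic Y X.
Proof. by move=> [f [g [gf fg]]]; exists g, f. Qed.

(** At each biproduct of the decomposition tree one branch vanishes, so an indecomposable object is
    isomorphic to a local leaf. *)
Lemma indecomposable_local X :
  locally_decomposable X -> indecomposable X -> local_object X.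
Proof.
elim=> {X} [X X0 [] //|X //|Y Z X bip _ IHY _ IHZ indX].
case: (indX.2 _ _ bip) => [Y0|Z0].
  have ZX := biproduct_zerol bip Y0.
  exact/(local_isomorphic ZX)/IHZ/(indecomposable_isomorphic (isomorphic_sym ZX)).
have YX := biproduct_zeror bip Z0.
exact/(local_isomorphic YX)/IHY/(indecomposable_isomorphic (isomorphic_sym YX)).
Qed.

Lemma locally_decomposable_sum X : locally_decomposable X ->
  exists n (F : 'I_n -> C), (forall i, local_object (F i)) /\ is_finite_sum F X.
Proof.
elim=> {X} [X X0|X locX|Y Z X [iY [iZ [pY [pZ [YY ZZ ZY YZ sum1]]]]]].
- exists 0%N, (fun=> X); split; first by case.
  exists (fun=> 0), (fun=> 0); split; [by case|by case|by rewrite big_ord0 X0].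
- exists 1%N, (fun=> X); split=> //; exists (fun=> idm X), (fun=> idm X).
  split=> [i|i j|]; first by rewrite comp_idl.
    by rewrite !ord1.
  by rewrite big_ord1 comp_idl.
move=> _ [n [F [locF [iF [pF [FF F0 sumF]]]]]] _ [m [H [locH [iH [pH [HH H0 sumH]]]]]].
pose D (s : 'I_n + 'I_m) := match s with inl i => F i | inr j => H j end.
pose inj s : hom (D s) X := match s with
  inl i => iY \oc iF i | inr j => iZ \oc iH j end.
pose prj s : hom X (D s) := match s with
  inl i => pF i \oc pY | inr j => pH j \oc pZ end.
have diag s : prj s \oc inj s = idm (D s).
  case: s => i /=; rewrite -comp_assoc (comp_assoc _ _ (_ i)) ?YY ?ZZ comp_idl.
    exact: FF.
  exact: HH.
have off s t : s != t -> prj t \oc inj s = 0.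
  case: s t => i [] j /= ij; rewrite -comp_assoc (comp_assoc _ _ (_ i)) ?YY ?ZZ ?ZY ?YZ.
  - by rewrite comp_idl F0 //; apply: contra ij => /eqP->.
  - by rewrite comp0l comp0r.
  - by rewrite comp0l comp0r.
  - by rewrite comp_idl H0 //; apply: contra ij => /eqP->.
exists (n + m)%N, (fun i => D (split i)); split; first by move=> i; case: split.
exists (fun i => inj (split i)), (fun i => prj (split i)); split=> [i|i j ij|].
- exact: diag.
- by apply: off; apply: contra ij => /eqP/(can_inj splitK)->.
rewrite big_split_ord /=.
under eq_bigr => i _ do rewrite (unsplitK (inl i) : split (lshift m i) = _) /=.
under [X in _ + X]eq_bigr => i _ do rewrite (unsplitK (inr i) : split (rshift n i) = _) /=.
have -> : \sum_(i < n) iY \oc iF i \oc (pF i \oc pY)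
    = iY \oc (\sum_(i < n) iF i \oc pF i) \oc pY.
  rewrite comp_sumr comp_suml.
  by apply: eq_bigr => i _; rewrite !comp_assoc.
have -> : \sum_(i < m) iZ \oc iH i \oc (pH i \oc pZ)
    = iZ \oc (\sum_(i < m) iH i \oc pH i) \oc pZ.
  rewrite comp_sumr comp_suml.
  by apply: eq_bigr => i _; rewrite !comp_assoc.
by rewrite sumF sumH !comp_idr.
Qed.

Section Exchange.
Variables (I J : finType) (F : I -> C) (H : J -> C).
Hypothesis locF : forall i, local_object (F i).
Hypothesis locH : forall j, local_object (H j).

(* Mutually inverse matrices between the sums of the F i, i in A, and of the
   H j, j in B. An invertible entry phi j0 i0 is removed by passing to its Schur
   complement, whose inverse is a block of psi. *)
Lemma inverse_matrices_exchange n (A : {set I}) (B : {set J})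
    (phi : forall j i, hom (F i) (H j)) (psi : forall i j, hom (H j) (F i)) :
  #|A| = n ->
  (forall i, i \in A -> \sum_(j in B) psi i j \oc phi j i = idm (F i)) ->
  (forall i i', i \in A -> i' \in A -> i != i' ->
     \sum_(j in B) psi i' j \oc phi j i = 0) ->
  (forall j, j \in B -> \sum_(i in A) phi j i \oc psi i j = idm (H j)) ->
  (forall j j', j \in B -> j' \in B -> j != j' ->
     \sum_(i in A) phi j' i \oc psi i j = 0) ->
  #|B| = n /\ exists s : I -> option J,
    (forall i, i \in A -> exists2 j, s i = Some j & isomorphic (F i) (H j) /\ j \in B) /\
    {in A &, injective s}.
Proof.
elim: n A B phi psi => [|n IHn] A B phi psi.
  move=> /cards0_eq -> _ _ diagB _; split; last first.
    (* The values of [s] are optional because [J] may be empty. *)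
    by exists (fun=> None); split=> [i|i j]; rewrite inE.
  apply/eqP; rewrite cards_eq0; apply/eqP/setP => j; rewrite inE.
  apply/negP => jB; case: (locH j) => + _; apply.
  by rewrite /is_zero -(diagB j jB) big_set0.
move=> cardA diagA offA diagB offB.
have /card_gt0P[i0 i0A] : (0 < #|A|)%N by rewrite cardA.
have [j0 [j0B psiphi]] : exists j, j \in B /\ isomorphism (psi i0 j \oc phi j i0).
  have sum_iso : isomorphism (\sum_(j in B) psi i0 j \oc phi j i0).
    by rewrite diagA //; exists (idm _); rewrite comp_idl.
  exact: local_sum (locF i0) sum_iso.
have a_iso : isomorphism (phi j0 i0).
  by apply: local_retract psiphi => //; case: (locF i0).
have [a' [a'a aa']] := a_iso.
(* The relation between [i0] and [i'] says that the terms [psi i' j \oc phi j i0] with [j] other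
   than [j0] sum to [- (psi i' j0 \oc phi j0 i0)]. As [a'] inverts [phi j0 i0], the correction term
   restores exactly the missing summand at [j0]. *)
have redA i i' : i' \in A -> i' != i0 ->
    \sum_(j in B :\ j0) psi i' j \oc (phi j i - phi j i0 \oc a' \oc phi j0 i)
    = \sum_(j in B) psi i' j \oc phi j i.
  move=> i'A i'0; under eq_bigr do rewrite compBr !comp_assoc.
  rewrite sumrB -!comp_suml [in RHS](big_setD1 j0) //= addrC; congr (_ + _).
  have := offA i0 i' i0A i'A; rewrite eq_sym => /(_ i'0).
  rewrite (big_setD1 j0) //= addrC => /eqP; rewrite addr_eq0 => /eqP->.
  by rewrite !compNl opprK -!comp_assoc (comp_assoc (phi j0 i0)) aa' comp_idl.
have redB j j' : j \in B -> j != j0 ->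
    \sum_(i in A :\ i0) (phi j' i - phi j' i0 \oc a' \oc phi j0 i) \oc psi i j
    = \sum_(i in A) phi j' i \oc psi i j.
  move=> jB jj0; under eq_bigr do rewrite compBl -!comp_assoc.
  rewrite sumrB -!comp_sumr [in RHS](big_setD1 i0) //= addrC; congr (_ + _).
  have := offB j j0 jB j0B jj0.
  rewrite (big_setD1 i0) //= addrC => /eqP; rewrite addr_eq0 => /eqP->.
  by rewrite !compNr opprK (comp_assoc a') a'a comp_idl.
have [|i|i i'|j|j j'|cardB [s [sP s_inj]]] := IHn (A :\ i0) (B :\ j0)
  (fun j i => phi j i - phi j i0 \oc a' \oc phi j0 i) psi.
- by move: cardA; rewrite (cardsD1 i0) i0A => -[].
- by rewrite !inE => /andP[ii0 iA]; rewrite redA // diagA.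
- by rewrite !inE => /andP[_ iA] /andP[i'i0 i'A] ii'; rewrite redA // offA.
- by rewrite !inE => /andP[jj0 jB]; rewrite redB // diagB.
- by rewrite !inE => /andP[jj0 jB] /andP[_ j'B] jj'; rewrite redB // offB.
split; first by rewrite (cardsD1 j0) j0B cardB.
have s_not0 i : i \in A -> i != i0 -> s i != Some j0.
  move=> iA ii0; have [|j -> [_]] := sP i; first by rewrite !inE ii0.
  by rewrite !inE => /andP[jj0 _]; apply: contra jj0 => /eqP[->].
exists (fun i => if i == i0 then Some j0 else s i); split.
  move=> i iA; have [->|ii0] := eqVneq i i0.
    by exists j0 => //; split=> //; exists (phi j0 i0).
  have [|j sj [Fj]] := sP i; first by rewrite !inE ii0.
  by rewrite !inE => /andP[_ jB]; exists j.
move=> i i' iA i'A; have [->|ii0] := eqVneq i i0; have [->|i'i0] := eqVneq i' i0 => //.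
- by move=> /esym/eqP; rewrite (negPf (s_not0 _ i'A i'i0)).
- by move=> /eqP; rewrite (negPf (s_not0 _ iA ii0)).
by apply: s_inj; rewrite !inE ?ii0 ?i'i0.
Qed.

End Exchange.
End LocalObjects.

Theorem locally_decomposable_krull_schmidt (C : addcat) :
  (forall X : C, locally_decomposable X) -> krull_schmidt C.
Proof.
move=> decC; split=> [X|X n m F H indF indH [iF [pF [FF F0 sumF]]] [iH [pH [HH H0 sumH]]]].
  have [n [F [locF sumF]]] := locally_decomposable_sum (decC X).
  by exists n, F; split=> // i; exact: local_indecomposable.
have locF i := indecomposable_local (decC (F i)) (indF i).
have locH i := indecomposable_local (decC (H i)) (indH i).
(* Inserting a decomposition of the identity of [X] yields all four relations between the matrices
   of the [pH j \oc iF i] and the [pF i \oc iH j]. *)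
have sandwich (T U : C) (l : nat) (K : 'I_l -> C) (iK : forall i, hom (K i) X)
    (pK : forall i, hom X (K i)) (f : hom X U) (g : hom T X) :
    \sum_i iK i \oc pK i = idm X ->
    \sum_(i in [set: 'I_l]) (f \oc iK i) \oc (pK i \oc g) = f \oc g.
  move=> sumK; rewrite -[g in RHS]comp_idl -sumK.
  rewrite comp_suml comp_sumr.
  by apply: eq_big => [i|i _]; rewrite ?inE // !comp_assoc.
have [|i _|i i' _ _ ii'|j _|j j' _ _ jj'|] := @inverse_matrices_exchange C _ _ F H locF locH
  n [set: 'I_n] [set: 'I_m] (fun j i => pH j \oc iF i) (fun i j => pF i \oc iH j).
- by rewrite cardsT card_ord.
- by rewrite (sandwich _ _ _ _ _ _ _ _ sumH) FF.
- by rewrite (sandwich _ _ _ _ _ _ _ _ sumH) F0.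
- by rewrite (sandwich _ _ _ _ _ _ _ _ sumF) HH.
- by rewrite (sandwich _ _ _ _ _ _ _ _ sumF) H0.
rewrite cardsT card_ord => mn [s [sP s_inj]].
have sE i : exists j, s i = Some j /\ isomorphic (F i) (H j).
  by have [j sj [Fj _]] := sP i (in_setT i); exists j.
exists (fun i => sval (cid (sE i))); last by move=> i; case: (svalP (cid (sE i))).
apply: inj_card_bij; last by rewrite !card_ord mn.
move=> i i' ii'; apply: s_inj; rewrite ?inE //.
apply: etrans (svalP (cid (sE i))).1 _; rewrite ii'.
exact: esym (svalP (cid (sE i'))).1.
Qed.

Lemma quotient_locally_decomposable (C : addcat) (E : sequences C) (X : C) :
  locally_decomposable X -> @locally_decomposable (quot_proj E) X.
Proof.
elim=> {X} [X X0|X [X0 locX]|Y Z X [iY [iZ [pY [pZ [YY ZZ ZY YZ sum1]]]]] _ IHY _ IHZ].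
- by apply: LDZero; rewrite /is_zero /= X0; exact: quot_class0.
- case: (pselect (@is_zero (quot_proj E) X)) => [|nz]; first exact: LDZero.
  apply: LDLocal; split=> // f.
  have quot_iso (g : hom X X) : isomorphism g ->
      @isomorphism (quot_proj E) X X (quot_class E g).
    by move=> [h [hg gh]]; exists (quot_class E h); rewrite /= !quot_compE hg gh.
  rewrite -(quot_reprK f); case: (locX (quot_repr f)) => /quot_iso; first by left.
  have -> : quot_class E (idm X - quot_repr f)
      = quot_class E (idm X) - quot_class E (quot_repr f).
    by apply/eqP; rewrite eq_sym subr_eq -quot_classD subrK.
  by right.
apply: (@LDSum (quot_proj E) Y Z X) => //.
exists (quot_class E iY), (quot_class E iZ), (quot_class E pY), (quot_class E pZ).
by split; rewrite /= !quot_compE ?YY ?ZZ ?ZY ?YZ ?quot_class0 // -quot_classD sum1.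
Qed.

(** * Krull-Schmidt decompositions of complexes *)

(* {poly _} and char_poly require a ring with 1 != 0. *)
Definition nontrivial_ring (k : comPzRingType) of (1 : k) != 0 : Type := k.
HB.instance Definition _ (k : comPzRingType) (k1 : (1 : k) != 0) :=
  GRing.ComPzRing.on (nontrivial_ring k1).
HB.instance Definition _ (k : comPzRingType) (k1 : (1 : k) != 0) :=
  GRing.PzSemiRing_isNonZero.Build (nontrivial_ring k1) k1.

(** * Polynomials in an endomorphism *)

Section PolynomialAction.
Variables (k : comPzRingType) (k1 : (1 : k) != 0).
Local Notation R := (nontrivial_ring k1).
Implicit Types p q : {poly R}.

Section Endomorphism.
Variables (M : lmodType k) (f : {linear M -> M}).

Definition poly_act p (x : M) : M := \sum_(i < size p) (p`_i : k) *: iter i f x.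

Lemma poly_act_wide n p x : (size p <= n)%N ->
  poly_act p x = \sum_(i < n) (p`_i : k) *: iter i f x.
Proof.
move=> le_pn; rewrite /poly_act (big_ord_widen n (fun i => (p`_i : k) *: iter i f x)) //.
rewrite big_mkcond; apply: eq_bigr => i _.
by case: ltnP => // le_pi; rewrite nth_default // scale0r.
Qed.

Lemma poly_actD p q x : poly_act (p + q) x = poly_act p x + poly_act q x.
Proof.
rewrite (poly_act_wide _ (size_polyD p q)) (poly_act_wide _ (leq_maxl (size p) (size q))).
rewrite (poly_act_wide _ (leq_maxr (size p) (size q))) -big_split.
by apply: eq_bigr => i _; rewrite coefD; exact: scalerDl.
Qed.

Lemma poly_act0 x : poly_act 0 x = 0.
Proof. by rewrite /poly_act size_poly0 big_ord0. Qed.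

Lemma poly_actC c x : poly_act c%:P x = (c : k) *: x.
Proof. by rewrite (poly_act_wide x (size_polyC_leq1 c)) big_ord1 coefC. Qed.

Lemma poly_actXM p x : poly_act ('X * p) x = poly_act p (f x).
Proof.
rewrite (@poly_act_wide (size p).+1); last first.
  by apply: leq_trans (size_polyMleq _ _) _; rewrite size_polyX.
rewrite big_ord_recl coefXM scale0r add0r; apply: eq_bigr => i _.
by rewrite coefXM /= -iterSr.
Qed.

Lemma poly_act_linear p : linear (poly_act p).
Proof.
have iterL i : linear (iter i f) by elim: i => // i IHi a x y; rewrite /= IHi linearP.
move=> a x y; rewrite scaler_sumr -big_split; apply: eq_bigr => i _.
by rewrite iterL scalerDr !scalerA mulrC.
Qed.

Lemma poly_act_comm p x : f (poly_act p x) = poly_act p (f x).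
Proof.
rewrite raddf_sum; apply: eq_bigr => i _.
by rewrite -iterSr iterS; exact: (linearZZ f).
Qed.

Lemma poly_actCM c q x : poly_act (c%:P * q) x = (c : k) *: poly_act q x.
Proof.
elim/poly_ind: q x => [|q d IHq] x; first by rewrite mulr0 !poly_act0 scaler0.
rewrite (mulrC q) mulrDr mulrCA !poly_actD !poly_actXM IHq scalerDr -polyCM.
by rewrite !poly_actC scalerA.
Qed.

Lemma poly_actM p q x : poly_act (p * q) x = poly_act p (poly_act q x).
Proof.
elim/poly_ind: p x => [|p c IHp] x; first by rewrite mul0r !poly_act0.
rewrite (mulrC p) mulrDl -mulrA !poly_actD !poly_actXM IHp -poly_act_comm.
by rewrite poly_actC poly_actCM.
Qed.

Lemma poly_act_annihilator (I : finType) (e0 : I -> M) :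
  (forall x, exists a : I -> k, x = \sum_i a i *: e0 i) ->
  exists2 p, p \is monic & forall x, poly_act p x = 0.
Proof.
move=> e0P; pose n := #|I|.
(* A zero vector is added to the family so that the matrix has positive size, as [horner_mx]
   demands. *)
have [e eP] : exists e : 'I_n.+1 -> M, forall x, exists a : 'I_n.+1 -> k,
    x = \sum_i a i *: e i.
  exists (fun i => if unlift ord0 i is Some j then e0 (enum_val j) else 0) => x.
  have [a ->] := e0P x.
  exists (fun i => if unlift ord0 i is Some j then a (enum_val j) else 0).
  rewrite big_ord_recl unlift_none scaler0 add0r.
  rewrite (reindex (@enum_val I predT)) /=; last exact/onW_bij/enum_val_bij.
  by apply: eq_bigr => i _; rewrite liftK.
pose a i := sval (cid (eP (f (e i)))).
have aP i : f (e i) = \sum_j a i j *: e j by rewrite /a; case: cid.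
pose A : 'M[R]_n.+1 := \matrix_(i, j) a i j.
have actE p i : poly_act p (e i) = \sum_j (horner_mx A p i j : k) *: e j.
  elim/poly_ind: p i => [|p c IHp] i.
    by rewrite poly_act0 rmorph0 big1 // => j _; rewrite mxE scale0r.
  have actL := poly_act_linear p.
  pose g : {linear M -> M} := HB.pack (poly_act p) (GRing.isLinear.Build k _ _ _ _ actL).
  rewrite (mulrC p) poly_actD poly_actXM poly_actC aP.
  rewrite -[poly_act p]/(g : _ -> _) raddf_sum.
  have -> : \sum_j g (a i j *: e j) = \sum_l (\sum_j a i j * horner_mx A p j l : k) *: e l.
    under eq_bigr => j _ do rewrite (linearZZ g) [g _]IHp scaler_sumr.
    rewrite exchange_big; apply: eq_bigr => l _.
    by rewrite scaler_suml; apply: eq_bigr => j _; rewrite scalerA.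
  have -> : (c : k) *: e i = \sum_l (c *+ (i == l) : k) *: e l.
    rewrite (bigD1 i) //= eqxx mulr1n big1 ?addr0 // => l li.
    by rewrite eq_sym (negPf li) mulr0n scale0r.
  rewrite -big_split; apply: eq_bigr => l _ /=; rewrite -scalerDl; congr (_ *: _).
  rewrite rmorphD rmorphM /= horner_mx_X horner_mx_C !mxE; congr (_ + _).
  by apply: eq_bigr => j _; rewrite mxE.
exists (char_poly A); first exact: char_poly_monic.
move=> x; have [c ->] := eP x.
have actL := poly_act_linear (char_poly A).
pose g : {linear M -> M} :=
  HB.pack (poly_act (char_poly A)) (GRing.isLinear.Build k _ _ _ _ actL).
rewrite -[poly_act _]/(g : _ -> _) raddf_sum big1 // => i _.
apply: etrans (linearZZ g _ _) _; rewrite [g _]actE Cayley_Hamilton big1 ?scaler0 // => j _.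
by rewrite mxE scale0r.
Qed.

End Endomorphism.

(* F is evaluation of polynomials at f. Writing the lowest term of p as a
   multiple of 'X^m, one gets f ^ m = f ^ m.+1 o F r, and f ^ m o F (r ^ m) is an
   idempotent projecting onto the part where f is invertible. *)
Lemma fitting_idempotent (C : preaddcat) (X : C) (f : hom X X)
    (F : {poly R} -> hom X X) p :
  field_ring k ->
  {morph F : q q' / q + q'} -> {morph F : q q' / q * q' >-> q \oc q'} ->
  F 1 = idm X -> F 'X = f -> p != 0 -> F p = 0 ->
  exists e : hom X X, [/\ e \oc e = e, e = idm X -> isomorphism f
    & e = 0 -> isomorphism (idm X - f)].
Proof.
move=> [_ kinv] FD FM F1 FX p0 Fp.
have F0 : F 0 = 0 by apply: (addrI (F 0)); rewrite -FD !addr0.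
have FN q : F (- q) = - F q.
  by apply/eqP; rewrite -subr_eq0 opprK -FD addNr F0.
have FC q q' : F q \oc F q' = F q' \oc F q by rewrite -!FM mulrC.
(* The factor ['X] makes the lowest degree [m] positive, so that [q] below is divisible by ['X] and
   [f] is invertible whenever [F q] is the identity. *)
pose p' := p * 'X.
have Fp' : F p' = 0 by rewrite FM Fp comp0l.
have exm : exists m, p'`_m != 0.
  exists (size p); rewrite coefMX size_poly_eq0 (negPf p0).
  by rewrite -lead_coefE lead_coef_eq0.
have [m pm0 m_min] : exists2 m, p'`_m != 0 & forall i, (i < m)%N -> p'`_i = 0.
  have [m pm mP] := ex_minnP exm; exists m => // i im; apply/eqP; apply/negPn/negP => /mP.
  by rewrite leqNgt im.
have m_gt0 : (0 < m)%N by rewrite lt0n; apply: contraNneq pm0 => ->; rewrite coefMX eqxx.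
have [c cp] := kinv (p'`_m) (fun h => negP pm0 (introT eqP h)).
pose r : {poly R} := - ((c : R)%:P * drop_poly m.+1 p').
have XmE : 'X^m = (c : R)%:P * p' + 'X^(m.+1) * r :> {poly R}.
  have tp : take_poly m.+1 p' = (p'`_m)%:P * 'X^m.
    apply/polyP => i; rewrite coef_take_poly coefCM coefXn ltnS.
    have [->|im] := eqVneq i m; first by rewrite leqnn mulr1.
    by rewrite mulr0; case: ifP => // le_im; rewrite m_min // ltn_neqAle im.
  have cpX : (c : R)%:P * ((p'`_m)%:P * 'X^m) = 'X^m :> {poly R}.
    rewrite mulrA -polyCM (_ : (c : R) * p'`_m = 1); last exact: cp.
    by rewrite polyC1 mul1r.
  rewrite -{1}(poly_take_drop m.+1 p') tp mulrDr cpX /r mulrN (mulrC 'X^(m.+1)).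
  by rewrite mulrA addrK.
have Fm : F 'X^m = F ('X^(m.+1) * r).
  by rewrite {1}XmE FD (FM _ p') Fp' comp0r add0r.
have Fmj j : F 'X^m = F ('X^(m + j) * r ^+ j).
  elim: j => [|j IHj]; first by rewrite addn0 expr0 mulr1.
  have -> : 'X^(m + j.+1) * r ^+ j.+1 = ('X^(m.+1) * r) * ('X^j * r ^+ j) :> {poly R}.
    by rewrite addnS -addSn exprD (exprS r) mulrACA.
  by rewrite FM -Fm -FM mulrA -exprD.
pose q := 'X^m * r ^+ m.
have Fmq : F 'X^m = F 'X^m \oc F q by rewrite -FM mulrA -exprD -Fmj.
have qq : F q \oc F q = F q.
  have qE : F q = F (r ^+ m) \oc F 'X^m by rewrite -FM mulrC.
  by rewrite {1}qE -comp_assoc -Fmq -qE.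
exists (F q); split=> [//|q1|q0].
  have qE : q = 'X * ('X^(m.-1) * r ^+ m) by rewrite mulrA -exprS prednK.
  exists (F ('X^(m.-1) * r ^+ m)); rewrite -FX FC -FM -qE.
  by [].
(* Here [f] is nilpotent, and the finite geometric series inverts [idm X - f]. *)
have Xm0 : F 'X^m = 0 by rewrite Fmq q0 comp0r.
have inv1 : F ((1 - 'X) * (\sum_(i < m) 'X^i)) = idm X.
  rewrite -opprB mulNr -subrX1 opprB FD FN Xm0 F1.
  by rewrite oppr0 addr0.
exists (F (\sum_(i < m) 'X^i)); rewrite -FX -F1 -FN -FD FC -FM inv1.
by [].
Qed.

End PolynomialAction.

Section KrullSchmidtComplexes.
Variables (k : comPzRingType) (G : finGroupType).
Hypothesis k_field : field_ring k.
Local Notation CC := (Cpx k G true Bounded).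

Lemma Cpx_splits_idempotents fg b : splits_idempotents (Cpx k G fg b).
Proof.
move=> X e ee.
have [Y [i [p [pi ip]]]] :=
  complexes_split_idempotents (@Mod_splits_idempotents k G)
    (ee : @comp (Cpx_all k G) _ _ _ e e = e).
have pin n : p n \oc i n = idm (Y n) by exact: (congr1 (fun h : chain_map Y Y => h n) pi).
have YC : in_Cpx fg b Y.
  apply: in_Cpx_near (svalP X) _ _ => [kX n|n _ X0 _].
    by apply: kspan_retract (kX n); exists (i n), (p n).
  by rewrite /is_zero -pin (zero_cod (i n) X0) comp0r.
by exists (exist _ Y YC), i, p.
Qed.

Lemma Cpx_fitting (X : CC) (f : hom X X) : exists e : hom X X,
  [/\ e \oc e = e, e = idm X -> isomorphism f & e = 0 -> isomorphism (idm X - f)].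
Proof.
have k1 : (1 : k) != 0 by apply/eqP; case: k_field.
pose R := nontrivial_ring k1.
have [fgX [[N XN] [N' XN']]] := svalP X.
pose fn n : ghom (sval X n) (sval X n) := (f : chain_map _ _) n.
pose fl n : {linear (sval X n : gmodType k G) -> _} := fn n.
have actJ n (p : {poly R}) (g : G) x :
    poly_act (fl n) p (gact g x) = gact g (poly_act (fl n) p x).
  rewrite raddf_sum; apply: eq_bigr => i _ /=; rewrite linearZZ; congr (_ *: _).
  by elim: (i : nat) => // j /= ->; exact: ghomJ.
pose act p n : hom (sval X n) (sval X n) := GHom (poly_act_linear (fl n) p) (actJ n p).
have actC p n : act p (n + 1) \oc diff (sval X) n = diff (sval X) n \oc act p n.
  apply: ghom_ext => x; rewrite [RHS](raddf_sum (diff (sval X) n : ghom _ _)).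
  apply: eq_bigr => i _.
  apply: etrans (esym (linearZZ (diff (sval X) n : ghom _ _) _ _)); congr (_ *: _).
  elim: (i : nat) => // j /= ->.
  exact: (congr1 (fun h : ghom _ _ => h _) (cmapP (f : chain_map _ _) n)).
pose F p : hom X X := ChainMap (actC p).
have ann n : exists2 p : {poly R}, p \is monic & forall x, poly_act (fl n) p x = 0.
  have /kspan_fin_gen[I [e eP]] := fgX isT n; exact: poly_act_annihilator eP.
pose P n := s2val (cid2 (ann n)).
(* One polynomial must serve all degrees: it is the product of the annihilators over the degrees
   from [N'] to [N], outside of which the terms vanish. *)
pose p := \prod_(i < `|N - N'|.+1) P (N' + i%:Z).
have p_monic : p \is monic by apply: monic_prod => i _; exact: s2valP (cid2 (ann _)).
apply: (@fitting_idempotent k k1 CC X f F p) => //.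
- by move=> q q'; apply: chain_map_ext => n; apply: ghom_ext => x; exact: poly_actD.
- by move=> q q'; apply: chain_map_ext => n; apply: ghom_ext => x; exact: poly_actM.
- apply: chain_map_ext => n; apply: ghom_ext => x.
  by apply: etrans (poly_actC _ _ _) _; exact: scale1r.
- apply: chain_map_ext => n; apply: ghom_ext => x.
  apply: etrans (_ : poly_act (fl n) ('X * 1) x = _); first by rewrite mulr1.
  by rewrite poly_actXM; apply: etrans (poly_actC _ _ _) _; exact: scale1r.
- exact: monic_neq0.
apply: chain_map_ext => n; have [nN'|N'n] := ltP n N'; first exact: zero_dom (XN' n nN').
have [Nn|nN] := ltP N n; first exact: zero_dom (XN n Nn).
apply: ghom_ext => x; rewrite /=.
have li : (`|n - N'| < `|N - N'|.+1)%N by lia.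
have nE : N' + (Ordinal li)%:Z = n by rewrite /=; lia.
rewrite /p (bigD1 (Ordinal li)) //= nE mulrC poly_actM.
have -> : poly_act (fl n) (P n) x = 0 by exact: (s2valP' (cid2 (ann n))).
exact: (linear0 (act _ n : ghom _ _)).
Qed.

(** An upper bound [n] for the dimension over k. *)
Definition spanned n (M : gmodType k G) := exists e : 'I_n -> M,
  forall x, exists a : 'I_n -> k, x = \sum_i a i *: e i.

(** A nonzero element of the kernel has a nonzero, hence invertible, coefficient at some [e i0];
    subtracting multiples of it removes [e i0] from the spanning family of the image. *)
Lemma spanned_drop n (M N : gmodType k G) (p : ghom M N) z :
  (forall y, exists x, p x = y) -> z <> 0 -> p z = 0 -> spanned n M ->
  (0 < n)%N /\ spanned n.-1 N.
Proof.
move=> p_surj z0 pz [e eP]; have [a za] := eP z.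
have [i0 ai0] : exists i, a i <> 0.
  apply: contrapT => a0; apply: z0; rewrite za big1 // => i _.
  suff -> : a i = 0 by rewrite scale0r.
  by apply: contrapT => ai; apply: a0; exists i.
have n_gt0 : (0 < n)%N := leq_ltn_trans (leq0n i0) (ltn_ord i0).
split=> //; case: n e eP a za i0 ai0 n_gt0 => // n e eP a za i0 ai0 _ /=.
have [c ca] := k_field.2 _ ai0.
exists (fun j => p (e (lift i0 j))) => y; have [x <-] := p_surj y; have [b xb] := eP x.
exists (fun j => b (lift i0 j) - b i0 * c * a (lift i0 j)).
have pcz : p ((b i0 * c) *: z) = 0.
  exact: etrans (linearZZ p _ _) (etrans (congr1 (GRing.scale _) pz) (scaler0 _ _)).
have -> : p x = p (x - (b i0 * c) *: z) by rewrite raddfB /= pcz subr0.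
have -> : x - (b i0 * c) *: z = \sum_i (b i - b i0 * c * a i) *: e i.
  rewrite [in LHS]xb [in LHS]za scaler_sumr -sumrB; apply: eq_bigr => i _.
  by rewrite scalerBl scalerA.
rewrite (bigD1_ord i0) //= -mulrA ca mulr1 subrr scale0r add0r raddf_sum.
by apply: eq_bigr => j _; exact: (linearZZ p).
Qed.

Lemma spanned_surj n (M N : gmodType k G) (p : ghom M N) :
  (forall y, exists x, p x = y) -> spanned n M -> spanned n N.
Proof.
move=> p_surj [e eP]; exists (fun i => p (e i)) => y; have [x <-] := p_surj y.
have [a ->] := eP x; exists a; rewrite raddf_sum.
by apply: eq_bigr => i _; exact: (linearZZ p).
Qed.

Lemma kspan_spanned (M : gmodType k G) : kspan M -> exists n, spanned n M.
Proof.
move=> [I [e eP]]; exists #|I|, (fun i => e (enum_val i)) => x; have [a ->] := eP x.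
exists (fun i => a (enum_val i)).
by rewrite (reindex (@enum_val I predT)) //=; exact/onW_bij/enum_val_bij.
Qed.

(** The induction measure is the number of generators in a fixed window of [L] degrees. It drops for
    [Y] because a nonzero element of [Z] in some degree is killed by the projection to [Y]. *)
Lemma summand_spanned (Y Z X : CC) (d : int -> nat) (a : int) (L : nat) :
  is_biproduct Y Z X -> ~ is_zero Z ->
  (forall n, spanned (d n) (sval X n)) ->
  (forall n, ~~ (a <= n < a + L%:Z) -> is_zero (sval X n)) ->
  exists d' : int -> nat, [/\ forall n, spanned (d' n) (sval Y n),
    forall n, ~~ (a <= n < a + L%:Z) -> is_zero (sval Y n)
    & (\sum_(i < L) d' (a + i%:Z)%R < \sum_(i < L) d (a + i%:Z)%R)%N].
Proof.
move=> [iY [iZ [pY [pZ bip]]]] Z0 dX aX.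
have bipn := biproduct_term (bip : @biproduct (Cpx_all k G) _ _ _ iY iZ pY pZ).
have pY_surj n (y : sval Y n : gmodType k G) :
    exists x, ((pY : chain_map _ _) n : ghom _ _) x = y.
  exists (((iY : chain_map _ _) n : ghom _ _) y).
  by have [YY _ _ _ _] := bipn n; exact: (congr1 (fun h : ghom _ _ => h y) YY).
have zY n : ~~ (a <= n < a + L%:Z) -> is_zero (sval Y n).
  move=> /aX X0; have [YY _ _ _ _] := bipn n.
  by rewrite /is_zero -YY (zero_cod ((iY : chain_map _ _) n) X0) comp0r.
have [n0 Zn0] : exists n, ~ is_zero (sval Z n).
  apply: contrapT => Zn; apply: Z0; apply: chain_map_ext => n /=.
  by apply: contrapT => Zn0; apply: Zn; exists n.
have [_ ZZ _ YZ _] := bipn n0.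
have [z z0] : exists z : sval Z n0 : gmodType k G, z <> 0.
  apply: contrapT => zZ; apply: Zn0; apply: ghom_ext => z.
  by apply: contrapT => z0; apply: zZ; exists z.
have n0_range : a <= n0 < a + L%:Z.
  apply/negPn/negP => /aX X0; apply: Zn0.
  by rewrite /is_zero -ZZ (zero_cod ((iZ : chain_map _ _) n0) X0) comp0r.
have [||[d_gt0 dY]] := @spanned_drop _ _ _ ((pY : chain_map _ _) n0 : ghom _ _)
  (((iZ : chain_map _ _) n0 : ghom _ _) z) (pY_surj n0) _ _ (dX n0).
- move=> iz0; apply: z0.
  have : ((pZ : chain_map _ _) n0 : ghom _ _) (((iZ : chain_map _ _) n0 : ghom _ _) z) = z.
    exact: (congr1 (fun h : ghom _ _ => h z) ZZ).
  by rewrite iz0 raddf0 => <-.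
- exact: (congr1 (fun h : ghom _ _ => h z) YZ).
exists (fun n => if n == n0 then (d n).-1 else d n); split=> //.
  move=> n; case: eqP => [->//|_]; exact: spanned_surj (pY_surj n) (dX n).
have li : (`|n0 - a| < L)%N by lia.
have n0E : a + (Ordinal li)%:Z = n0 by rewrite /=; lia.
rewrite (bigD1 (Ordinal li)) //= [ltnRHS](bigD1 (Ordinal li)) //=.
rewrite n0E eqxx -addSn prednK // leq_add2l; apply: leq_sum => i _.
by case: ifP => // _; exact: leq_pred.
Qed.

Lemma Cpx_locally_decomposable (X : CC) : locally_decomposable X.
Proof.
have [fgX [[N XN] [N' XN']]] := svalP X.
pose cd n := cid (kspan_spanned (iffRL (kspan_fin_gen _) (fgX isT n))).
pose L := `|N - N'|.+1.
have aX n : ~~ (N' <= n < N' + L%:Z) -> is_zero (sval X n).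
  rewrite negb_and -!ltNge => /orP[nN'|]; first exact: XN'.
  by rewrite -leNgt => Ln; apply: XN; rewrite /L in Ln; lia.
have [d dX] : exists d, forall n, spanned (d n) (sval X n).
  by exists (fun n => sval (cd n)) => n; exact: svalP (cd n).
move: N' L aX {XN XN' fgX cd} => a L aX.
have [s] := ubnP (\sum_(i < L) d (a + i%:Z)%R)%N.
elim: s X d dX aX => // s IHs X d dX aX ds.
case: (pselect (is_zero X)) => [|X0]; first exact: LDZero.
(* Either a nontrivial idempotent cuts [X] into two smaller summands, or every idempotent supplied
   by [Cpx_fitting] is trivial and [X] is local. *)
case: (pselect (exists e : hom X X, [/\ e \oc e = e, e <> idm X & e <> 0])).
  move=> [e [ee e1 e0]]; have [Y [i [p [pi ip]]]] := Cpx_splits_idempotents ee.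
  have [Z [j [q [bip jq]]]] := idempotent_biproduct (@Cpx_splits_idempotents _ _) pi.
  have Y0 : ~ is_zero Y by move=> Y0; apply: e0; rewrite -ip (zero_dom i Y0) comp0l.
  have Z0 : ~ is_zero Z.
    move=> Z0; apply: e1; apply/esym/eqP; rewrite -subr_eq0 -ip -jq.
    by rewrite (zero_dom j Z0) comp0l.
  have bipYZ : is_biproduct Y Z X by exists i, j, p, q.
  have bipZY : is_biproduct Z Y X.
    by have [? ? ? ? ?] := bip; exists j, i, q, p; split=> //; rewrite addrC.
  apply: (LDSum bipYZ).
    have [d' [dY aY lt_d]] := summand_spanned bipYZ Z0 dX aX.
    by apply: IHs dY aY _; exact: leq_trans lt_d _.
  have [d' [dZ aZ lt_d]] := summand_spanned bipZY Y0 dX aX.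
  by apply: IHs dZ aZ _; exact: leq_trans lt_d _.
move=> no_idem; apply: LDLocal; split=> // f.
have [e [ee e1 e0]] := Cpx_fitting f.
case: (pselect (e = idm X)) => [/e1|ne1]; first by left.
case: (pselect (e = 0)) => [/e0|ne0]; first by right.
by case: no_idem; exists e.
Qed.

End KrullSchmidtComplexes.

Theorem proposition3p6 (k : comPzRingType) (G : finGroupType) (V : gmodType k G)
    (r : nat) (r_gt0 : (0 < r)%N) (V_free : free_of_rank V r) :
  (forall (fg : bool) (b : boundedness),
     [/\ frobenius (Vts V fg b),
         forall X : Cpx k G fg b,
           projective (Vts V fg b) X <-> split_contractible_Vproj V (sval X),
         forall (W : gmodType k G) (n : int) (W_in : in_Cpx fg b (Cpx_disk W n)),
           Vprojective V W ->
           projective (Vts V fg b) (exist _ (Cpx_disk W n) W_in : Cpx k G fg b)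
       & forall X : Cpx k G fg b,
           projective (Vts V fg b) X <-> sum_of_Vdisks V (sval X)]) /\
  (field_ring k -> krull_schmidt (K_Vts V true Bounded)).
Proof.
have [e [co [co_lin co_sum co_basis]]] := free_coordinates V_free.
split=> [fg b|k_field]; last first.
  apply: locally_decomposable_krull_schmidt => X.
  exact/quotient_locally_decomposable/Cpx_locally_decomposable.
have projP := Vts_projectiveP co_lin co_sum co_basis r_gt0 (fg := fg) (b := b).
split=> [|//|W n W_in VW|X]; first exact: Vts_frobenius co_lin co_sum co_basis r_gt0 fg b.
  exact/projP/disk_split_contractible.
rewrite projP; exact: sum_of_VdisksP co_lin co_sum co_basis r_gt0 (sval X).
Qed.
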